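(* Let $\{\boldsymbol{w},p\}$, $\boldsymbol{w}=(u,v)\in C^2(\overline{\Omega_0})$, be a solution of the system $$\Delta \boldsymbol{w}-(\boldsymbol{w}\cdot\nabla)\boldsymbol{w}-b\,\partial_y\boldsymbol{w}=\nabla p,\qquad \nabla\cdot\boldsymbol{w}=0\qquad\text{in }\Omega_0,$$ with the boundary condition $v(x,0)=0$, $\partial_y u(x,0)=0$ for $|x|>r_0$. Assume that $$\int_{\Omega_0}|\nabla\boldsymbol{w}|^{2}\,dx\,dy<\infty$$ and that, in polar coordinates, $b\,u(r,0)=b\,u(r,\pi)$ for all $r>r_0$. Then: (i) $|p(r,\theta)|=o(\log r)$ as $r\to\infty$, uniformly for all $\theta\in[0,\pi]$. (ii) Up to adding a constant to $p$, for every $\theta_0\in[0,\pi]$, $$\lim_{r\to\infty}p(r,\theta_0)=0;$$ that is, there is a constant $c\in\mathbb{R}$, independent of $\theta_0$, such that $\lim_{r\to\infty}(p(r,\theta_0)-c)=0$ for every $\theta_0\in[0,\pi]$.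
   Context: Fix $r_0>0$ and a real constant $b$. Points of the plane are $(x,y)$, with polar coordinates $x=r\cos\theta$, $y=r\sin\theta$; a function $f$ in polar coordinates is written $f(r,\theta)$. $\Omega_0=\{(r,\theta): r>r_0,\ 0<\theta<\pi\}=\mathbb{R}^2_+\setminus\overline{B_{r_0}}$, where $\mathbb{R}^2_+=\{y>0\}$ and $B_{r_0}$ is the disc of radius $r_0$ centered at $0$. $C^2(\overline{\Omega_0})$ means that all derivatives up to order 2 extend continuously to $\overline{\Omega_0}$ (no boundedness at infinity is assumed); the values of $p$ on the boundary are those of its continuous extension. (The system is the case $a=0$ of $\Delta \boldsymbol{w}-(\boldsymbol{w}\cdot\nabla)\boldsymbol{w}-(ay\partial_x+b\partial_y)\boldsymbol{w}-(av,0)=\nabla p$, $\nabla\cdot\boldsymbol{w}=0$.) *)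

(* Defs.v *)
From HB Require Import structures.
From mathcomp Require Import all_boot all_order all_algebra.
From mathcomp Require Import all_classical all_reals all_analysis.

Set Implicit Arguments.
Unset Strict Implicit.
Unset Printing Implicit Defensive.

Import Order.TTheory GRing.Theory Num.Theory.
Import numFieldNormedType.Exports.

Local Open Scope classical_set_scope.
Local Open Scope ring_scope.

Section HalfPlane.
Context {R : realType}.
Implicit Types (f u v p : R * R -> R) (D : set (R * R)) (z : R * R).

Definition ex : R * R := (1, 0).
Definition ey : R * R := (0, 1).

Definition dx f : R * R -> R := 'D_ex f.
Definition dy f : R * R -> R := 'D_ey f.

Definition laplacian f z : R := dx (dx f) z + dy (dy f) z.

(* Only the values of f on D matter: the extension g is unrelated to the
   values that the total function f takes outside D. *)
Definition extends_to_closure D f : Prop :=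
  exists2 g : R * R -> R,
    {within closure D, continuous g} & (forall z, D z -> g z = f z).

(* C^k of the closure of an open set D. *)
Fixpoint Ck_closure (k : nat) D f : Prop :=
  extends_to_closure D f /\
  match k with
  | 0%N => True
  | k'.+1 =>
      [/\ forall z, D z -> derivable f z ex /\ derivable f z ey,
          Ck_closure k' D (dx f) & Ck_closure k' D (dy f)]
  end.

(* The continuous extension of f from D to the closure of D; it agrees with f
   at the points of the open set D at which f is continuous. *)
Definition ext D f z : R := lim (f @ within D (nbhs z)).

Definition polar f (r t : R) : R := f (r * cos t, r * sin t).

(* The norm of R * R in the library is the sup norm, hence the explicit
   Euclidean distance to the origin. *)
Definition Omega0 (r0 : R) : set (R * R) :=
  [set z | 0 < z.2 /\ r0 < Num.sqrt (z.1 ^+ 2 + z.2 ^+ 2)].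

Definition momentum_eq (b : R) u v f (gradp : R * R -> R) z : Prop :=
  laplacian f z - (u z * dx f z + v z * dy f z) - b * dy f z = gradp z.

Definition system_solution (b : R) D u v p : Prop :=
  forall z, D z ->
    [/\ derivable p z ex /\ derivable p z ey,
        momentum_eq b u v u (dx p) z,
        momentum_eq b u v v (dy p) z &
        dx u z + dy v z = 0].

Definition sqr_grad u v z : R :=
  dx u z ^+ 2 + dy u z ^+ 2 + dx v z ^+ 2 + dy v z ^+ 2.

Definition dirichlet_integral D u v : \bar R :=
  (\int[lebesgue_measure \x lebesgue_measure]_(z in D) (sqr_grad u v z)%:E)%E.

End HalfPlane.

(* Main.v *)
(** In fact p converges uniformly at infinity to one constant, which gives both
    claims. Shifting v by b turns the equation into a stationary Navier-Stokes
    flow W = (u, v + b) whose vorticity o = v_x - u_y vanishes on the axis.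

    Half circles: d/d rho of the mean of p over the half circle of radius rho
    about a point x of the axis is a quadratic expression in W minus a constant,
    controlled by the energy through Wirtinger's inequality, plus the term
    b (u(x + rho) - u(x - rho)) / rho. For circles about the origin, and for the
    sum over the circles about r and - r, the latter vanishes because b u is even.
    Hence the mean of p over half circles about 0 tends to some c, and
    p(r, 0) + p(- r, 0) - 2 c (each term p(+-r, 0) - c when b = 0) is controlled
    by the mean of |p - c| over a half annulus of radii comparable to r.

    Axis: testing the vorticity equation with arctan (o / d) in logarithmic polar
    coordinates, a Kato-type identity makes the weighted vorticity dissipation
    finite; letting d -> 0 shows that the flux |o_y| is integrable on the axis.
    This flux is the derivative of the head p + |W|^2 / 2, which therefore
    converges along each half axis. Hence u is bounded on the axis, and
    |p - c| tends to 0 in mean over half annuli and on the axis. If b <> 0 then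
    u(r, 0) = u(- r, 0), so p(r, 0) - p(- r, 0) converges besides the sum, and the
    limits of p(r, 0) and p(- r, 0) can only be c.

    Interior: away from the axis p is compared with its averages over full discs.
    Near the axis p - p(x, 0) is represented over a half disc by a Dirichlet Green
    function with a regularised pole, and the div-curl structure of the quadratic
    terms makes the right-hand side small with the energy. *)

Require Import Defs.
From HB Require Import structures.
From mathcomp Require Import all_boot all_order all_algebra.
From mathcomp Require Import all_classical all_reals all_analysis.
From mathcomp Require Import ring lra measurable_realfun.

Set Implicit Arguments.
Unset Strict Implicit.
Unset Printing Implicit Defensive.

Import Order.TTheory GRing.Theory Num.Theory.
Import numFieldNormedType.Exports.

Local Open Scope classical_set_scope.
Local Open Scope ring_scope.

(** * Integrals of continuous functions *)

(* [lra] translates the whole context, so it is slow when many facts are in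
   scope: among the hypotheses introduced after [H], [slra H] keeps the 7 most
   recent (in)equalities, and all of them only if these do not suffice. *)
Ltac keep_after stop n :=
  lazymatch goal with
  | H : ?T |- _ =>
    tryif constr_eq H stop then idtac else
    (lazymatch type of T with
     | Prop =>
        let keep := (lazymatch n with
          | 0%N => first [clear H | revert H]; keep_after stop n
          | S ?m => revert H; keep_after stop m
          end) in
        lazymatch T with
        | is_true _ => keep
        | _ = _ => keep
        | _ => clear H; keep_after stop n
        end
     | _ => first [clear H | try clearbody H; revert H]; keep_after stop n
     end)
  end.
Ltac slra stop :=
  first [solve [keep_after stop 7%N; intros; lra] | keep_after stop 200%N; intros; lra].

(** Four obstacles shape the proof. The vorticity is only $C^1$, so its transport equation is used
    in first-order form: up to multiples of the vorticity, the gradient of the head is the rotated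
    vorticity gradient, and integrals of Jacobians are differentiated instead of second derivatives.
    The mean square speed is a priori only $O(\log r)$; the Kato estimate survives because its free
    weight is taken of order $1/\log r$ and the energy tail is small. The speed on the axis and the
    pressure bound each other; the loop closes because a pressure block is at most a constant plus
    an arbitrarily small multiple of the squared speed, which the head absorbs. Near the axis the
    discs of the interior argument shrink, so every constant of the Green estimate must be
    independent of the height; pairing the rotated gradient with $o - uv$ leaves $v$, which vanishes
    on the axis, as the only undifferentiated velocity. Every function is extended to the whole
    plane or strip, so that integrals are increments of primitives and Lebesgue integration enters
    only through the energy hypothesis. *)

Section ContinuousCombinators.
Context {R : realType} {T : topologicalType}.
Implicit Types (f g : T -> R).

Lemma ctsD f g : continuous f -> continuous g -> continuous (fun x => f x + g x).
Proof. by move=> cf cg x; apply: cvgD; [exact: cf|exact: cg]. Qed.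

Lemma ctsN f : continuous f -> continuous (fun x => - f x).
Proof. by move=> cf x; apply: cvgN; exact: cf. Qed.

Lemma ctsM f g : continuous f -> continuous g -> continuous (fun x => f x * g x).
Proof. by move=> cf cg x; apply: cvgM; [exact: cf|exact: cg]. Qed.

Lemma ctsX f n : continuous f -> continuous (fun x => f x ^+ n).
Proof.
move=> cf; elim: n => [|n IH]; first by move=> x; exact: cvg_cst.
by under eq_fun do rewrite exprS; apply: ctsM.
Qed.

Lemma cts_comp (h : R -> R) f :
  continuous h -> continuous f -> continuous (fun x => h (f x)).
Proof. by move=> ch cf x; apply: continuous_comp; [exact: cf|exact: ch]. Qed.

Lemma cts_pair (U V : topologicalType) (f : T -> U) (g : T -> V) :
  continuous f -> continuous g -> continuous (fun x => (f x, g x)).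
Proof. by move=> cf cg x; apply: cvg_pair; [exact: cf|exact: cg]. Qed.

Lemma cts_comp2 (U V : topologicalType) (h : U * V -> R) (f : T -> U) (g : T -> V) :
  continuous h -> continuous f -> continuous g ->
  continuous (fun x => h (f x, g x)).
Proof.
move=> ch cf cg x.
apply: (@continuous_comp _ _ _ (fun x => (f x, g x)) h); last exact: ch.
exact: cts_pair.
Qed.

Lemma cts_norm f : continuous f -> continuous (fun x => `|f x|).
Proof. by move=> cf x; apply: cvg_norm; exact: cf. Qed.

Lemma cts_max f g :
  continuous f -> continuous g -> continuous (fun x => Num.max (f x) (g x)).
Proof. by move=> cf cg x; apply: continuous_max; [exact: cf|exact: cg]. Qed.

Lemma cts_min f g :
  continuous f -> continuous g -> continuous (fun x => Num.min (f x) (g x)).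
Proof. by move=> cf cg x; apply: continuous_min; [exact: cf|exact: cg]. Qed.

Lemma cts_inv f :
  continuous f -> (forall x, f x != 0) -> continuous (fun x => (f x)^-1).
Proof. by move=> cf f0 x; apply: cvgV; [exact: f0|exact: cf]. Qed.

Lemma cts_cst (U : topologicalType) (c : U) : continuous (fun _ : T => c).
Proof. by move=> x; exact: cvg_cst. Qed.

End ContinuousCombinators.
Arguments cts_cst {T U} c.

Lemma cts_id (T : topologicalType) : continuous (fun x : T => x).
Proof. by move=> x; exact: cvg_id. Qed.

Lemma cts_fst (T U : topologicalType) : continuous (fun z : T * U => z.1).
Proof. by move=> z; exact: cvg_fst. Qed.

Lemma cts_snd (T U : topologicalType) : continuous (fun z : T * U => z.2).
Proof. by move=> z; exact: cvg_snd. Qed.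

(* [is_derive] is a type class; this wrapper keeps instance resolution out of
   rewriting with lemmas that have differentiability hypotheses. *)
Definition der {R : realType} (x : R) (f : R -> R) (a : R) : Prop := is_derive x 1 f a.

Section DeriveCombinators.
Context {R : realType}.
Implicit Types (f g : R -> R) (x y a b : R).

Lemma derD f g x a b : der x f a -> der x g b ->
  der x (fun t => f t + g t) (a + b).
Proof. by move=> fa gb; exact: is_deriveD. Qed.

Lemma derN f x a : der x f a -> der x (fun t => - f t) (- a).
Proof. by move=> fa; exact: is_deriveN. Qed.

Lemma derM f g x a b : der x f a -> der x g b ->
  der x (fun t => f t * g t) (f x * b + g x * a).
Proof. by move=> fa gb; exact: is_deriveM. Qed.

Lemma derX2 f x a : der x f a ->
  der x (fun t => f t ^+ 2) (2 * f x * a).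
Proof.
move=> fa; under eq_fun do rewrite expr2.
by apply: (is_derive_eq (derM fa fa)); ring.
Qed.

Lemma der_comp (h g : R -> R) x a b : der (g x) h a -> der x g b ->
  der x (fun t => h (g t)) (a * b).
Proof. by move=> ha gb; exact: (@is_derive1_comp _ h g x a b ha gb). Qed.

Lemma der_id x : der x (fun t => t) 1.
Proof. exact: is_derive_id. Qed.

Lemma der_cst (c : R) x : der x (fun _ : R => c) 0.
Proof. exact: is_derive_cst. Qed.

Lemma der_eq (f : R -> R) x a b : der x f a -> a = b -> der x f b.
Proof. by move=> ? <-. Qed.

Lemma der_near f g x a : der x g a -> (\forall t \near x, f t = g t) ->
  der x f a.
Proof.
rewrite /der => ga fg; apply: near_eq_is_derive ga.
by apply: filterS fg => t ->.
Qed.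

Lemma der_cts f (f' : R -> R) : (forall x : R, der x f (f' x)) -> continuous f.
Proof.
move=> df x; apply: differentiable_continuous; apply/derivable1_diffP.
by have [] := df x.
Qed.

Lemma der_unique f x a b : der x f a -> der x f b -> a = b.
Proof. by move=> [_ <-] [_ <-]. Qed.

Lemma der_const_eq f x y : (forall t : R, der t f 0) -> f x = f y.
Proof. by move=> df; exact: is_derive_0_is_cst. Qed.

Lemma der_mean f (f' : R -> R) a b : a <= b -> (forall x : R, der x f (f' x)) ->
  exists2 c, a <= c <= b & f b - f a = f' c * (b - a).
Proof.
move=> ab df; have [|c cab ->] := @MVT_segment _ f f' a b ab (fun x _ => df x).
  by apply: continuous_subspaceT; exact: der_cts df.
by exists c => //; move: cab; rewrite in_itv.
Qed.

End DeriveCombinators.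

(** The slope is a total function, continuous at the one point that matters. The exchange of
    integrals and the chain rule in two variables exhibit such slopes instead of handling limits of
    quotients. *)
Lemma der_caratheodory {R : realType} (f : R -> R) (x a : R) :
  der x f a <-> exists g, [/\ forall z, f z - f x = g z * (z - x),
        {for x, continuous g} & g x = a].
Proof. exact: is_derive1_caratheodory. Qed.

Lemma der_cos {R : realType} (f : R -> R) x a : der x f a ->
  der x (fun t => cos (f t)) (- sin (f x) * a).
Proof. by move=> fa; apply: (der_comp (h := cos)) fa; exact: is_derive_cos. Qed.

Lemma der_sin {R : realType} (f : R -> R) x a : der x f a ->
  der x (fun t => sin (f t)) (cos (f x) * a).
Proof. by move=> fa; apply: (der_comp (h := sin)) fa; exact: is_derive_sin. Qed.

Lemma der_exp {R : realType} (f : R -> R) x a : der x f a ->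
  der x (fun t => expR (f t)) (expR (f x) * a).
Proof. by move=> fa; apply: (der_comp (h := expR)) fa; exact: is_derive_expR. Qed.

Ltac der_by tac := refine (der_eq _ _);
  [ repeat (first [ solve [tac]
     | refine (der_cst _ _) | refine (der_id _)
     | refine (derD _ _) | refine (derN _)
     | refine (derX2 _) | refine (derM _ _)
     | refine (der_cos _) | refine (der_sin _) | refine (der_exp _) ]) | cbv beta ].

Section Primitive.
Context {R : realType}.
Notation mu := (@lebesgue_measure R).
Implicit Types f : R -> R.

Lemma cts_integrable f a b : continuous f -> mu.-integrable `[a, b] (EFin \o f).
Proof.
move=> cf; apply: continuous_compact_integrable; first exact: segment_compact.
exact: continuous_subspaceT.
Qed.

Lemma Rint_cat f m1 m2 x : continuous f -> m1 <= m2 -> m2 <= x ->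
  (\int[mu]_(t in `[m1, x]) f t = \int[mu]_(t in `[m1, m2]) f t + \int[mu]_(t in `[m2, x]) f t)%R.
Proof.
move=> cf m12 m2x.
have := @Rintegral_itvB _ f (BLeft m1) (BRight x) m2 (cts_integrable _ _ cf).
rewrite !bnd_simp => /(_ m12 m2x); rewrite Rintegral_itv_obnd_cbnd; last first.
  apply: integrableS (cts_integrable m2 x cf) => //.
  by apply: subset_itvr; rewrite bnd_simp.
by move=> <-; rewrite addrC subrK.
Qed.

Lemma primitive_ex f : continuous f -> exists F : R -> R, forall x : R, der x F (f x).
Proof.
move=> cf.
pose I (m x : R) := (\int[mu]_(t in `[m, x]) f t)%R.
(* The fundamental theorem wants a base point to the left of [x], so the base moves with [x];
   subtracting the value at 0 makes the result independent of it. *)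
have indep m1 m2 x : m1 <= m2 -> m2 <= x -> m2 <= 0 ->
    I m1 x - I m1 0 = I m2 x - I m2 0.
  by move=> ? ? ?; rewrite /I (@Rint_cat f m1 m2 x)// (@Rint_cat f m1 m2 0)//; ring.
exists (fun x => I (- `|x| - 1) x - I (- `|x| - 1) 0) => x0.
pose m := - `|x0| - 2.
apply: (@der_near _ _ (fun x => I m x - I m 0)).
  have xu : x0 < x0 + 1 by rewrite ltrDl.
  have mx : m < x0 by rewrite /m; have := ler_norm (- x0); rewrite normrN; lra.
  have [dI eI] := continuous_FTC1_closed xu (cts_integrable m (x0 + 1) cf) mx (cf x0).
  have dIm : der x0 (I m) (f x0).
    by apply: DeriveDef; [exact: dI| rewrite -derive1E].
  by der_by ltac:(exact: dIm); rewrite addr0.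
have : \forall t \near x0, ball x0 1 t by apply: nbhsx_ballx.
apply: filterS => t; rewrite /ball/= => tx0.
have h1 : `|t| <= `|x0| + 1.
  by have := ler_normB x0 (x0 - t); rewrite opprB addrCA subrr addr0; lra.
have h2 := ler_norm (- t); rewrite normrN in h2.
symmetry; apply: indep; rewrite /m; [lra|lra|have := normr_ge0 t; lra].
Qed.

Definition prim f : R -> R := xget (fun=> 0) [set F : R -> R | forall x : R, der x F (f x)].

Lemma primP f : continuous f -> forall x : R, der x (prim f) (f x).
Proof. by move=> /primitive_ex[F HF]; rewrite /prim; case: xgetP => [G _|/(_ F)]. Qed.

(* The integral from a to b of a continuous function, as an increment of a
   primitive: the endpoints may be in any order. *)
Definition J f (a b : R) : R := prim f b - prim f a.

Implicit Types (a b c : R).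

Lemma J_ftc f F a b : continuous f -> (forall x : R, der x F (f x)) ->
  J f a b = F b - F a.
Proof.
move=> cf dF; have := @der_const_eq R (fun x => prim f x - F x) b a.
rewrite /J => H; suff : prim f b - F b = prim f a - F a by lra.
by apply: H => t; der_by ltac:(first [exact: primP|exact: dF]); rewrite subrr.
Qed.

Lemma J_der f a (x : R) : continuous f -> der x (J f a) (f x).
Proof.
by move=> cf; rewrite /J; der_by ltac:(exact: primP); rewrite addr0.
Qed.

Lemma J_cat f a b c : J f a c = J f a b + J f b c.
Proof. by rewrite /J; ring. Qed.

Lemma J_sym f a b : J f b a = - J f a b.
Proof. by rewrite /J; ring. Qed.

Lemma Jaa f a : J f a a = 0.
Proof. by rewrite /J subrr. Qed.

Lemma JD f g a b : continuous f -> continuous g ->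
  J (fun x => f x + g x) a b = J f a b + J g a b.
Proof.
move=> cf cg; rewrite (@J_ftc _ (fun x => prim f x + prim g x)); first by rewrite /J; ring.
- exact: ctsD.
- by move=> x; der_by ltac:(exact: primP).
Qed.

Lemma JZ f k a b : continuous f -> J (fun x => k * f x) a b = k * J f a b.
Proof.
move=> cf; rewrite (@J_ftc _ (fun x => k * prim f x)); first by rewrite /J; ring.
- by apply: ctsM => //; exact: cts_cst.
- by move=> x; der_by ltac:(exact: primP); ring.
Qed.

Lemma JN f a b : continuous f -> J (fun x => - f x) a b = - J f a b.
Proof. by move=> cf; rewrite -mulN1r -JZ//; congr J; apply/funext => x; rewrite mulN1r. Qed.

Lemma JB f g a b : continuous f -> continuous g ->
  J (fun x => f x - g x) a b = J f a b - J g a b.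
Proof. by move=> cf cg; rewrite JD ?JN//; exact: ctsN. Qed.

Lemma J_cst k a b : J (fun _ => k) a b = k * (b - a).
Proof.
rewrite (@J_ftc _ (fun x => k * x)); [by ring|exact: cts_cst|move=> x].
by der_by fail; ring.
Qed.

Lemma J_ge0 f a b : a <= b -> continuous f -> (forall x, a <= x <= b -> 0 <= f x) ->
  0 <= J f a b.
Proof.
move=> ab cf f0; rewrite /J.
have [c cab ->] := der_mean ab (primP cf).
by apply: mulr_ge0; [exact: f0|rewrite subr_ge0].
Qed.

Lemma J_le f g a b : a <= b -> continuous f -> continuous g ->
  (forall x, a <= x <= b -> f x <= g x) -> J f a b <= J g a b.
Proof.
move=> ab cf cg fg; rewrite -subr_ge0 -JB//; apply: J_ge0 => //.
  by apply: ctsD => //; exact: ctsN.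
by move=> x /fg; rewrite subr_ge0.
Qed.

Lemma J_ext f g a b : a <= b -> continuous f -> continuous g ->
  (forall x, a <= x <= b -> f x = g x) -> J f a b = J g a b.
Proof.
by move=> ab cf cg fg; apply/eqP; rewrite eq_le !J_le// => x /fg ->.
Qed.

Lemma J_abs f a b : a <= b -> continuous f -> `|J f a b| <= J (fun x => `|f x|) a b.
Proof.
move=> ab cf; have cnf := cts_norm cf; rewrite ler_norml -JN//.
apply/andP; split; apply: J_le => //.
- exact: ctsN.
- by move=> x _; exact: lerNnormlW.
- by move=> x _; exact: ler_norm.
Qed.

Lemma J_sub_itv f a a' b' b : continuous f -> a <= a' -> a' <= b' -> b' <= b ->
  (forall x, a <= x <= b -> 0 <= f x) -> J f a' b' <= J f a b.
Proof.
move=> cf aa' ab bb' f0.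
rewrite (@J_cat f a a' b) (@J_cat f a' b' b).
have h1 : 0 <= J f a a' by apply: J_ge0 => // x xa; apply: f0; lra.
have h2 : 0 <= J f b' b by apply: J_ge0 => // x xa; apply: f0; lra.
lra.
Qed.

Lemma J_subst f g g' a b : continuous f -> continuous g' ->
  (forall x : R, der x g (g' x)) ->
  J (fun x => f (g x) * g' x) a b = J f (g a) (g b).
Proof.
move=> cf cg' dg; rewrite (@J_ftc _ (fun x => prim f (g x))) //.
- by apply: ctsM => //; apply: cts_comp => //; exact: der_cts dg.
- by move=> x; apply: (der_comp (h := prim f)) => //; exact: primP.
Qed.

(** Meant for substitutions such as the tangent or the reciprocal, which are differentiable on the
    interval but not on the line; the mean value theorem on the closed interval does the work. *)
Lemma J_subst_in f g g' h a b : a <= b -> continuous f -> continuous h ->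
  (forall x : R, a <= x <= b -> der x g (g' x)) ->
  (forall x, a <= x <= b -> h x = f (g x) * g' x) ->
  J h a b = J f (g a) (g b).
Proof.
move=> ab cf ch dg hE.
pose D x := prim h x - prim f (g x).
have dD x : a <= x <= b -> der x D 0.
  move=> xab.
  der_by ltac:(first [exact: (primP ch)|exact: (der_comp (primP cf _) (dg _ xab))]).
  by rewrite hE// subrr.
suff : D b = D a by rewrite /J /D; lra.
have d1 x : x \in `]a, b[ -> is_derive x 1 D 0.
  by rewrite in_itv/= => /andP[ax xb]; apply: dD; rewrite !ltW.
have d2 : {within `[a, b], continuous D}.
  apply: derivable_within_continuous => x; rewrite in_itv/= => xab.
  by have [] := dD x xab.
have [c _] := MVT_segment ab d1 d2.
by rewrite mul0r => /eqP; rewrite subr_eq0 => /eqP.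
Qed.

Lemma J_shift f k a b : continuous f -> J (fun x => f (x + k)) a b = J f (a + k) (b + k).
Proof.
move=> cf; rewrite -(@J_subst f (fun x => x + k) (fun=> 1)) //.
- by congr J; apply/funext => x; rewrite mulr1.
- exact: cts_cst.
- by move=> x; der_by fail; rewrite addr0.
Qed.

Lemma J_opp f a b : continuous f -> J (fun x => f (- x)) a b = J f (- b) (- a).
Proof.
move=> cf; rewrite (J_sym f (- a)) -(@J_subst f (fun x => - x) (fun=> -1)) //.
- rewrite -JN; first by congr J; apply/funext => x; rewrite mulrN1 opprK.
  by apply: ctsM; [apply: cts_comp => //; apply: ctsN; exact: cts_id|exact: cts_cst].
- exact: cts_cst.
- by move=> x; der_by fail.
Qed.

Lemma J_cts f a : continuous f -> continuous (J f a).
Proof. by move=> cf; apply: (@der_cts _ _ f) => x; exact: J_der. Qed.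

(** Cauchy-Schwarz against 1, read off from the integral of the squared deviation from the mean. *)
Lemma sqr_J_le f a b : a <= b -> continuous f ->
  (J f a b) ^+ 2 <= (b - a) * J (fun x => f x ^+ 2) a b.
Proof.
move=> ab cf; have [<-|ba] := eqVneq a b; first by rewrite !Jaa expr0n mulr0.
have ab0 : 0 < b - a by rewrite subr_gt0 lt_neqAle ba.
set m := J f a b / (b - a).
have : 0 <= J (fun x => (f x - m) ^+ 2) a b.
  apply: J_ge0 => //; first by apply: ctsX; apply: ctsD => //; exact: cts_cst.
  by move=> x _; exact: sqr_ge0.
have cf2 : continuous (fun x => f x ^+ 2) by exact: ctsX.
have cf3 : continuous (fun x => (- 2 * m) * f x) by apply: ctsM => //; exact: cts_cst.
have -> : (fun x => (f x - m) ^+ 2) = (fun x => f x ^+ 2 + (- 2 * m) * f x + m ^+ 2).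
  by apply/funext => x; ring.
have cf4 : continuous (fun _ : R => m ^+ 2) by exact: cts_cst.
rewrite (JD _ _ (ctsD cf2 cf3) cf4) JD// JZ// J_cst -(@ler_pM2l _ (b - a))// mulr0 => H.
have mE : m * (b - a) = J f a b by rewrite /m divfK// gt_eqF.
have -> : J f a b ^+ 2 = m ^+ 2 * (b - a) ^+ 2 by rewrite -mE; ring.
move: H; rewrite -mE; set A := J _ a b; nra.
Qed.

(** The minimum is at most the mean. This picks slices on which an integrated quantity is small
    pointwise. *)
Lemma J_exists_le f a b : a < b -> continuous f ->
  exists2 c, a <= c <= b & f c * (b - a) <= J f a b.
Proof.
move=> ab cf.
have [c cab cmin] := EVT_min (ltW ab) (continuous_subspaceT cf : {within `[a, b], continuous f}).
exists c; first by move: cab; rewrite in_itv.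
rewrite -J_cst; apply: J_le (ltW ab) _ cf _; first exact: cts_cst.
by move=> x xab; apply: cmin; rewrite in_itv.
Qed.

End Primitive.
#[global] Opaque J.

Lemma cts_cos {R : realType} (T : topologicalType) (f : T -> R) :
  continuous f -> continuous (fun x => cos (f x)).
Proof. by move=> cf; apply: (@cts_comp _ _ cos) => //; exact: continuous_cos. Qed.

Lemma cts_sin {R : realType} (T : topologicalType) (f : T -> R) :
  continuous f -> continuous (fun x => sin (f x)).
Proof. by move=> cf; apply: (@cts_comp _ _ sin) => //; exact: continuous_sin. Qed.

Lemma cts_exp {R : realType} (T : topologicalType) (f : T -> R) :
  continuous f -> continuous (fun x => expR (f x)).
Proof. by move=> cf; apply: (@cts_comp _ _ expR) => //; exact: continuous_expR. Qed.

Lemma cts_fst_comp (T U V : topologicalType) (f : T -> U * V) :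
  continuous f -> continuous (fun x => (f x).1).
Proof. by move=> cf x; apply: continuous_comp; [exact: cf|exact: cvg_fst]. Qed.

Lemma cts_snd_comp (T U V : topologicalType) (f : T -> U * V) :
  continuous f -> continuous (fun x => (f x).2).
Proof. by move=> cf x; apply: continuous_comp; [exact: cf|exact: cvg_snd]. Qed.

Ltac cts_step :=
  lazymatch goal with
  | |- forall x, continuous_at x (fun _ => ?c) => exact (cts_cst c)
  | |- forall x, continuous_at x (fun x => x) => exact (@cts_id _)
  | |- forall x, continuous_at x (fun x => (@?f x + @?g x)%R) => refine (@ctsD _ _ f g _ _)
  | |- forall x, continuous_at x (fun x => (- @?f x)%R) => refine (@ctsN _ _ f _)
  | |- forall x, continuous_at x (fun x => (@?f x * @?g x)%R) => refine (@ctsM _ _ f g _ _)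
  | |- forall x, continuous_at x (fun x => (@?f x ^+ ?n)%R) => refine (@ctsX _ _ f n _)
  | |- forall x, continuous_at x (fun x => `|@?f x|%R) => refine (@cts_norm _ _ f _)
  | |- forall x, continuous_at x (fun x => cos (@?f x)) => refine (@cts_cos _ _ f _)
  | |- forall x, continuous_at x (fun x => sin (@?f x)) => refine (@cts_sin _ _ f _)
  | |- forall x, continuous_at x (fun x => expR (@?f x)) => refine (@cts_exp _ _ f _)
  | |- forall x, continuous_at x (fun x => Num.max (@?f x) (@?g x)) => refine (@cts_max _ _ f g _ _)
  | |- forall x, continuous_at x (fun x => Num.min (@?f x) (@?g x)) => refine (@cts_min _ _ f g _ _)
  | |- forall x, continuous_at x (fun x => (@?f x).1) =>
      first [exact: cts_fst | refine (@cts_fst_comp _ _ _ f _)]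
  | |- forall x, continuous_at x (fun x => (@?f x).2) =>
      first [exact: cts_snd | refine (@cts_snd_comp _ _ _ f _)]
  | |- forall x, continuous_at x (fun x => ?h (@?f x, @?g x)) =>
      refine (@cts_comp2 _ _ _ _ h f g _ _ _);
      [first [match goal with H : forall x, continuous_at x h |- _ => exact H end | assumption] | |]
  | |- forall x, continuous_at x (fun x => ?h (@?f x)) =>
      first [match goal with H : forall x, continuous_at x (fun z => h (f z)) |- _ => exact H end
        | match goal with H : forall x, continuous_at x h |- _ => exact H end
        | refine (@cts_comp _ _ h f _ _);
          [match goal with H : forall x, continuous_at x h |- _ => exact H end | ]
        | assumption
        | refine (@cts_comp _ _ h f _ _); [assumption|]]
  | |- _ => first [assumption | exact: cts_fst | exact: cts_snd | exact: cts_id]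
  end.
Ltac cts := repeat cts_step.

(** * Integrals depending on a parameter *)

Section ParametricIntegrals.
Context {R : realType}.

(** Compactness of the segment makes continuity in [t] uniform in the second variable. *)
Lemma tube (T : topologicalType) (f : T * R -> R) (a b : R) t0 (e : R) :
  continuous f -> 0 < e ->
  \forall t \near t0, forall y, a <= y <= b -> `|f (t, y) - f (t0, y)| <= e.
Proof.
move=> cf e0.
have /compact_near_coveringP := @segment_compact _ a b.
move=> /(_ T (nbhs t0) (fun t y => `|f (t, y) - f (t0, y)| <= e) _) H.
have : \forall t \near t0, `[a, b] `<=` (fun y => `|f (t, y) - f (t0, y)| <= e).
  apply: H => y _.
  have e2 : 0 < e / 2 by rewrite divr_gt0.
  have h1 := cf (t0, y) _ (nbhsx_ballx (f (t0, y)) (e / 2) e2).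
  have h2 : continuous (fun y => f (t0, y)) by cts.
  have h3 := h2 y _ (nbhsx_ballx (f (t0, y)) (e / 2) e2).
  case: h1 => -[U V] /= [Ut0 Vy] UV.
  exists (V `&` ((fun y => f (t0, y)) @^-1` ball (f (t0, y)) (e / 2)), U) => /=.
    by split => //; apply: filterI.
  move=> [y' t] /= [[Vy' By'] Ut].
  have := UV (t, y') (conj Ut Vy'); move: By'; rewrite /ball /=.
  move=> A B; apply: ltW.
  have := ler_normD (f (t0, y) - f (t0, y')) (- (f (t0, y) - f (t, y'))).
  rewrite normrN opprB.
  rewrite (_ : f (t0, y) - f (t0, y') + (f (t, y') - f (t0, y)) = f (t, y') - f (t0, y')); last by ring.
  by lra.
by apply: filterS => t st y ab; apply: st; rewrite /= in_itv.
Qed.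

Lemma J_param_cts (T : topologicalType) (f : T * R -> R) (a b : R) :
  continuous f -> continuous (fun t => J (fun y => f (t, y)) a b).
Proof.
wlog ab : a b / a <= b.
  move=> H cf; have [ab|/ltW ab] := leP a b; first exact: H.
  under eq_fun do rewrite J_sym.
  by apply: ctsN; exact: H.
move=> cf t0; apply/cvgrPdist_le => e e0.
have d0 : 0 < e / (b - a + 1) by rewrite divr_gt0//; lra.
apply: filterS (tube a b t0 cf d0) => t H.
rewrite -JB; [|cts|cts].
apply: (le_trans (J_abs ab _)); first by cts.
apply: (@le_trans _ _ (J (fun _ => e / (b - a + 1)) a b)).
  by apply: J_le => //; [cts|cts|move=> y ?; rewrite distrC; exact: H].
rewrite J_cst mulrAC ler_pdivrMr; last lra.
by apply: ler_wpM2l; [exact: ltW|lra].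
Qed.

(** The right side, as a function of [b], has the inner integral as derivative. Its Caratheodory
    slope at [t] is the average of [f] over the segment from [t] to [s], continuous as a parametric
    integral. *)
Lemma J_fubini (f : R * R -> R) (a b c d : R) : continuous f ->
  J (fun x => J (fun y => f (x, y)) c d) a b = J (fun y => J (fun x => f (x, y)) a b) c d.
Proof.
move=> cf.
wlog cd : c d / c <= d.
  move=> H; have [|/ltW] := leP c d => cd; first exact: H.
  rewrite (J_sym _ d c) -(H _ _ cd) -JN; last by apply: J_param_cts.
  by congr J; apply/funext => x; rewrite J_sym.
have cfs : continuous (fun z : R * R => f (z.2, z.1)) by cts.
have cG y0 : continuous (fun t : R * R => J (fun x => f (x, t.2)) y0 t.1).
  have -> : (fun t : R * R => J (fun x => f (x, t.2)) y0 t.1) =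
      (fun t : R * R => (t.1 - y0) * J (fun s => f (y0 + s * (t.1 - y0), t.2)) 0 1).
    apply/funext => -[t y] /=.
    rewrite -JZ; last by cts.
    transitivity (J (fun x => f (x, y)) (y0 + 0 * (t - y0)) (y0 + 1 * (t - y0))).
      by congr J; ring.
    rewrite -(@J_subst _ (fun x => f (x, y)) (fun s => y0 + s * (t - y0)) (fun=> t - y0)); [|cts|cts|].
      by congr J; apply/funext => s; rewrite mulrC.
    move=> x; der_by fail; ring.
  apply: ctsM; first by cts.
  apply: (@J_param_cts _ (fun z : (R * R) * R => f (y0 + z.2 * (z.1.1 - y0), z.1.2))).
  by cts.
pose G t := J (fun y => J (fun x => f (x, y)) a t) c d.
suff dG t : der t G (J (fun y => f (t, y)) c d).
  rewrite (@J_ftc _ _ G); [|exact: J_param_cts|by []].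
  rewrite /G (_ : (fun y => J (fun x => f (x, y)) a a) = (fun=> 0)).
    by rewrite J_cst mul0r subr0.
  by apply/funext => y; rewrite Jaa.
apply/der_caratheodory.
exists (fun s => J (fun y => J (fun r => f (t + r * (s - t), y)) 0 1) c d); split.
- move=> s; rewrite /G -JB; last 2 first.
    by apply: (@cts_comp2 _ R R R (fun z => J (fun x => f (x, z.2)) a z.1)) => //; cts.
    by apply: (@cts_comp2 _ R R R (fun z => J (fun x => f (x, z.2)) a z.1)) => //; cts.
  rewrite mulrC -JZ; last first.
    apply: (@J_param_cts _ (fun z : R * R => f (t + z.2 * (s - t), z.1))); cts.
  congr J; apply/funext => y.
  transitivity (J (fun x => f (x, y)) t s); first by rewrite (J_cat _ a t s); ring.
  rewrite -JZ; last by cts.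
  transitivity (J (fun x => f (x, y)) (t + 0 * (s - t)) (t + 1 * (s - t))).
    by congr J; ring.
  rewrite -(@J_subst _ (fun x => f (x, y)) (fun r => t + r * (s - t)) (fun=> s - t)); [|cts|cts|].
    by congr J; apply/funext => r; rewrite mulrC.
  move=> x; der_by fail; ring.
- move: t; have : continuous (fun z : R * R => J (fun y => J (fun r => f (z.1 + r * (z.2 - z.1), y)) 0 1) c d).
    apply: (@J_param_cts _ (fun w : (R * R) * R => J (fun r => f (w.1.1 + r * (w.1.2 - w.1.1), w.2)) 0 1)).
    apply: (@J_param_cts _ (fun w : ((R * R) * R) * R => f (w.1.1.1 + w.2 * (w.1.1.2 - w.1.1.1), w.1.2))).
    by cts.
  move=> H t.
  apply: (@continuous_comp _ _ _ (fun s => (t, s)) (fun z : R * R => J (fun y => J (fun r => f (z.1 + r * (z.2 - z.1), y)) 0 1) c d)).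
    by apply: cts_pair; cts.
  exact: H.
- congr J; apply/funext => y.
  rewrite (_ : (fun r => f (t + r * (t - t), y)) = (fun=> f (t, y))).
    by rewrite J_cst; ring.
  by apply/funext => r; rewrite subrr mulr0 addr0.
Qed.

(** By Fubini the function of [s] is a constant plus the primitive of a continuous function, so
    differentiation under the integral is the fundamental theorem. *)
Lemma J_der_param (g gt : R * R -> R) (a b t : R) :
  continuous g -> continuous gt ->
  (forall t y, der t (fun s => g (s, y)) (gt (t, y))) ->
  der t (fun s => J (fun y => g (s, y)) a b) (J (fun y => gt (t, y)) a b).
Proof.
move=> cg cgt dg.
have -> : (fun s => J (fun y => g (s, y)) a b) =
   (fun s => J (fun y => g (0, y)) a b + J (fun x => J (fun y => gt (x, y)) a b) 0 s).
  apply/funext => s; rewrite J_fubini// -JD; [|cts|].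
    congr J; apply/funext => y.
    by rewrite (@J_ftc _ _ (fun s => g (s, y))); [ring|cts|].
  have cgs : continuous (fun z : R * R => gt (z.2, z.1)) by cts.
  exact: (@J_param_cts _ (fun z : R * R => gt (z.2, z.1))).
by der_by ltac:(apply: J_der; exact: J_param_cts); rewrite add0r.
Qed.

End ParametricIntegrals.

(** * Continuously differentiable functions of two variables *)

Section ContinuouslyDifferentiable.
Context {R : realType}.

Record C1 (f fx fy : R * R -> R) : Prop := MkC1 {
  C1_cx : continuous fx;
  C1_cy : continuous fy;
  C1_dx : forall x y : R, der x (fun t => f (t, y)) (fx (x, y));
  C1_dy : forall x y : R, der y (fun t => f (x, t)) (fy (x, y)) }.

(** Hadamard's form of an increment: a variable endpoint becomes a parameter of an integral over
    [0, 1], to which [J_param_cts] applies. *)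
Lemma J_line (f : R -> R) (x0 x : R) : continuous f ->
  J f x0 x = (x - x0) * J (fun s => f (x0 + s * (x - x0))) 0 1.
Proof.
move=> cf; rewrite -JZ; last by cts.
transitivity (J f (x0 + 0 * (x - x0)) (x0 + 1 * (x - x0))); first by congr J; ring.
rewrite -(@J_subst _ f (fun s => x0 + s * (x - x0)) (fun=> x - x0)) //; [|cts|].
  by congr J; apply/funext => s; rewrite mulrC.
move=> s; der_by fail; ring.
Qed.

(** The increment is split along the two coordinate directions; each part is a Hadamard quotient
    times the slope of [a] or of [b]. *)
Lemma C1_chain f fx fy (a b : R -> R) (a' b' t : R) : C1 f fx fy ->
  der t a a' -> der t b b' ->
  der t (fun s => f (a s, b s)) (fx (a t, b t) * a' + fy (a t, b t) * b').
Proof.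
move=> [cx cy dx dy].
move=> /der_caratheodory[ga [aE cga ga']] /der_caratheodory[gb [bE cgb gb']].
apply/der_caratheodory.
pose A (z : R * R) := J (fun r => fx (a t + r * (z.1 - a t), z.2)) 0 1.
pose B (y : R) := J (fun r => fy (a t, b t + r * (y - b t))) 0 1.
have cA : continuous A.
  apply: (@J_param_cts _ _ (fun w : (R * R) * R => fx (a t + w.2 * (w.1.1 - a t), w.1.2))).
  by cts.
have cB : continuous B.
  by apply: (@J_param_cts _ _ (fun w : R * R => fy (a t, b t + w.2 * (w.1 - b t)))); cts.
have cat : {for t, continuous a}.
  have -> : a = (fun s => a t + ga s * (s - t)).
    by apply/funext => s; rewrite -aE; ring.
  apply: cvgD; first exact: cvg_cst.
  by apply: cvgM => //; apply: cvgB; [exact: cvg_id|exact: cvg_cst].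
have cbt : {for t, continuous b}.
  have -> : b = (fun s => b t + gb s * (s - t)).
    by apply/funext => s; rewrite -bE; ring.
  apply: cvgD; first exact: cvg_cst.
  by apply: cvgM => //; apply: cvgB; [exact: cvg_id|exact: cvg_cst].
exists (fun s => A (a s, b s) * ga s + B (b s) * gb s); split.
- move=> s.
  have e1 : f (a s, b s) - f (a t, b s) = (a s - a t) * A (a s, b s).
    rewrite /A /= -(@J_line (fun x => fx (x, b s))); last by cts.
    by rewrite (@J_ftc _ _ (fun x => f (x, b s))) //; cts.
  have e2 : f (a t, b s) - f (a t, b t) = (b s - b t) * B (b s).
    rewrite /B /= -(@J_line (fun y => fy (a t, y))); last by cts.
    by rewrite (@J_ftc _ _ (fun y => f (a t, y))) //; cts.
  have -> : f (a s, b s) - f (a t, b t) =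
    (f (a s, b s) - f (a t, b s)) + (f (a t, b s) - f (a t, b t)) by ring.
  by rewrite e1 e2 aE bE; ring.
- apply: cvgD; apply: cvgM => //.
    apply: (@continuous_comp _ _ _ (fun s => (a s, b s)) A); last exact: cA.
    by apply: (@cvg_pair _ _ _ _ (nbhs (a t)) (nbhs (b t))).
  by apply: continuous_comp => //; exact: cB.
- rewrite /A /B /= ga' gb'.
  rewrite (_ : (fun r => fx (a t + r * (a t - a t), b t)) = (fun=> fx (a t, b t))); last first.
    by apply/funext => r; rewrite subrr mulr0 addr0.
  rewrite (_ : (fun r => fy (a t, b t + r * (b t - b t))) = (fun=> fy (a t, b t))); last first.
    by apply/funext => r; rewrite subrr mulr0 addr0.
  by rewrite !J_cst subr0 !mulr1.
Qed.

Lemma C1_cts f fx fy : C1 f fx fy -> continuous f.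
Proof.
move=> [cx cy dx dy].
have -> : f = (fun z => f (0, 0) + J (fun x => fx (x, 0)) 0 z.1 +
                 z.2 * J (fun r => fy (z.1, r * z.2)) 0 1).
  apply/funext => -[x y] /=.
  rewrite (_ : (fun r => fy (x, r * y)) = (fun r => fy (x, 0 + r * (y - 0)))); last first.
    by apply/funext => r; rewrite add0r subr0.
  have := @J_line (fun y => fy (x, y)) 0 y; rewrite subr0 => <-; last by cts.
  rewrite (@J_ftc _ _ (fun x => f (x, 0))) //; last by cts.
  by rewrite (@J_ftc _ _ (fun y => f (x, y))) //; [ring|cts].
apply: ctsD; last first.
  apply: ctsM; first by cts.
  apply: (@J_param_cts _ _ (fun w : (R * R) * R => fy (w.1.1, w.2 * w.1.2))).
  by cts.
apply: ctsD; first by cts.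
apply: (cts_comp (h := J (fun x => fx (x, 0)) 0)); last by cts.
by apply: J_cts; cts.
Qed.

End ContinuouslyDifferentiable.

(** * Polar coordinates *)

Section PolarCoordinates.
Context {R : realType}.
Implicit Types (f g : R * R -> R).

Lemma J_bounds_cts (T : topologicalType) (f : T * R -> R) (a b : T -> R) :
  continuous f -> continuous a -> continuous b ->
  continuous (fun t => J (fun y => f (t, y)) (a t) (b t)).
Proof.
move=> cf ca cb.
have -> : (fun t => J (fun y => f (t, y)) (a t) (b t)) =
    (fun t => (b t - a t) * J (fun s => f (t, a t + s * (b t - a t))) 0 1).
  by apply/funext => t; rewrite (@J_line _ (fun y => f (t, y)))//; cts.
apply: ctsM; first by cts.
apply: (@J_param_cts _ _ (fun z : T * R => f (z.1, a z.1 + z.2 * (b z.1 - a z.1)))).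
have ca1 : continuous (fun z : T * R => a z.1) by move=> z; apply: continuous_comp; [exact: cvg_fst|exact: ca].
have cb1 : continuous (fun z : T * R => b z.1) by move=> z; apply: continuous_comp; [exact: cvg_fst|exact: cb].
by cts.
Qed.

Lemma J_support (h : R -> R) (a a' b' b : R) : continuous h -> a <= a' -> a' <= b' -> b' <= b ->
  (forall x, a <= x <= b -> x <= a' \/ b' <= x -> h x = 0) -> J h a b = J h a' b'.
Proof.
move=> ch aa ab bb h0.
rewrite (J_cat _ a a' b) (J_cat _ a' b' b).
have c0 : continuous (fun _ : R => 0 : R) by cts.
rewrite (J_ext aa ch c0); last by move=> x xa; apply: h0; [lra|left; lra].
rewrite (J_ext bb ch c0); last by move=> x xa; apply: h0; [lra|right; lra].
by rewrite !J_cst; ring.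
Qed.

(** The square is cut along its diagonal. Both sides vanish at [A = 0] and have the same derivative
    in [A], the integrals over the two moving edges. *)
Lemma J_triangle g (A : R) : continuous g ->
  J (fun x => J (fun y => g (x, y)) 0 A) 0 A =
  J (fun x => J (fun y => g (x, y)) 0 x) 0 A + J (fun y => J (fun x => g (x, y)) 0 y) 0 A.
Proof.
move=> cg.
have cgs : continuous (fun z : R * R => g (z.2, z.1)) by cts.
have c1 : continuous (fun z : R * R => J (fun y => g (z.1, y)) 0 z.2).
  by apply: (@J_bounds_cts _ (fun w : (R * R) * R => g (w.1.1, w.2)) (fun=> 0) snd); cts.
have c2 : continuous (fun z : R * R => J (fun x => g (x, z.2)) 0 z.1).
  by apply: (@J_bounds_cts _ (fun w : (R * R) * R => g (w.2, w.1.2)) (fun=> 0) fst); cts.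
have c3 : continuous (fun x => J (fun y => g (x, y)) 0 x).
  by apply: (@J_bounds_cts _ g (fun=> 0) id); cts.
have c4 : continuous (fun y => J (fun x => g (x, y)) 0 y).
  by apply: (@J_bounds_cts _ (fun z : R * R => g (z.2, z.1)) (fun=> 0) id); cts.
have HF : C1 (fun z => J (fun x => J (fun y => g (x, y)) 0 z.2) 0 z.1)
    (fun z => J (fun y => g (z.1, y)) 0 z.2) (fun z => J (fun x => g (x, z.2)) 0 z.1).
  split => //= x y.
    have cgy : continuous (fun x' => J (fun y' => g (x', y')) 0 y) by exact: J_param_cts.
    exact: (J_der 0 x cgy).
  apply: (@J_der_param _ (fun z : R * R => J (fun y => g (z.2, y)) 0 z.1) (fun z : R * R => g (z.2, z.1))) => //.
    by apply: (@J_bounds_cts _ (fun w : (R * R) * R => g (w.1.2, w.2)) (fun=> 0) fst); cts.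
  move=> t x'; have cgx : continuous (fun y => g (x', y)) by cts.
  exact: (J_der 0 t cgx).
pose D A := J (fun x => J (fun y => g (x, y)) 0 A) 0 A -
  (J (fun x => J (fun y => g (x, y)) 0 x) 0 A + J (fun y => J (fun x => g (x, y)) 0 y) 0 A).
suff : D A = D 0 by rewrite /D !Jaa => /eqP; rewrite addr0 subrr subr_eq0 => /eqP.
apply: der_const_eq => t; rewrite /D.
der_by ltac:(first [exact: (C1_chain HF (der_id _) (der_id _)) | exact: (J_der _ _ c3) | exact: (J_der _ _ c4)]).
by rewrite /=; ring.
Qed.

(** On the cone $|y| \le x$ put $y = x \tan t$, then $x = r \cos t$: the factors $x$, $\cos^{-2} t$
    and $\cos t$ multiply to $r$. The support hypothesis replaces the straight edge $x = A$ by the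
    arc $r = A$. *)
Lemma cone_polar f (A : R) : 0 < A -> continuous f ->
  (forall z : R * R, A ^+ 2 <= z.1 ^+ 2 + z.2 ^+ 2 -> f z = 0) ->
  J (fun x => J (fun y => f (x, y)) (- x) x) 0 A =
  J (fun t => J (fun r => f (r * cos t, r * sin t) * r) 0 A) (- (pi / 4)) (pi / 4).
Proof.
move=> A0 cf f0.
pose k t := J (fun x => x * f (x, x * t)) 0 A.
have ck : continuous k by apply: (@J_param_cts _ _ (fun z : R * R => z.2 * f (z.2, z.2 * z.1))); cts.
transitivity (J k (-1) 1).
  rewrite /k -(@J_fubini _ (fun z : R * R => z.1 * f (z.1, z.1 * z.2))); last by cts.
  congr J; apply/funext => x.
  rewrite (_ : (fun y => x * f (x, x * y)) = (fun y => f (x, x * y) * x)); last first.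
    by apply/funext => y; rewrite mulrC.
  rewrite (@J_subst _ (fun y => f (x, y)) (fun y => x * y) (fun=> x)) ?mulr1 ?mulrN1//; [cts|cts|].
  by move=> y; der_by fail; ring.
have pi0 := @pi_gt0 R.
rewrite -[X in J k (-X)]tan_piquarter -[X in J k _ X]tan_piquarter -tanN.
symmetry; apply: (@J_subst_in _ _ _ (fun t => (cos t) ^- 2)); [lra|exact: ck| | |].
- apply: (@J_param_cts _ _ (fun z : R * R => f (z.2 * cos z.1, z.2 * sin z.1) * z.2)); cts.
- move=> t tt; apply: is_derive_tan; rewrite gt_eqF//; apply: cos_gt0_pihalf; lra.
- move=> t tt; have c0 : 0 < cos t by apply: cos_gt0_pihalf; lra.
  have c1 : cos t <= 1 by exact: cos_le1.
  have cn : cos t != 0 by rewrite gt_eqF.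
  have ch : continuous (fun x : R => x * f (x, x * tan t)) by cts.
  have cc2 := cos2Dsin2 t.
  have kE : k (tan t) = J (fun x => x * f (x, x * tan t)) 0 (A * cos t).
    apply: (J_support ch); first exact: lexx.
    - by apply: mulr_ge0; lra.
    - by rewrite ger_pMr.
    - move=> x xA [x0|xc]; first by rewrite (_ : x = 0) ?mul0r//; lra.
      rewrite f0 ?mulr0//= /tan.
      have -> : x ^+ 2 + (x * (sin t / cos t)) ^+ 2 = (x / cos t) ^+ 2 * (cos t ^+ 2 + sin t ^+ 2) by field.
      rewrite cc2 mulr1 ler_sqr ?nnegrE; [|lra|by apply: divr_ge0; lra].
      by rewrite ler_pdivlMr.
  have dg x : der x (fun r => r * cos t) (cos t).   by der_by fail; ring.
  have := J_subst 0 A ch (cts_cst (cos t)) dg; rewrite mul0r -kE => <-.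
  rewrite mulrC -JZ; last by cts.
  congr J; apply/funext => r.
  have -> : r * cos t * tan t = r * sin t by rewrite /tan; field.
  by field.
Qed.

(** The four cones are the quarter turns of $|y| \le x$; the diagonals cut the quadrants into eight
    triangles, two for each cone. *)
Lemma square_cones f (A : R) : 0 < A -> continuous f ->
  J (fun x => J (fun y => f (x, y)) (- A) A) (- A) A =
  J (fun x => J (fun y => f (x, y)) (- x) x) 0 A +
  J (fun x => J (fun y => f (- y, x)) (- x) x) 0 A +
  J (fun x => J (fun y => f (- x, - y)) (- x) x) 0 A +
  J (fun x => J (fun y => f (y, - x)) (- x) x) 0 A.
Proof.
move=> A0 cf.
have split (h : R -> R) (x : R) : continuous h -> J h (- x) x = J (fun y => h y + h (- y)) 0 x.
  move=> ch; rewrite JD; [|cts|by apply: (@cts_comp _ _ h (fun y => - y)) => //; cts].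
  by rewrite J_opp// oppr0 [RHS]addrC -J_cat.
rewrite split; last by apply: (@J_param_cts _ _ f).
pose f1 := fun z : R * R => f z; pose f2 := fun z : R * R => f (z.1, - z.2).
pose f3 := fun z : R * R => f (- z.1, z.2); pose f4 := fun z : R * R => f (- z.1, - z.2).
have c1 : continuous f1 by exact: cf.
have c2 : continuous f2 by rewrite /f2; cts.
have c3 : continuous f3 by rewrite /f3; cts.
have c4 : continuous f4 by rewrite /f4; cts.
pose P (h : R * R -> R) := J (fun x => J (fun y => h (x, y)) 0 x) 0 A : R.
pose Q (h : R * R -> R) := J (fun y => J (fun x => h (x, y)) 0 y) 0 A : R.
have cP (h : R * R -> R) : continuous h -> continuous (fun x => J (fun y => h (x, y)) 0 x).
  by move=> ch; apply: (@J_bounds_cts _ h); cts.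
have cQ (h : R * R -> R) : continuous h -> continuous (fun y => J (fun x => h (x, y)) 0 y).
  by move=> ch; apply: (@J_bounds_cts _ (fun z : R * R => h (z.2, z.1))); cts.
have cS (h : R * R -> R) : continuous h -> continuous (fun x => J (fun y => h (x, y)) 0 A).
  by move=> ch; apply: J_param_cts.
have HL : J (fun y => J (fun y0 => f (y, y0)) (- A) A + J (fun y0 => f (- y, y0)) (- A) A) 0 A =
    (P f1 + Q f1) + (P f2 + Q f2) + (P f3 + Q f3) + (P f4 + Q f4).
  rewrite /P /Q -!J_triangle//.
  rewrite (_ : (fun y => _ + _) = (fun x => J (fun y => f1 (x, y)) 0 A + J (fun y => f2 (x, y)) 0 A +
     J (fun y => f3 (x, y)) 0 A + J (fun y => f4 (x, y)) 0 A)); last first.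
    apply/funext => x; rewrite !split; [|cts|cts].
    rewrite !JD; try by cts.
    by rewrite /f1 /f2 /f3 /f4 /=; ring.
  by do 3 (rewrite JD; [|by repeat first [assumption|apply: cS|apply: ctsD]|exact: cS]).
have e1 : J (fun x => J (fun y => f (x, y)) (- x) x) 0 A = P f1 + P f2.
  rewrite /P -JD; [|exact: cP|exact: cP]; congr J; apply/funext => x.
  by rewrite split; [rewrite JD//; cts|cts].
have e2 : J (fun x => J (fun y => f (- y, x)) (- x) x) 0 A = Q f3 + Q f1.
  rewrite /Q -JD; [|exact: cQ|exact: cQ]; congr J; apply/funext => x.
  rewrite split; last by cts.
  rewrite JD; [|cts|cts].
  by congr (_ + J _ _ _); apply/funext => y; rewrite opprK.
have e3 : J (fun x => J (fun y => f (- x, - y)) (- x) x) 0 A = P f4 + P f3.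
  rewrite /P -JD; [|exact: cP|exact: cP]; congr J; apply/funext => x.
  rewrite split; last by cts.
  rewrite JD; [|cts|cts].
  by congr (_ + J _ _ _); apply/funext => y; rewrite opprK.
have e4 : J (fun x => J (fun y => f (y, - x)) (- x) x) 0 A = Q f2 + Q f4.
  rewrite /Q -JD; [|exact: cQ|exact: cQ]; congr J; apply/funext => x.
  by rewrite split; [rewrite JD//; cts|cts].
by rewrite HL e1 e2 e3 e4; ring.
Qed.

(** Rotating the cones back to the first one glues their angles into one full turn that starts at
    $-\pi/4$; this is the origin of the angular range used for all full circles. *)
Lemma polar0 f (A : R) : 0 < A -> continuous f ->
  (forall z : R * R, A ^+ 2 <= z.1 ^+ 2 + z.2 ^+ 2 -> f z = 0) ->
  J (fun x => J (fun y => f (x, y)) (- A) A) (- A) A =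
  J (fun t => J (fun r => f (r * cos t, r * sin t) * r) 0 A) (- (pi / 4)) (7 * (pi / 4)).
Proof.
move=> A0 cf f0.
rewrite square_cones//.
pose k t := J (fun r => f (r * cos t, r * sin t) * r) 0 A.
have ck : continuous k.
  by apply: (@J_param_cts _ _ (fun z : R * R => f (z.2 * cos z.1, z.2 * sin z.1) * z.2)); cts.
have e1 : J (fun x => J (fun y => f (- y, x)) (- x) x) 0 A = J k (pi / 4) (3 * (pi / 4)).
  rewrite (@cone_polar (fun z => f (- z.2, z.1)))//; [|cts|].
    rewrite [RHS](_ : _ = J k (- (pi / 4) + pi / 2) (pi / 4 + pi / 2)); last by congr J; field.
    rewrite -(J_shift _ _ _ ck); congr J; apply/funext => t; congr J; apply/funext => r /=.
    by rewrite cosDpihalf sinDpihalf mulrN.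
  by move=> z hz; apply: f0; rewrite /= sqrrN addrC.
have e2 : J (fun x => J (fun y => f (- x, - y)) (- x) x) 0 A = J k (3 * (pi / 4)) (5 * (pi / 4)).
  rewrite (@cone_polar (fun z => f (- z.1, - z.2)))//; [|cts|].
    rewrite [RHS](_ : _ = J k (- (pi / 4) + pi) (pi / 4 + pi)); last by congr J; field.
    rewrite -(J_shift _ _ _ ck); congr J; apply/funext => t; congr J; apply/funext => r /=.
    by rewrite cosDpi sinDpi !mulrN.
  by move=> z hz; apply: f0; rewrite /= !sqrrN.
have e3 : J (fun x => J (fun y => f (y, - x)) (- x) x) 0 A = J k (5 * (pi / 4)) (7 * (pi / 4)).
  rewrite (@cone_polar (fun z => f (z.2, - z.1)))//; [|cts|].
    rewrite [RHS](_ : _ = J k (- (pi / 4) + (pi / 2 + pi)) (pi / 4 + (pi / 2 + pi))); last by congr J; field.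
    rewrite -(J_shift _ _ _ ck); congr J; apply/funext => t; congr J; apply/funext => r /=.
    by rewrite addrA cosDpi sinDpi cosDpihalf sinDpihalf opprK mulrN.
  by move=> z hz; apply: f0; rewrite /= sqrrN addrC.
by rewrite cone_polar// e1 e2 e3 -/(k _) -!J_cat.
Qed.

(* Polar coordinates about an arbitrary centre, for a compactly supported
   function; the size B of the square is independent of the centre. *)
Lemma polar_box f (c : R * R) (A B : R) : 0 < A -> continuous f ->
  (forall z : R * R, A ^+ 2 <= (z.1 - c.1) ^+ 2 + (z.2 - c.2) ^+ 2 -> f z = 0) ->
  `|c.1| + A <= B -> `|c.2| + A <= B ->
  J (fun x => J (fun y => f (x, y)) (- B) B) (- B) B =
  J (fun t => J (fun r => f (c.1 + r * cos t, c.2 + r * sin t) * r) 0 A)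
    (- (pi / 4)) (7 * (pi / 4)).
Proof.
move=> A0 cf f0 B1 B2.
have [h11 h12] : - `|c.1| <= c.1 /\ c.1 <= `|c.1| by split; [exact: lerNnormlW|exact: ler_norm].
have [h21 h22] : - `|c.2| <= c.2 /\ c.2 <= `|c.2| by split; [exact: lerNnormlW|exact: ler_norm].
have cfx x : continuous (fun y => f (x, y)) by cts.
have cF a b : continuous (fun x => J (fun y => f (x, y)) a b) by exact: J_param_cts.
have zero x y : A <= `|x - c.1| \/ A <= `|y - c.2| -> f (x, y) = 0.
  move=> H; apply: f0; rewrite /=.
  have sq z : A <= `|z| -> A ^+ 2 <= z ^+ 2.
    by move=> Az; rewrite -(real_normK (num_real z)) ler_sqr ?nnegrE//; lra.
  have := sqr_ge0 (x - c.1); have := sqr_ge0 (y - c.2).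
  by case: H => /sq; lra.
rewrite (@J_support _ (- B) (c.1 - A) (c.1 + A) B) //; [|lra|lra|lra|]; last first.
  move=> x xB xA; rewrite (_ : (fun y => f (x, y)) = fun=> 0); first by rewrite J_cst mul0r.
  apply/funext => y; apply: zero; left; case: xA => h; last by rewrite ger0_norm; lra.
  by rewrite ler0_norm; lra.
rewrite (_ : (fun x => J (fun y => f (x, y)) (- B) B) =
             (fun x => J (fun y => f (x, y)) (c.2 - A) (c.2 + A))); last first.
  apply/funext => x; apply: J_support => //; [lra|lra|lra|].
  move=> y yB yA; apply: zero; right; case: yA => h; last by rewrite ger0_norm; lra.
  by rewrite ler0_norm; lra.
rewrite -(@polar0 (fun z => f (c.1 + z.1, c.2 + z.2))) //; last 2 first.
- by cts.
- by move=> z hz; apply: f0; rewrite /= ![_ + _ - _]addrAC !subrr !add0r.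
rewrite [LHS](_ : _ = J (fun x => J (fun y => f (x, y)) (c.2 - A) (c.2 + A)) (- A + c.1) (A + c.1)); last first.
  by congr J; ring.
rewrite -(J_shift _ _ _ (cF _ _)); congr J; apply/funext => x.
rewrite [LHS](_ : _ = J (fun y => f (x + c.1, y)) (- A + c.2) (A + c.2)); last by congr J; ring.
rewrite -(J_shift _ _ _ (cfx _)); congr J; apply/funext => y.
by rewrite (addrC x) (addrC y).
Qed.

End PolarCoordinates.

(** * Limits, $C^1$ calculus and a Wirtinger inequality *)

Section Generalities.
Context {R : realType}.

Definition tends (f : R -> R) (l : R) : Prop :=
  forall e, 0 < e -> exists S, forall s, S <= s -> `|f s - l| <= e.

Lemma cauchy_tends (f : R -> R) :
  (forall e, 0 < e -> exists S, forall s s', S <= s -> s <= s' -> `|f s' - f s| <= e) ->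
  exists l, tends f l.
Proof.
move=> H.
have cv : cvg (f @ +oo).
  apply/cauchy_cvgP/cauchyP => e e0.
  have [S HS] := H (e / 2) (divr_gt0 e0 (ltr0n _ 2)).
  exists (f S); rewrite /fmapE.
  have : \forall x \near +oo, S <= x by apply: nbhs_pinfty_ge; exact: num_real.
  apply: filterS => x Sx; rewrite /ball/= distrC.
  apply: le_lt_trans (HS _ _ (lexx _) Sx) _.
  by rewrite ltr_pdivrMr// mulr_natr mulr2n ltrDl.
exists (lim (f @ +oo)) => e e0.
have /cvgrPdist_le /(_ e e0) [M [_ HM]] := cv.
by exists (M + 1) => s sM; rewrite distrC; apply: HM; lra.
Qed.

Lemma cts_ge0_closure (D : R -> R) (a : R) : continuous D ->
  (forall x, a < x -> x < a + 1 -> 0 <= D x) -> 0 <= D a.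
Proof.
move=> cD H; rewrite leNgt; apply/negP => Da.
have D0 : 0 < - D a by rewrite oppr_gt0.
have /cvgrPdist_lt /(_ _ D0) [e /= e0 He] := cD a.
have e2 : 0 < Num.min e 1 by rewrite lt_min e0 ltr01.
have hm := H (a + Num.min e 1 / 2).
have m1 : Num.min e 1 <= 1 by rewrite ge_min lexx orbT.
have m2 : Num.min e 1 <= e by rewrite ge_min lexx.
have hb : ball_ Num.norm a e (a + Num.min e 1 / 2).
  by rewrite /ball_ /= opprD addrA subrr add0r normrN ger0_norm; lra.
have := He _ hb; rewrite ltr_norml => /andP[h1 h2].
have : 0 <= D (a + Num.min e 1 / 2) by apply: hm; lra.
by lra.
Qed.

(** Circle estimates are divided by the radius and so hold for positive radii only; continuity
    supplies the endpoint. *)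
Lemma J_le_open (f g : R -> R) (a b : R) : a <= b -> continuous f -> continuous g ->
  (forall x, a < x -> x <= b -> f x <= g x) -> J f a b <= J g a b.
Proof.
move=> ab cf cg fg.
have [<-|ba] := eqVneq a b; first by rewrite !Jaa.
have {ab ba} ab : a < b by rewrite lt_neqAle ba.
apply: J_le => //; first exact: ltW.
move=> x /andP[]; rewrite le_eqVlt => /predU1P[<- _|]; last exact: fg.
rewrite -subr_ge0.
have cD : continuous (fun t : R => g (a + t * (b - a)) - f (a + t * (b - a))) by cts.
have := @cts_ge0_closure _ 0 cD; rewrite mul0r addr0; apply => t t0 t1.
by rewrite subr_ge0; apply: fg; nra.
Qed.

Lemma J_abs_le (f g : R -> R) (a b : R) : a <= b -> continuous f -> continuous g ->
  (forall x, a <= x <= b -> `|f x| <= g x) -> `|J f a b| <= J g a b.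
Proof.
move=> ab cf cg fg; apply: le_trans (J_abs ab cf) _.
by apply: J_le => //; exact: cts_norm.
Qed.

Lemma C1_comp (h h' : R -> R) (f fx fy : R * R -> R) : continuous h' ->
  (forall x : R, der x h (h' x)) -> C1 f fx fy ->
  C1 (fun z => h (f z)) (fun z => h' (f z) * fx z) (fun z => h' (f z) * fy z).
Proof.
move=> ch' dh Cf; have cf := C1_cts Cf; have [cx cy dx dy] := Cf.
split; [by cts|by cts| |] => x y.
  exact: der_comp (dh _) (dx _ _).
exact: der_comp (dh _) (dy _ _).
Qed.

Lemma C1_mul (f fx fy g gx gy : R * R -> R) : C1 f fx fy -> C1 g gx gy ->
  C1 (fun z => f z * g z) (fun z => f z * gx z + g z * fx z) (fun z => f z * gy z + g z * fy z).
Proof.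
move=> Cf Cg; have cf := C1_cts Cf; have cg := C1_cts Cg.
have [cx cy dx dy] := Cf; have [cgx cgy dgx dgy] := Cg.
split; [by cts|by cts| |] => x y.
  exact: derM (dx _ _) (dgx _ _).
exact: derM (dy _ _) (dgy _ _).
Qed.

Lemma C1_add (f fx fy g gx gy : R * R -> R) : C1 f fx fy -> C1 g gx gy ->
  C1 (fun z => f z + g z) (fun z => fx z + gx z) (fun z => fy z + gy z).
Proof.
move=> [cx cy dx dy] [cgx cgy dgx dgy]; split; [by cts|by cts| |] => x y.
  exact: derD (dx _ _) (dgx _ _).
exact: derD (dy _ _) (dgy _ _).
Qed.

Lemma C1_opp (f fx fy : R * R -> R) : C1 f fx fy ->
  C1 (fun z => - f z) (fun z => - fx z) (fun z => - fy z).
Proof.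
by move=> [cx cy dx dy]; split; [cts|cts| |] => x y; [exact: derN (dx _ _)|exact: derN (dy _ _)].
Qed.

Lemma C1_eq (f fx fy gx gy : R * R -> R) : C1 f fx fy -> fx =1 gx -> fy =1 gy -> C1 f gx gy.
Proof. by move=> Cf /funext <- /funext <-. Qed.

(* The integral of a Jacobian over a rectangle reduces to its boundary even
   though f and g are only C^1. *)
Lemma der_wedge (f fS fT g gS gT : R * R -> R) (a b s : R) : C1 f fS fT -> C1 g gS gT ->
  der s (fun s => J (fun t => fT (s, t) * g (s, t)) a b)
    (J (fun t => fT (s, t) * gS (s, t) - fS (s, t) * gT (s, t)) a b +
     (fS (s, b) * g (s, b) - fS (s, a) * g (s, a))).
Proof.
move=> Cf Cg; have cf := C1_cts Cf; have cg := C1_cts Cg.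
have [cfS cfT dfS dfT] := Cf; have [cgS cgT dgS dgT] := Cg.
(* The arguments are decoupled: [z.1] is the place of [g], [z.2] that of [fT]. Although [fT] is not
   differentiable, integration by parts in [t] moves its derivative onto [g], and what remains is
   differentiable in [z.2]. *)
pose A2 (z : R * R) := J (fun t => fT (z.2, t) * g (z.1, t)) a b.
have A2E z : A2 z = f (z.2, b) * g (z.1, b) - f (z.2, a) * g (z.1, a)
                    - J (fun t => f (z.2, t) * gT (z.1, t)) a b.
  rewrite -(@J_ftc _ (fun t => f (z.2, t) * gT (z.1, t) + g (z.1, t) * fT (z.2, t))
     (fun t => f (z.2, t) * g (z.1, t))); [|cts|].
    rewrite JD; [|cts|cts].
    rewrite addrAC subrr add0r /A2; congr J; apply/funext => t; exact: mulrC.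
  by move=> t; exact: derM (dfT _ _) (dgT _ _).
have CA2 : C1 A2 (fun z => J (fun t => fT (z.2, t) * gS (z.1, t)) a b)
   (fun z => fS (z.2, b) * g (z.1, b) - fS (z.2, a) * g (z.1, a)
             - J (fun t => fS (z.2, t) * gT (z.1, t)) a b).
  split.
  - by apply: (@J_param_cts _ _ (fun w : (R * R) * R => fT (w.1.2, w.2) * gS (w.1.1, w.2))); cts.
  - apply: ctsD; first by cts.
    apply: ctsN.
    by apply: (@J_param_cts _ _ (fun w : (R * R) * R => fS (w.1.2, w.2) * gT (w.1.1, w.2))); cts.
  - move=> x y /=.
    apply: (@J_der_param _ (fun w => fT (y, w.2) * g w) (fun w => fT (y, w.2) * gS w)).
    + by cts.
    + by cts.
    + by move=> t z /=; der_by ltac:(exact: dgS); ring.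
  - move=> x y /=.
    rewrite (_ : (fun t => A2 (x, t)) = (fun t => f (t, b) * g (x, b) - f (t, a) * g (x, a)
                    - J (fun r => f (t, r) * gT (x, r)) a b)); last first.
      by apply/funext => t; rewrite A2E.
    have dJ : der y (fun t => J (fun r => f (t, r) * gT (x, r)) a b)
                    (J (fun r => fS (y, r) * gT (x, r)) a b).
      apply: (@J_der_param _ (fun w => f w * gT (x, w.2)) (fun w => fS w * gT (x, w.2))).
      + by cts.
      + by cts.
      + by move=> t z /=; der_by ltac:(exact: dfS); ring.
    by der_by ltac:(first [exact: dJ|exact: dfS]); ring.
refine (der_eq (C1_chain CA2 (der_id s) (der_id s)) _); rewrite /= !mulr1.
by rewrite JB; [ring|cts|cts].
Qed.

(** After removal of the constant [V a], [V] vanishes at both ends and is at most the integral of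
    $|V'|$; the form is then at most $2 \int |V'| \int |U'|$. The last hypothesis disposes of the
    constant: it holds on closed circles, where [U] closes up, and on arcs with ends on the axis,
    where [V] is zero. *)
Lemma wirtinger (U U' V V' : R -> R) (a b : R) : a <= b ->
  continuous U' -> continuous V' ->
  (forall x : R, der x U (U' x)) -> (forall x : R, der x V (V' x)) ->
  V a = V b -> V a * (U b - U a) = 0 ->
  `|J (fun x => U x * V' x - V x * U' x) a b| <=
  (b - a) * J (fun x => U' x ^+ 2 + V' x ^+ 2) a b.
Proof.
move=> ab cU' cV' dU dV Vab VU.
have cU := der_cts dU; have cV := der_cts dV.
pose k := V a; pose W x := V x - k.
have cW : continuous W by rewrite /W; cts.
have e1 : J (fun x => U x * V' x - V x * U' x) a b = - 2 * J (fun x => W x * U' x) a b.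
  have h1 : J (fun x => U x * V' x + W x * U' x) a b = 0.
    rewrite (@J_ftc _ _ (fun x => U x * W x)); [|cts|].
      by rewrite /W /k -Vab subrr !mulr0 subrr.
    by move=> x; rewrite /W; der_by ltac:(first [exact: dU|exact: dV]); ring.
  have h2 : J (fun x => k * U' x) a b = 0.
    by rewrite JZ// (@J_ftc _ _ U).
  rewrite (_ : (fun x => U x * V' x - V x * U' x) =
    (fun x => (U x * V' x + W x * U' x) - (2 * (W x * U' x) + k * U' x))); last first.
    by apply/funext => x; rewrite /W; ring.
  rewrite JB; [|cts|cts].
  rewrite h1 JD; [|cts|cts].
  rewrite JZ; last by cts.
  by rewrite h2; ring.
pose m := J (fun x => `|V' x|) a b; pose n := J (fun x => `|U' x|) a b.
have cnV : continuous (fun x => `|V' x|) by cts.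
have cnU : continuous (fun x => `|U' x|) by cts.
have Wm x : a <= x <= b -> `|W x| <= m.
  move=> xab; rewrite /W /k -(@J_ftc _ V' V)//.
  apply: le_trans (J_abs _ cV') _; first by lra.
  by apply: J_sub_itv => //; lra.
have h : `|J (fun x => W x * U' x) a b| <= m * n.
  rewrite -JZ//; apply: J_abs_le => //; [by cts|by cts|move=> x xab].
  by rewrite normrM; apply: ler_wpM2r => //; exact: Wm.
have hm : m ^+ 2 <= (b - a) * J (fun x => V' x ^+ 2) a b.
  apply: le_trans (sqr_J_le ab cnV) _.
  by rewrite (_ : (fun x => `|V' x| ^+ 2) = (fun x => V' x ^+ 2))//; apply/funext => x; rewrite real_normK// num_real.
have hn : n ^+ 2 <= (b - a) * J (fun x => U' x ^+ 2) a b.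
  apply: le_trans (sqr_J_le ab cnU) _.
  by rewrite (_ : (fun x => `|U' x| ^+ 2) = (fun x => U' x ^+ 2))//; apply/funext => x; rewrite real_normK// num_real.
rewrite e1 normrM normrN (ger0_norm (ler0n _ 2)) JD; [|cts|cts].
have := sqr_ge0 (m - n); nra.
Qed.

End Generalities.

(** * The arctangent as a smoothed sign *)

Section ArctanRamp.
Context {R : realType}.
Implicit Types (d x y : R).

(** A sign function smoothed at scale [d]. Its bounds do not depend on [d], while its derivative has
    mass $\pi$ and concentrates at 0 as [d] tends to 0. *)
Definition hatan (d x : R) : R := atan (x / d).

Lemma hatan0 d : hatan d 0 = 0. Proof. by rewrite /hatan mul0r atan0. Qed.

Lemma hatan_den (d x : R) : 0 < d -> 0 < d ^+ 2 + x ^+ 2.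
Proof. by move=> d0; rewrite ltr_wpDr ?sqr_ge0// exprn_gt0. Qed.

Lemma hatan_der (d x : R) : 0 < d -> der x (hatan d) (d / (d ^+ 2 + x ^+ 2)).
Proof.
move=> d0; have dn : d != 0 by rewrite gt_eqF.
have := hatan_den x d0 => /lt0r_neq0 dx.
have h : der (x / d) atan ((1 + (x / d) ^+ 2)^-1) by exact: is_derive1_atan.
have dd : der x (fun y : R => y / d) d^-1 by der_by fail; ring.
refine (der_eq (@der_comp _ atan (fun y => y / d) x _ _ h dd) _).
have -> : 1 + (x / d) ^+ 2 = (d ^+ 2 + x ^+ 2) / d ^+ 2 by field.
by field; rewrite dn dx.
Qed.

Lemma hatan_dcts d : 0 < d -> continuous (fun x : R => d / (d ^+ 2 + x ^+ 2)).
Proof.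
move=> d0; apply: ctsM; first by cts.
by apply: cts_inv; [cts|move=> x; rewrite gt_eqF// hatan_den].
Qed.

Lemma hatan_cts d : 0 < d -> continuous (hatan d).
Proof. by move=> d0; apply: der_cts => x; exact: hatan_der. Qed.

Lemma hatan_le d x y : 0 < d -> x <= y -> hatan d x <= hatan d y.
Proof.
move=> d0 xy; rewrite -subr_ge0.
have [c _ ->] := der_mean xy (fun x => hatan_der x d0).
by rewrite mulr_ge0 ?subr_ge0// divr_ge0 ?ltW// hatan_den.
Qed.

Lemma hatan_ge0 d x : 0 < d -> 0 <= x -> 0 <= hatan d x.
Proof. by move=> d0 x0; rewrite -(hatan0 d) hatan_le. Qed.

Lemma hatan_le0 d x : 0 < d -> x <= 0 -> hatan d x <= 0.
Proof. by move=> d0 x0; rewrite -(hatan0 d) hatan_le. Qed.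

Lemma hatan_bound d x : `|hatan d x| <= 2.
Proof.
rewrite ler_norml /hatan.
have := @atan_ltpi2 R (x / d); have := @atan_gtNpi2 R (x / d); have := @pihalf_lt2 R; lra.
Qed.

Lemma hatanI_bound d x : 0 < d -> 0 <= J (hatan d) 0 x <= 2 * `|x|.
Proof.
move=> d0; have ch := hatan_cts d0.
have [x0|/ltW x0] := leP 0 x.
  rewrite (ger0_norm x0) J_ge0//=; last by move=> y /andP[y0 _]; exact: hatan_ge0.
  rewrite -[X in _ * X](subr0 x) -J_cst; apply: J_le => //; first by cts.
  by move=> y _; apply: le_trans (ler_norm _) (hatan_bound _ _).
rewrite (ler0_norm x0) J_sym -JN//; have cNh := ctsN ch.
rewrite J_ge0//=; last by move=> y /andP[_ y0]; rewrite oppr_ge0; exact: hatan_le0.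
rewrite -[X in _ * X](sub0r x) -J_cst; apply: J_le => //; first by cts.
by move=> y _; apply: le_trans (ler_norm _) _; rewrite normrN; exact: hatan_bound.
Qed.

End ArctanRamp.

(** * The flow in logarithmic polar coordinates *)

(* The flow in the conformal coordinates s = ln r, t = theta: U, V, O, P are the
   velocity components, the vorticity v_x - u_y and the pressure, and A, B are
   e^s times the radial and angular components of (U, V + b). *)
Record strip_flow {R : realType} (b s1 : R)
  (U US UT V VS VT O OS OT P PS PT A AS AT B BS BT : R * R -> R) : Prop := StripFlow {
  sf_U : C1 U US UT; sf_V : C1 V VS VT; sf_O : C1 O OS OT; sf_P : C1 P PS PT;
  sf_A : C1 A AS AT; sf_B : C1 B BS BT;
  sf_s1 : 1 <= s1;
  sf_PS : forall s t : R, s1 <= s -> 0 <= t <= pi ->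
    PS (s, t) = - OT (s, t) + U (s, t) * VT (s, t) - (V (s, t) + b) * UT (s, t);
  sf_PT : forall s t : R, s1 <= s -> 0 <= t <= pi ->
    PT (s, t) = OS (s, t) - U (s, t) * VS (s, t) + (V (s, t) + b) * US (s, t);
  sf_FS : forall s t : R, s1 <= s -> 0 <= t <= pi ->
    PS (s, t) + U (s, t) * US (s, t) + (V (s, t) + b) * VS (s, t)
    = - OT (s, t) + O (s, t) * B (s, t);
  sf_FT : forall s t : R, s1 <= s -> 0 <= t <= pi ->
    PT (s, t) + U (s, t) * UT (s, t) + (V (s, t) + b) * VT (s, t)
    = OS (s, t) - O (s, t) * A (s, t);
  sf_div : forall s t : R, s1 <= s -> 0 <= t <= pi -> AS (s, t) + BT (s, t) = 0;
  sf_Aw : forall s t : R, A (s, t) ^+ 2 <= expR s ^+ 2 * (U (s, t) ^+ 2 + (V (s, t) + b) ^+ 2);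
  sf_Oe : forall s t : R, s1 <= s -> 0 <= t <= pi -> O (s, t) ^+ 2 * expR s ^+ 2 <=
    2 * (US (s, t) ^+ 2 + UT (s, t) ^+ 2 + VS (s, t) ^+ 2 + VT (s, t) ^+ 2);
  sf_V0 : forall s : R, s1 <= s -> V (s, 0) = 0;
  sf_Vpi : forall s : R, s1 <= s -> V (s, pi) = 0;
  sf_O0 : forall s : R, s1 <= s -> O (s, 0) = 0;
  sf_Opi : forall s : R, s1 <= s -> O (s, pi) = 0;
  sf_b : forall s : R, s1 <= s -> b * U (s, 0) = b * U (s, pi);
  sf_tail : forall e : R, 0 < e -> exists S, forall s s', S <= s -> s <= s' ->
    J (fun s => J (fun t => US (s, t) ^+ 2 + UT (s, t) ^+ 2 + VS (s, t) ^+ 2 + VT (s, t) ^+ 2) 0 pi) s s' <= e }.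

(** * Energy, speed and dissipation of vorticity in the strip *)

Section Strip.
Context {R : realType} (b s1 : R).
Context (U US UT V VS VT O OS OT P PS PT A AS AT B BS BT : R * R -> R).
Context (F : strip_flow b s1 U US UT V VS VT O OS OT P PS PT A AS AT B BS BT).

Let cU := C1_cts (sf_U F).
Let cV := C1_cts (sf_V F).
Let cO := C1_cts (sf_O F).
Let cP := C1_cts (sf_P F).
Let cA := C1_cts (sf_A F).
Let cB := C1_cts (sf_B F).
Let cUS := C1_cx (sf_U F).
Let cUT := C1_cy (sf_U F).
Let cVS := C1_cx (sf_V F).
Let cVT := C1_cy (sf_V F).
Let cOS := C1_cx (sf_O F).
Let cOT := C1_cy (sf_O F).
Let cPS := C1_cx (sf_P F).
Let cPT := C1_cy (sf_P F).
Let cAS := C1_cx (sf_A F).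
Let cBT := C1_cy (sf_B F).
Let s1_ge1 := sf_s1 F.
Let pi0 : 0 < pi :> R := @pi_gt0 R.
Let pi0' : 0 <= pi :> R := @pi_ge0 R.

Definition strip_energy (z : R * R) : R :=
  US z ^+ 2 + UT z ^+ 2 + VS z ^+ 2 + VT z ^+ 2.
Definition strip_speed2 (z : R * R) : R := U z ^+ 2 + (V z + b) ^+ 2.
Local Notation E := strip_energy.
Local Notation W := strip_speed2.
Definition energy_at (s : R) : R := J (fun t => E (s, t)) 0 pi.
Definition speed2_at (s : R) : R := J (fun t => W (s, t)) 0 pi.
Local Notation D := energy_at.
Local Notation w := speed2_at.

Let cE : continuous E. Proof. by rewrite /strip_energy; cts. Qed.
Let cW : continuous W. Proof. by rewrite /strip_speed2; cts. Qed.
Let cD : continuous D. Proof. exact: J_param_cts. Qed.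
Let cw : continuous w. Proof. exact: J_param_cts. Qed.
Let E0 z : 0 <= E z.
Proof. by rewrite /strip_energy; have := sqr_ge0 (US z); have := sqr_ge0 (UT z);
  have := sqr_ge0 (VS z); have := sqr_ge0 (VT z); lra. Qed.
Let W0 z : 0 <= W z.
Proof. by rewrite /strip_speed2; have := sqr_ge0 (U z); have := sqr_ge0 (V z + b); lra. Qed.
Let D0 s : 0 <= D s. Proof. by apply: J_ge0 => //; cts. Qed.
Let w0 s : 0 <= w s. Proof. by apply: J_ge0 => //; cts. Qed.

Lemma energy_tail_at (e : R) : 0 < e -> exists S, s1 <= S /\ forall s s', S <= s -> s <= s' -> J D s s' <= e.
Proof.
move=> e0; have [S HS] := sf_tail F e0.
exists (Num.max S s1); split; first by rewrite le_max lexx orbT.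
by move=> s s'; rewrite ge_max => /andP[Ss _]; exact: HS.
Qed.

(** The linear terms [- OT - b * UT] of $\partial_s P$ integrate over the angle to boundary values
    that cancel. The rest is a Wirtinger form, so the mean moves by at most $\pi$ times the energy
    in between. *)
Lemma mean_pressure_tends : exists c, tends (fun s => J (fun t => P (s, t)) 0 pi) (pi * c).
Proof.
suff [l Hl] : exists l, tends (fun s => J (fun t => P (s, t)) 0 pi) l.
  by exists (l / pi); rewrite mulrCA divff ?mulr1 ?gt_eqF.
apply: cauchy_tends => e e0.
have [S [s1S HS]] := energy_tail_at (divr_gt0 e0 pi0).
exists S => s s' Ss ss'.
have cM : continuous (fun s => J (fun t => PS (s, t)) 0 pi) by exact: J_param_cts.
rewrite -(@J_ftc _ (fun s => J (fun t => PS (s, t)) 0 pi)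
  (fun s => J (fun t => P (s, t)) 0 pi))//; last first.
  by move=> x; apply: J_der_param => //; exact: (C1_dx (sf_P F)).
apply: (@le_trans _ _ (J (fun s => pi * D s) s s')).
  apply: J_abs_le => //; first by cts.
  move=> x /andP[sx xs'].
  have s1x : s1 <= x by apply: le_trans s1S _; apply: le_trans Ss sx.
  have -> : J (fun t => PS (x, t)) 0 pi = J (fun t => U (x, t) * VT (x, t) - V (x, t) * UT (x, t)) 0 pi.
    rewrite (@J_ext _ _ (fun t => (U (x, t) * VT (x, t) - V (x, t) * UT (x, t)) - (OT (x, t) + b * UT (x, t)))) //; [|cts|cts|].
      rewrite JB; [|cts|cts].
      rewrite [X in _ - X](_ : _ = 0) ?subr0//.
      rewrite (@J_ftc _ _ (fun t => O (x, t) + b * U (x, t))); [|cts|].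
        by rewrite (sf_O0 F)// (sf_Opi F)// (sf_b F)// subrr.
      by move=> t; der_by ltac:(first [exact: (C1_dy (sf_O F))|exact: (C1_dy (sf_U F))]); ring.
    by move=> t t0pi; rewrite (sf_PS F)//; ring.
  have h := @wirtinger _ (fun t => U (x, t)) (fun t => UT (x, t)) (fun t => V (x, t)) (fun t => VT (x, t)) 0 pi pi0'.
  apply: (le_trans (h _ _ _ _ _ _)).
  - by cts.
  - by cts.
  - exact: (C1_dy (sf_U F)).
  - exact: (C1_dy (sf_V F)).
  - by rewrite (sf_V0 F)// (sf_Vpi F).
  - by rewrite (sf_V0 F)// mul0r.
  rewrite subr0 ler_pM2l//; apply: J_le => //; [cts|cts|move=> t _].
  by rewrite /strip_energy; have := sqr_ge0 (US (x, t)); have := sqr_ge0 (VS (x, t)); lra.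
rewrite JZ//; have := HS _ _ Ss ss'; rewrite ler_pdivlMr// mulrC; exact.
Qed.

Lemma J_prod_le (f : R -> R) (a c : R) (k : R) : a <= c -> continuous f ->
  (forall x, a <= x <= c -> f x <= k) -> J f a c <= k * (c - a).
Proof. by move=> ac cf fk; rewrite -J_cst; apply: J_le => //; cts. Qed.

(** Cauchy-Schwarz along each ray. Absolute values allow [s'] on either side of [s], because a slice
    of small energy may be picked before or after the one of interest. *)
Lemma speed2_growth s s' : w s' <= 2 * w s + 2 * `|s' - s| * `|J D s s'|.
Proof.
have key (G GS : R * R -> R) : continuous G -> continuous GS ->
    (forall x y : R, der x (fun t => G (t, y)) (GS (x, y))) -> forall t,
    G (s', t) ^+ 2 <= 2 * G (s, t) ^+ 2 + 2 * `|s' - s| * `|J (fun x => GS (x, t) ^+ 2) s s'|.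
  move=> cG cGS dG t.
  have cg : continuous (fun x => GS (x, t)) by cts.
  have : G (s', t) - G (s, t) = J (fun x => GS (x, t)) s s' by rewrite (@J_ftc _ _ (fun x => G (x, t))).
  have : (J (fun x => GS (x, t)) s s') ^+ 2 <= `|s' - s| * `|J (fun x => GS (x, t) ^+ 2) s s'|.
    have [ss'|/ltW ss'] := leP s s'.
      rewrite (ger0_norm (_ : 0 <= s' - s)); last by rewrite subr_ge0.
      apply: le_trans (sqr_J_le ss' cg) _; apply: ler_wpM2l; first by rewrite subr_ge0.
      exact: ler_norm.
    rewrite J_sym sqrrN distrC (J_sym _ s') normrN (ger0_norm (_ : 0 <= s - s')); last by rewrite subr_ge0.
    apply: le_trans (sqr_J_le ss' cg) _; apply: ler_wpM2l; first by rewrite subr_ge0.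
    exact: ler_norm.
  rewrite -(mulrA 2 `|s' - s|); set X := J _ s s'; set Y := `|_| * _ => XY GX.
  have -> : G (s', t) = G (s, t) + X by rewrite -GX; ring.
  by have := sqr_ge0 (G (s, t) - X); nra.
have cDsub : continuous (fun t => J (fun x => US (x, t) ^+ 2 + VS (x, t) ^+ 2) s s').
  by apply: (@J_param_cts _ _ (fun z : R * R => US (z.2, z.1) ^+ 2 + VS (z.2, z.1) ^+ 2)); cts.
have dVb x y : der x (fun t => V (t, y) + b) (VS (x, y)).
  by der_by ltac:(exact: (C1_dx (sf_V F))); rewrite addr0.
have same (x : R) : 0 <= J (fun t => US (x, t) ^+ 2 + VS (x, t) ^+ 2) 0 pi <= D x.
  apply/andP; split; first by apply: J_ge0 => //; [cts|move=> t _; rewrite addr_ge0// sqr_ge0].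
  apply: J_le => //; [cts|cts|move=> t _].
  by rewrite /strip_energy; have := sqr_ge0 (UT (x, t)); have := sqr_ge0 (VT (x, t)); lra.
have bnd : `|J (fun t => J (fun x => US (x, t) ^+ 2 + VS (x, t) ^+ 2) s s') 0 pi| <= `|J D s s'|.
  rewrite -(@J_fubini _ (fun z : R * R => US z ^+ 2 + VS z ^+ 2)); last by cts.
  have cK : continuous (fun x => J (fun t => US (x, t) ^+ 2 + VS (x, t) ^+ 2) 0 pi).
    by apply: (@J_param_cts _ _ (fun z : R * R => US z ^+ 2 + VS z ^+ 2)); cts.
  have [ss'|/ltW ss'] := leP s s'.
    rewrite ger0_norm; last by apply: J_ge0 => // x _; have /andP[] := same x.
    apply: le_trans (ler_norm _); apply: J_le => // x _; by have /andP[] := same x.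
  rewrite J_sym normrN (J_sym D) normrN ger0_norm; last by apply: J_ge0 => // x _; have /andP[] := same x.
  apply: le_trans (ler_norm _); apply: J_le => // x _; by have /andP[] := same x.
have sgn t : `|J (fun x => US (x, t) ^+ 2) s s'| + `|J (fun x => VS (x, t) ^+ 2) s s'| =
   (if s <= s' then 1 else -1) * J (fun x => US (x, t) ^+ 2 + VS (x, t) ^+ 2) s s'.
  have cu : continuous (fun x => US (x, t) ^+ 2) by cts.
  have cv : continuous (fun x => VS (x, t) ^+ 2) by cts.
  rewrite JD//; have [ss'|/ltW ss'] := leP s s'.
    by rewrite !ger0_norm ?mul1r//; apply: J_ge0 => // x _; exact: sqr_ge0.
  rewrite !(J_sym _ s') !normrN !ger0_norm; first by ring.
    by apply: J_ge0 => // x _; exact: sqr_ge0.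
  by apply: J_ge0 => // x _; exact: sqr_ge0.
set sg := (if s <= s' then 1 else -1) in sgn.
apply: (@le_trans _ _ (J (fun t => 2 * W (s, t) +
   2 * `|s' - s| * (sg * J (fun x => US (x, t) ^+ 2 + VS (x, t) ^+ 2) s s')) 0 pi)).
  apply: J_le => //; [cts|cts|move=> t _].
  rewrite -sgn /strip_speed2.
  have := key _ _ cU cUS (C1_dx (sf_U F)) t.
  have := key (fun z => V z + b) VS _ cVS dVb t => /=.
  move=> /(_ ltac:(cts)); set a1 := `|_ - _|; set a2 := `|J _ _ _|; set a3 := `|J _ _ _|; lra.
rewrite JD; [|cts|cts].
rewrite JZ; last by cts.
rewrite lerD2l JZ; last by cts.
rewrite ler_wpM2l ?mulr_ge0//.
rewrite JZ//; apply: le_trans bnd.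
rewrite /sg; case: ifP => _; first by rewrite mul1r; exact: ler_norm.
by rewrite mulN1r -normrN; exact: ler_norm.
Qed.

Lemma speed2_linear : exists2 K, 0 < K & forall s, s1 <= s -> w s <= K * (1 + s).
Proof.
have [S [s1S HS]] := energy_tail_at (@ltr01 R).
pose M := J D s1 S + 1.
have M0 : 1 <= M by rewrite /M lerDr J_ge0.
have bd s : s1 <= s -> J D s1 s <= M.
  move=> s1s; have [sS|/ltW Ss] := leP s S.
    by rewrite /M (J_cat D s1 s S); have := @J_ge0 _ D s S sS cD (fun x _ => D0 x); lra.
  by rewrite /M (J_cat D s1 S s) lerD2l; apply: HS.
exists (2 * w s1 + 2 * M).
  by have := w0 s1; lra.
move=> s s1s.
have := speed2_growth s1 s.
rewrite ger0_norm ?subr_ge0// ger0_norm; last by apply: J_ge0.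
have := bd _ s1s; have := w0 s1; have := s1_ge1.
have : 0 <= J D s1 s by apply: J_ge0.
nra.
Qed.

(** Formally, $O_{ss} + O_{tt} = A O_s + B O_t$ is multiplied by $h(O)$ and integrated over the
    angle; the boundary terms vanish with $O$, and $A_s + B_t = 0$ makes the transport term exact.
    As [O] is only $C^1$, [OS] is replaced by the angular derivative of the head plus [O * A], and
    [der_wedge] differentiates the head part. *)
Lemma kato_identity (h h' H : R -> R) : continuous h' ->
  (forall x : R, der x h (h' x)) -> (forall x : R, der x H (h x)) -> h 0 = 0 -> H 0 = 0 ->
  forall s s', s1 <= s -> s <= s' ->
  J (fun t => OS (s', t) * h (O (s', t)) - H (O (s', t)) * A (s', t)) 0 pi -
  J (fun t => OS (s, t) * h (O (s, t)) - H (O (s, t)) * A (s, t)) 0 pi =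
  J (fun x => J (fun t => h' (O (x, t)) * (OS (x, t) ^+ 2 + OT (x, t) ^+ 2)) 0 pi) s s'.
Proof.
move=> ch' dh dH h0 H0 s s' s1s ss'.
have ch := der_cts dh; have cH := der_cts dH.
pose Fi z := P z + 2^-1 * (U z ^+ 2 + (V z + b) ^+ 2).
pose FS z := PS z + U z * US z + (V z + b) * VS z.
pose FT z := PT z + U z * UT z + (V z + b) * VT z.
have cFS : continuous FS by rewrite /FS; cts.
have cFT : continuous FT by rewrite /FT; cts.
have CFi : C1 Fi FS FT.
  split => // x y; rewrite /Fi /FS /FT.
    by der_by ltac:(first [exact: (C1_dx (sf_P F))|exact: (C1_dx (sf_U F))|exact: (C1_dx (sf_V F))]); field.
  by der_by ltac:(first [exact: (C1_dy (sf_P F))|exact: (C1_dy (sf_U F))|exact: (C1_dy (sf_V F))]); field.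
have Cg := C1_comp ch' dh (sf_O F).
(* What the replacement of [OS] leaves as coefficient of [A]; its gradient is $O h'(O) \nabla O$. *)
pose G z := O z * h (O z) - H (O z).
have CG : C1 G (fun z => O z * (h' (O z) * OS z)) (fun z => O z * (h' (O z) * OT z)).
  have CH := C1_comp ch dH (sf_O F).
  split; [by cts|by cts| |] => x y; rewrite /G.
    by der_by ltac:(first [exact: (C1_dx (sf_O F))|exact: (C1_dx Cg)|exact: (C1_dx CH)]); ring.
  by der_by ltac:(first [exact: (C1_dy (sf_O F))|exact: (C1_dy Cg)|exact: (C1_dy CH)]); ring.
have cG := C1_cts CG.
pose Z2 s := J (fun t => FT (s, t) * h (O (s, t))) 0 pi + J (fun t => G (s, t) * A (s, t)) 0 pi.
pose dZ2 s := J (fun t => FT (s, t) * (h' (O (s, t)) * OS (s, t)) - FS (s, t) * (h' (O (s, t)) * OT (s, t))) 0 pi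
  + (FS (s, pi) * h (O (s, pi)) - FS (s, 0) * h (O (s, 0)))
  + J (fun t => G (s, t) * AS (s, t) + A (s, t) * (O (s, t) * (h' (O (s, t)) * OS (s, t)))) 0 pi.
have cdZ2 : continuous dZ2.
  apply: ctsD; last first.
    by apply: (@J_param_cts _ _ (fun z => G z * AS z + A z * (O z * (h' (O z) * OS z)))); cts.
  apply: ctsD; last by cts.
  by apply: (@J_param_cts _ _ (fun z => FT z * (h' (O z) * OS z) - FS z * (h' (O z) * OT z))); cts.
have dZ x : der x Z2 (dZ2 x).
  apply: derD; first exact: (der_wedge 0 pi x CFi Cg).
  apply: (@J_der_param _ (fun z => G z * A z) (fun z => G z * AS z + A z * (O z * (h' (O z) * OS z)))).
  - by cts.
  - by cts.
  - by move=> t y; der_by ltac:(first [exact: (C1_dx CG)|exact: (C1_dx (sf_A F))]).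
have ZE x : s1 <= x -> J (fun t => OS (x, t) * h (O (x, t)) - H (O (x, t)) * A (x, t)) 0 pi = Z2 x.
  move=> s1x; rewrite /Z2 -JD; [|cts|cts].
  apply: J_ext => //; [cts|cts|move=> t t0pi].
  by rewrite /FT (sf_FT F)// /G; ring.
have s1s' : s1 <= s' by apply: le_trans ss'.
rewrite !ZE// -(J_ftc _ _ cdZ2 dZ); apply: J_ext => //.
  by apply: (@J_param_cts _ _ (fun z => h' (O z) * (OS z ^+ 2 + OT z ^+ 2))); cts.
move=> x /andP[sx _]; have s1x : s1 <= x by apply: le_trans sx.
rewrite /dZ2 !(sf_Opi F)// !(sf_O0 F)// h0 !mulr0 subrr addr0.
(* The exact angular derivative of [G * B], which is zero at both ends, supplies the missing half of
   the divergence. *)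
have GB : J (fun t => G (x, t) * BT (x, t) + B (x, t) * (O (x, t) * (h' (O (x, t)) * OT (x, t)))) 0 pi = 0.
  rewrite (@J_ftc _ _ (fun t => G (x, t) * B (x, t))); [|cts|].
    by rewrite /G !(sf_Opi F)// !(sf_O0 F)// h0 H0; ring.
  by move=> t; exact: derM (C1_dy CG _ _) (C1_dy (sf_B F) _ _).
rewrite -[LHS]addr0 -[X in _ + X = _]GB.
rewrite -JD; [|cts|cts].
rewrite -JD; [|cts|cts].
apply: J_ext => //; [cts|cts|move=> t t0pi].
have -> : AS (x, t) = - BT (x, t) by have := sf_div F s1x t0pi; lra.
by rewrite /FT /FS (sf_FT F)// (sf_FS F)//; ring.
Qed.

Section KatoBound.
Context (h h' H : R -> R) (ch' : continuous h') (dh : forall x : R, der x h (h' x))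
  (dH : forall x : R, der x H (h x)) (h0 : h 0 = 0) (H0 : H 0 = 0)
  (h'_ge0 : forall x, 0 <= h' x) (H_bound : forall x, 0 <= H x <= 2 * `|x|).

Let Z s := J (fun t => OS (s, t) * h (O (s, t)) - H (O (s, t)) * A (s, t)) 0 pi.
Let y s := J (fun t => H (O (s, t))) 0 pi.
Let k s := J (fun t => H (O (s, t)) * A (s, t)) 0 pi.
Let ch := der_cts dh.
Let cH := der_cts dH.

Let cZ : continuous Z.
Proof. by apply: (@J_param_cts _ _ (fun z => OS z * h (O z) - H (O z) * A z)); cts. Qed.
Let cy : continuous y.
Proof. by apply: (@J_param_cts _ _ (fun z => H (O z))); cts. Qed.
Let ck : continuous k.
Proof. by apply: (@J_param_cts _ _ (fun z => H (O z) * A z)); cts. Qed.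

Let Zmono s s' : s1 <= s -> s <= s' -> Z s <= Z s'.
Proof.
move=> s1s ss'; rewrite -subr_ge0 /Z (kato_identity ch' dh dH h0 H0 s1s ss').
apply: J_ge0 => // [|x _].
  by apply: (@J_param_cts _ _ (fun z => h' (O z) * (OS z ^+ 2 + OT z ^+ 2))); cts.
apply: J_ge0 => //; [cts|move=> t _].
by rewrite mulr_ge0// addr_ge0// sqr_ge0.
Qed.

(** Over a long interval the integral of [Z] reduces to two values of [y] and the transport term,
    which makes averages of [Z] accessible. *)
Let JZE s T : J Z s T = y T - y s - J k s T.
Proof.
have cd : continuous (fun s => J (fun t => h (O (s, t)) * OS (s, t)) 0 pi).
  by apply: (@J_param_cts _ _ (fun z => h (O z) * OS z)); cts.
rewrite -(@J_ftc _ _ y s T cd); last first.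
  move=> x; apply: (@J_der_param _ (fun z => H (O z)) (fun z => h (O z) * OS z)); [cts|cts|].
  by move=> t x'; exact: der_comp (dH _) (C1_dx (sf_O F) _ _).
rewrite -JB//; congr J; apply/funext => x; rewrite /Z /k -JB; [|cts|cts].
by congr J; apply/funext => t; ring.
Qed.

(** The weight [m] trades energy against speed; it will be of order $1/s$, to offset the linear
    growth of [w]. *)
Let kbound s (m : R) : s1 <= s -> 0 < m -> `|k s| <= 2 * m^-1 * D s + m * w s.
Proof.
move=> s1s m0; rewrite /D /w -!JZ; [|cts|cts]; rewrite -JD; [|cts|cts].
apply: J_abs_le => //; [cts|cts|move=> t t0pi].
have mn : m != 0 by rewrite gt_eqF.
have e0 : 0 < expR s by exact: expR_gt0.
have en : expR s != 0 by rewrite gt_eqF.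
rewrite normrM.
set X := `|O (s, t)| * expR s; set Y := `|A (s, t)| / expR s.
have XE : X ^+ 2 <= 2 * E (s, t).
  by rewrite /X exprMn real_normK ?num_real//; exact: (sf_Oe F).
have YE : Y ^+ 2 <= W (s, t).
  rewrite /Y expr_div_n real_normK ?num_real// ler_pdivrMr ?exprn_gt0//.
  by rewrite mulrC; exact: (sf_Aw F).
have /andP[Hge Hle] := H_bound (O (s, t)).
rewrite (ger0_norm Hge).
apply: (@le_trans _ _ (2 * X * Y)).
  have -> : 2 * X * Y = 2 * `|O (s, t)| * `|A (s, t)| by rewrite /X /Y; field.
  exact: ler_wpM2r.
have : 0 <= m^-1 * (X - m * Y) ^+ 2 by rewrite mulr_ge0 ?sqr_ge0// invr_ge0 ltW.
have -> : m^-1 * (X - m * Y) ^+ 2 = m^-1 * X ^+ 2 - 2 * X * Y + m * Y ^+ 2 by field.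
have : m^-1 * X ^+ 2 <= m^-1 * (2 * E (s, t)) by rewrite ler_wpM2l// invr_ge0 ltW.
have : m * Y ^+ 2 <= m * W (s, t) by rewrite ler_wpM2l// ltW.
lra.
Qed.

Let ybound s : s1 <= s -> y s <= pi + 2 * D s.
Proof.
move=> s1s; have -> : pi = J (fun _ : R => 1) 0 pi :> R by rewrite J_cst; ring.
rewrite /D -JZ; last by cts.
rewrite -JD; [|cts|cts].
apply: J_le => //; [cts|cts|move=> t t0pi].
have /andP[_ Hle] := H_bound (O (s, t)); apply: le_trans Hle _.
have := sf_Oe F s1s t0pi; rewrite -/(E _).
have e1 : 1 <= expR s by have := expR_ge1Dx s; have := s1_ge1; lra.
have : O (s, t) ^+ 2 <= O (s, t) ^+ 2 * expR s ^+ 2 by rewrite ler_peMr ?sqr_ge0// exprn_ege1.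
have := sqr_ge0 (`|O (s, t)| - 1); have := real_normK (num_real (O (s, t))).
by rewrite /strip_energy; nra.
Qed.

(** As [Z] is monotone, [Z s] times a length comparable to [s] is controlled by the integral of [Z]
    over an interval to the left (lower bound) or to the right (upper bound). There [y] is
    nonnegative, it is bounded at the chosen end [T], and the integral of [k] is a small multiple of
    [s]. No constant depends on [h]. *)
Lemma kato_Z_bound (S K e ka eta s : R) : s1 <= S ->
  (forall s, s1 <= s -> w s <= K * (1 + s)) ->
  (forall s s', S <= s -> s <= s' -> J D s s' <= eta) ->
  0 < e -> 0 < K -> 0 < ka -> ka * (64 * K) = e -> eta * 64 = e * ka -> eta <= 1 ->
  2 * S + 2 <= s -> 96 <= e * s -> - (e / 2) <= Z s <= e / 2.
Proof.
move=> s1S wK Deta e0 K0 ka0 kaE etaE eta1 Ss es.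
have S1 := s1_ge1.
have s0 : 1 <= s by lra.
(* With this weight the energy part of the integral of [k] is $e(s+1)/32$ and the speed part at most
   that; this dictates the relations between [ka], [eta], [K] and [e]. *)
pose m := ka / (s + 1).
have m0 : 0 < m by rewrite divr_gt0//; lra.
have smallY a : S <= a -> exists2 T, a <= T <= a + 1 & y T <= pi + 2.
  move=> Sa; have aa1 : a < a + 1 by rewrite ltrDl.
  have [T aT yT] := J_exists_le aa1 cy; exists T => //.
  have -> : y T = y T * (a + 1 - a) by ring.
  apply: le_trans yT _; apply: (@le_trans _ _ (J (fun x => pi + 2 * D x) a (a + 1))).
    apply: J_le => //; [exact: ltW|cts|move=> x xa; apply: ybound; slra ybound].
  rewrite JD; [|cts|cts]; rewrite JZ// J_cst.
  have := Deta a (a + 1) Sa (ltW aa1); slra ybound.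
have kint a c : S <= a -> a <= c -> `|J k a c| <= 2 * m^-1 * eta + m * (K * (1 + c) * (c - a)).
  move=> Sa ac.
  apply: (@le_trans _ _ (J (fun x => 2 * m^-1 * D x + m * w x) a c)).
    by apply: J_abs_le => //; [cts|move=> x xa; apply: kbound => //; slra ybound].
  rewrite JD; [|cts|cts]; rewrite !JZ//.
  apply: lerD; first by apply: ler_wpM2l; [rewrite mulr_ge0 ?invr_ge0 ?ltW|exact: Deta].
  apply: ler_wpM2l; first exact: ltW.
  apply: J_prod_le => // x /andP[ax xc].
  apply: le_trans (wK x _) _; first by lra.
  by rewrite ler_pM2l// lerD2l.
have mE : m * (s + 1) = ka by rewrite /m divfK// gt_eqF//; lra.
have m1E : 2 * m^-1 * eta = e * (s + 1) / 32.
  have -> : eta = e * ka / 64 by lra.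
  by rewrite /m; field; rewrite !gt_eqF//; slra ybound.
have pi4 : pi < 4 :> R by have := @pihalf_lt2 R; lra.
have y_ge0 x : 0 <= y x.
  by apply: J_ge0 => //; [cts|move=> t _; have /andP[] := H_bound (O (x, t))].
apply/andP; split.
- have [|T /andP[T1 T2] yT] := smallY (s / 2 - 1); first by slra ybound.
  have Ts : T <= s by slra ybound.
  have ST : S <= T by slra ybound.
  have h1 : J Z T s <= Z s * (s - T).
    by apply: J_prod_le => // x xT; apply: Zmono; slra ybound.
  have := kint T s ST Ts; rewrite ler_norml => /andP[_ h2].
  have h3 : m * (K * (1 + s) * (s - T)) <= e * (s + 1) / 64.
    have -> : m * (K * (1 + s) * (s - T)) = (m * (s + 1)) * K * (s - T) by ring.
    rewrite mE (_ : ka * K = e / 64); last by slra ybound.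
    have : s - T <= s + 1 by slra ybound.
    by nra.
  move: h1 h2; rewrite JZE m1E => h1 h2.
  have h4 : - 6 - e * (s + 1) / 32 - e * (s + 1) / 64 <= Z s * (s - T).
    by have := y_ge0 s; slra ybound.
  rewrite leNgt; apply/negP => Zs.
  have : Z s * (s - T) <= - (e / 2) * (s / 2) by nra.
  by nra.
- have [|T /andP[T1 T2] yT] := smallY (2 * s); first by slra ybound.
  have sT : s <= T by slra ybound.
  have Ss' : S <= s by slra ybound.
  have h1 : Z s * (T - s) <= J Z s T.
    by rewrite -J_cst; apply: J_le => //; [cts|move=> x xT; apply: Zmono; slra ybound].
  have := kint s T Ss' sT; rewrite ler_norml => /andP[h2 _].
  have h3 : m * (K * (1 + T) * (T - s)) <= e * (s + 1) / 32.
    have -> : m * (K * (1 + T) * (T - s)) = (m * K) * ((1 + T) * (T - s)) by ring.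
    have : (1 + T) * (T - s) <= 2 * (s + 1) * (s + 1) by nra.
    have mK : 0 < m * K by rewrite mulr_gt0.
    move=> hT; apply: (@le_trans _ _ (m * K * (2 * (s + 1) * (s + 1)))).
      by rewrite ler_pM2l.
    have -> : m * K * (2 * (s + 1) * (s + 1)) = 2 * ((m * (s + 1)) * K) * (s + 1) by ring.
    by rewrite mE (_ : ka * K = e / 64); slra ybound.
  move: h1 h2; rewrite JZE m1E => h1 h2.
  have h4 : Z s * (T - s) <= 6 + e * (s + 1) / 32 + e * (s + 1) / 32.
    by have := y_ge0 s; slra ybound.
  rewrite leNgt; apply/negP => Zs.
  have : e / 2 * s <= Z s * (T - s) by nra.
  by nra.
Qed.

End KatoBound.

(** The dissipation between [s] and [s'] is the increment of [Z], and both values of [Z] lie within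
    [e / 2] of 0 from a threshold on that does not depend on [d]. *)
Lemma kato_bound (e : R) : 0 < e -> exists S, s1 <= S /\ forall d s s', 0 < d -> S <= s -> s <= s' ->
  J (fun x => J (fun t => d / (d ^+ 2 + O (x, t) ^+ 2) * (OS (x, t) ^+ 2 + OT (x, t) ^+ 2)) 0 pi) s s' <= e.
Proof.
move=> e0; have [K0 K00 wK0] := speed2_linear.
pose K := K0 + 1.
have K1 : 1 <= K by rewrite /K; lra.
have wK s : s1 <= s -> w s <= K * (1 + s).
  by move=> s1s; have := wK0 s s1s; rewrite /K; have := s1_ge1; nra.
pose e1 := Num.min e 1.
have e10 : 0 < e1 by rewrite lt_min e0 ltr01.
have e1e : e1 <= e by rewrite ge_min lexx.
have e11 : e1 <= 1 by rewrite ge_min lexx orbT.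
pose ka := e1 / (64 * K).
have kaE : ka * (64 * K) = e1 by rewrite /ka divfK// gt_eqF//; slra w0.
have ka0 : 0 < ka by rewrite divr_gt0//; lra.
have ka1 : ka <= 1 by nra.
pose eta := e1 * ka / 64.
have etaE : eta * 64 = e1 * ka by rewrite /eta divfK.
have eta0 : 0 < eta by rewrite divr_gt0// mulr_gt0.
have eta1 : eta <= 1 by nra.
have [S [s1S HS]] := energy_tail_at eta0.
exists (Num.max (2 * S + 2) (96 / e1)); split.
  by rewrite le_max; apply/orP; left; have := s1_ge1; lra.
move=> d s s' d0; rewrite ge_max => /andP[Ss es] ss'.
have es1 : 96 <= e1 * s by rewrite mulrC -ler_pdivrMr.
have Ss' : 2 * S + 2 <= s' by slra w0.
have es1' : 96 <= e1 * s' by nra.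
have s1s : s1 <= s by have := s1_ge1; slra w0.
have dH x : der x (J (hatan d) 0) (hatan d x) by apply: J_der; exact: hatan_cts.
have h'0 x : 0 <= d / (d ^+ 2 + x ^+ 2) by rewrite divr_ge0 ?ltW// hatan_den.
have KZ := kato_Z_bound (hatan_dcts d0) (fun x => hatan_der x d0) dH (hatan0 d) (Jaa _ _) h'0
  (fun x => hatanI_bound x d0) s1S wK HS e10 (lt_le_trans ltr01 K1) ka0 kaE etaE eta1.
have /andP[_ h1] := KZ s' Ss' es1'.
have /andP[h2 _] := KZ s Ss es1.
rewrite -(kato_identity (hatan_dcts d0) (fun x => hatan_der x d0) dH (hatan0 d) (Jaa _ _) s1s ss').
by slra w0.
Qed.

(** By the arithmetic-geometric mean, $2|O_s|$ is at most the weighted square of the dissipation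
    plus $(d^2 + O^2)/d$. For [d] of the order of $1/r$ the energy gives $O^2 \le 2 d^2 E$, so the
    second term is at most $d + 2 d E$ and tends to 0. *)
Lemma vorticity_block (e : R) : 0 < e -> exists S, s1 <= S /\ forall s, S <= s ->
  J (fun x => J (fun t => `|OS (x, t)|) 0 pi) (s - 2) (s + 2) <= e.
Proof.
move=> e0; have [S1 [s1S1 H1]] := kato_bound e0.
have [S2 [s1S2 H2]] := energy_tail_at (@ltr01 R).
exists (Num.max (Num.max S1 S2) (20 / e) + 2); split.
  have : S1 <= Num.max (Num.max S1 S2) (20 / e) by rewrite !le_max lexx.
  by slra w0.
move=> s Ss.
have [sS1 sS2 se] : [/\ S1 <= s - 2, S2 <= s - 2 & 20 / e <= s - 2].
  have h : Num.max (Num.max S1 S2) (20 / e) <= s - 2 by lra.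
  by move: h; rewrite !ge_max => /andP[/andP[-> ->] ->].
have ss : s - 2 <= s + 2 by lra.
pose d := expR (- (s - 2)).
have d0 : 0 < d by exact: expR_gt0.
have dn : d != 0 by rewrite gt_eqF.
have cint : continuous (fun z => d / (d ^+ 2 + O z ^+ 2)).
  exact: (cts_comp (hatan_dcts d0) cO).
have h1 := H1 d (s - 2) (s + 2) d0 sS1 ss.
have h2 := H2 (s - 2) (s + 2) sS2 ss.
pose Q z := d / (d ^+ 2 + O z ^+ 2) * (OS z ^+ 2 + OT z ^+ 2).
have cQ : continuous Q.
  by apply: ctsM; [exact: cint|cts].
have cK : continuous (fun x => J (fun t => Q (x, t)) 0 pi) by exact: J_param_cts.
apply: (@le_trans _ _ (J (fun x => 2^-1 * J (fun t => Q (x, t)) 0 pi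
    + (2^-1 * (d * pi) + d * D x)) (s - 2) (s + 2))).
  apply: J_le => //.
  - by apply: (@J_param_cts _ _ (fun z => `|OS z|)); cts.
  - by cts.
  move=> x /andP[x1 x2].
  have -> : d * pi = J (fun _ : R => d) 0 pi by rewrite J_cst; ring.
  rewrite /D -!JZ; try by cts.
  rewrite -JD; [|cts|cts].
  rewrite -JD; [|cts|cts].
  apply: J_le => //; [cts|cts|move=> t t0pi]; rewrite /Q.
  have s1x : s1 <= x by slra w0.
  have OE := sf_Oe F s1x t0pi.
  have ed : 1 <= d * expR x by rewrite /d -expRD; have := expR_ge1Dx (- (s - 2) + x); slra w0.
  have O2 : O (x, t) ^+ 2 <= d ^+ 2 * (2 * E (x, t)).
    have : O (x, t) ^+ 2 <= O (x, t) ^+ 2 * (d * expR x) ^+ 2 by rewrite ler_peMr ?sqr_ge0// exprn_ege1.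
    move/le_trans; apply.
    rewrite exprMn mulrCA ler_wpM2l ?sqr_ge0//.
  set q := OS (x, t); set o := O (x, t) in O2 *.
  have den : 0 < d ^+ 2 + o ^+ 2 by exact: hatan_den.
  have q2 : `|q| ^+ 2 = q ^+ 2 by rewrite real_normK ?num_real.
  have am : 2 * `|q| <= d / (d ^+ 2 + o ^+ 2) * q ^+ 2 + (d ^+ 2 + o ^+ 2) / d.
    rewrite -q2 -subr_ge0.
    have -> : d / (d ^+ 2 + o ^+ 2) * `|q| ^+ 2 + (d ^+ 2 + o ^+ 2) / d - 2 * `|q| =
      d / (d ^+ 2 + o ^+ 2) * (`|q| - (d ^+ 2 + o ^+ 2) / d) ^+ 2 by field; rewrite dn gt_eqF.
    by rewrite mulr_ge0 ?sqr_ge0// divr_ge0 ?ltW.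
  have od : (d ^+ 2 + o ^+ 2) / d <= d + d * (2 * E (x, t)).
    by rewrite ler_pdivrMr//; slra w0.
  have : 0 <= d / (d ^+ 2 + o ^+ 2) * OT (x, t) ^+ 2 by rewrite mulr_ge0 ?sqr_ge0// divr_ge0 ?ltW.
  by slra w0.
rewrite JD; [|cts|cts]; rewrite JD; [|cts|cts]; rewrite J_cst !JZ//.
have pi4 : pi < 4 :> R by have := @pihalf_lt2 R; lra.
have dE : d * (20 / e) <= 1.
  have : s - 2 <= expR (s - 2) by have := expR_ge1Dx (s - 2); slra w0.
  have : d * expR (s - 2) = 1 by rewrite /d -expRD addNr expR0.
  by nra.
have d20 : d * 20 <= e by rewrite -[leRHS]mul1r -ler_pdivrMr// -mulrA.
have := D0 0; nra.
Qed.

End Strip.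

(** * Flux of a function through its zero line *)

Section BoundaryFlux.
Context {R : realType}.

Lemma pi_lt4 : pi < 4 :> R.
Proof. by have := @pihalf_lt2 R; lra. Qed.

Lemma J_reflect (f : R -> R) : continuous f -> J (fun t => f (pi - t)) 0 pi = J f 0 pi.
Proof.
move=> cf; have cf2 : continuous (fun y => f (y + pi)) by cts.
transitivity (J (fun y => f (y + pi)) (- pi) (- 0)).
  by rewrite -(J_opp _ _ cf2); congr J; apply/funext => t; rewrite addrC.
by rewrite J_shift// oppr0 addNr add0r.
Qed.

Lemma hatan_id (d : R) : 0 < d -> 1 / 2 <= hatan d d.
Proof.
move=> d0; rewrite /hatan divff ?gt_eqF// atan1.
by have := @pihalf_ge1 R; lra.
Qed.

(* As d -> 0 the weight d / (d^2 + W^2) concentrates on the zero set of W. *)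
Lemma boundary_flux (W WT : R * R -> R) (s s' e : R) : s <= s' ->
  continuous W -> continuous WT -> (forall x t : R, der t (fun t => W (x, t)) (WT (x, t))) ->
  (forall x, s <= x <= s' -> W (x, 0) = 0) ->
  (forall d, 0 < d -> J (fun x => J (fun t => d / (d ^+ 2 + W (x, t) ^+ 2) * WT (x, t) ^+ 2) 0 pi) s s' <= e) ->
  J (fun x => `|WT (x, 0)|) s s' <= 2 * e.
Proof.
move=> ss' cW cWT dW W0 He.
have pi0 : 0 < pi :> R := pi_gt0 R.
have ca : continuous (fun x => `|WT (x, 0)|) by cts.
(* [k] is the tolerance for the oscillation of [WT] near the edge; on a fixed interval the resulting
   loss is removed by letting it tend to 0. *)
suff key k : 0 < k -> J (fun x => `|WT (x, 0)|) s s' <= 2 * e + 2 * k * (s' - s).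
  apply/ler_addgt0Pr => r r0.
  have k0 : 0 < r / (2 * (s' - s + 1)) by rewrite divr_gt0//; lra.
  apply: le_trans (key _ k0) _; rewrite lerD2l.
  have -> : 2 * (r / (2 * (s' - s + 1))) * (s' - s) = r * ((s' - s) / (s' - s + 1)) by field; lra.
  by rewrite ger_pMr// ler_pdivrMr; lra.
move=> k0.
have cT : continuous (fun z : R * R => WT (z.2, z.1)) by cts.
have /nbhs_ballP [r /= r0 Hr] := tube s s' (0 : R) cT k0.
pose q := Num.min (r / 2) pi.
have q0 : 0 < q by rewrite lt_min pi0 divr_gt0.
have qpi : q <= pi by rewrite ge_min lexx orbT.
have qr : q < r by rewrite gt_min; apply/orP; left; lra.
have near0 x t : s <= x <= s' -> 0 <= t <= q -> `|WT (x, t) - WT (x, 0)| <= k.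
  move=> xs tq; apply: (Hr t) => //.
  by rewrite /ball /= sub0r normrN ger0_norm; lra.
(* A slope that stays above [k] up to height [q] raises the modulus of [W] to at least [d], where
   the arctangent has reached $\pi/4 \ge 1/2$. *)
pose d := k * q.
have d0 : 0 < d by rewrite mulr_gt0.
have H12 := hatan_id d0.
have cden : continuous (fun z => d / (d ^+ 2 + W z ^+ 2)) by exact: (cts_comp (hatan_dcts d0) cW).
pose Q z := d / (d ^+ 2 + W z ^+ 2) * WT z ^+ 2.
have cQ : continuous Q by apply: ctsM; [exact: cden|cts].
have Q0 z : 0 <= Q z by rewrite mulr_ge0 ?sqr_ge0// divr_ge0 ?ltW// hatan_den.
have low x : s <= x <= s' -> 2^-1 * (`|WT (x, 0)| - 2 * k) <= J (fun t => Q (x, t)) 0 pi.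
  move=> xs.
  have JQ0 : 0 <= J (fun t => Q (x, t)) 0 pi by apply: J_ge0 => //; [exact: ltW|cts].
  have [small|big] := leP (`|WT (x, 0)|) (2 * k); first by lra.
  set a := `|WT (x, 0)| in big *.
  pose sg : R := if 0 <= WT (x, 0) then 1 else -1.
  have sga : sg * WT (x, 0) = a.
    by rewrite /sg /a; case: ifP => h; [rewrite mul1r ger0_norm|rewrite mulN1r ltr0_norm// ltNge h].
  have sg1 : sg * sg = 1 by rewrite /sg; case: ifP => _; ring.
  have WTlow t : 0 <= t <= q -> a - k <= sg * WT (x, t).
    move=> tq; have := near0 x t xs tq; rewrite ler_norml -sga => /andP[h1 h2].
    by move: h1 h2; rewrite /sg; case: ifP => _; slra R.
  have Wlow : k * q <= sg * W (x, q).
    have -> : sg * W (x, q) = J (fun t => sg * WT (x, t)) 0 q.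
      rewrite JZ; last by cts.
      by rewrite (@J_ftc _ _ (fun t => W (x, t))) ?W0 ?subr0//; cts.
    rewrite -[X in _ * X](subr0 q) -J_cst; apply: J_le; [exact: ltW|cts|cts|].
    by move=> t /WTlow; lra.
  have h1 : 1 / 2 <= hatan d (sg * W (x, q)) by apply: le_trans H12 _; exact: hatan_le.
  have h2 : hatan d (sg * W (x, q)) = J (fun t => d / (d ^+ 2 + W (x, t) ^+ 2) * (sg * WT (x, t))) 0 q.
    rewrite (@J_ftc _ _ (fun t => hatan d (sg * W (x, t)))).
    - by rewrite (W0 x xs) mulr0 hatan0 subr0.
    - by apply: ctsM; [exact: (@cts_comp2 _ _ _ _ (fun z => d / (d ^+ 2 + W z ^+ 2)) (fun=> x) id cden (cts_cst x) (@cts_id _))|cts].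
    - move=> t; have dsg : der t (fun t => sg * W (x, t)) (sg * WT (x, t)).
        by der_by ltac:(exact: dW); ring.
      refine (der_eq (@der_comp _ (hatan d) (fun t => sg * W (x, t)) t _ _ (hatan_der _ d0) dsg) _).
      by cbv beta; rewrite (_ : (sg * W (x, t)) ^+ 2 = W (x, t) ^+ 2)// exprMn (expr2 sg) sg1 mul1r.
  have h3 : (a - k) * hatan d (sg * W (x, q)) <= J (fun t => Q (x, t)) 0 q.
    rewrite h2 -JZ; last first.
      by apply: ctsM; [exact: (@cts_comp2 _ _ _ _ (fun z => d / (d ^+ 2 + W z ^+ 2)) (fun=> x) id cden (cts_cst x) (@cts_id _))|cts].
    apply: J_le; first exact: ltW.
    - apply: ctsM; first by cts.
      by apply: ctsM; [exact: (@cts_comp2 _ _ _ _ (fun z => d / (d ^+ 2 + W z ^+ 2)) (fun=> x) id cden (cts_cst x) (@cts_id _))|cts].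
    - by cts.
    - move=> t tq; rewrite /Q mulrCA; apply: ler_wpM2l.
        by rewrite divr_ge0 ?ltW// hatan_den.
      have -> : WT (x, t) ^+ 2 = (sg * WT (x, t)) * (sg * WT (x, t)) by rewrite mulrACA sg1 mul1r.
      have := WTlow t tq => hl.
      by apply: ler_wpM2r => //; slra R.
  have h4 : J (fun t => Q (x, t)) 0 q <= J (fun t => Q (x, t)) 0 pi.
    by apply: J_sub_itv => //; [cts|exact: ltW].
  by nra.
have HeQ : J (fun x => J (fun t => Q (x, t)) 0 pi) s s' <= e by exact: He.
have cJQ : continuous (fun x => J (fun t => Q (x, t)) 0 pi) by exact: J_param_cts.
have : J (fun x => 2^-1 * (`|WT (x, 0)| - 2 * k)) s s' <= e.
  by apply: le_trans HeQ; apply: J_le => //; cts.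
rewrite JZ; last by cts.
rewrite JB; [|cts|cts].
by rewrite J_cst; lra.
Qed.

End BoundaryFlux.

(** * The head on the axis and the oscillation of the pressure *)

Section Limits.
Context {R : realType} (b s1 : R).
Context (U US UT V VS VT O OS OT P PS PT A AS AT B BS BT : R * R -> R).
Context (F : strip_flow b s1 U US UT V VS VT O OS OT P PS PT A AS AT B BS BT).

Let cU := C1_cts (sf_U F).
Let cV := C1_cts (sf_V F).
Let cO := C1_cts (sf_O F).
Let cP := C1_cts (sf_P F).
Let cB := C1_cts (sf_B F).
Let cUS := C1_cx (sf_U F).
Let cUT := C1_cy (sf_U F).
Let cVS := C1_cx (sf_V F).
Let cVT := C1_cy (sf_V F).
Let cOS := C1_cx (sf_O F).
Let cOT := C1_cy (sf_O F).
Let cPS := C1_cx (sf_P F).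
Let cPT := C1_cy (sf_P F).
Let s1_ge1 := sf_s1 F.
Let pi0 : 0 < pi :> R := @pi_gt0 R.
Let pi0' : 0 <= pi :> R := @pi_ge0 R.
Let pi4 := @pi_lt4 R.
Local Notation E := (strip_energy US UT VS VT).
Local Notation W := (strip_speed2 b U V).
Local Notation D := (energy_at US UT VS VT).
Local Notation w := (speed2_at b U V).
Let cE : continuous E. Proof. by rewrite /strip_energy; cts. Qed.
Let cW : continuous W. Proof. by rewrite /strip_speed2; cts. Qed.
Let cD : continuous D. Proof. exact: J_param_cts. Qed.
Let cw : continuous w. Proof. exact: J_param_cts. Qed.
Let E0 z : 0 <= E z.
Proof. by rewrite /strip_energy; have := sqr_ge0 (US z); have := sqr_ge0 (UT z);
  have := sqr_ge0 (VS z); have := sqr_ge0 (VT z); lra. Qed.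
Let W0 z : 0 <= W z.
Proof. by rewrite /strip_speed2; have := sqr_ge0 (U z); have := sqr_ge0 (V z + b); lra. Qed.
Let D0 s : 0 <= D s. Proof. by apply: J_ge0 => //; cts. Qed.
Let w0 s : 0 <= w s. Proof. by apply: J_ge0 => //; cts. Qed.

(** Where [V] and [O] vanish, the head has derivative [- OT], and the term $(V + b)^2/2$ is constant
    and drops out of the increment. *)
Lemma head_increment (t0 s s' : R) : 0 <= t0 <= pi -> s1 <= s -> s <= s' ->
  (forall x, s1 <= x -> V (x, t0) = 0) -> (forall x, s1 <= x -> O (x, t0) = 0) ->
  (P (s', t0) + 2^-1 * U (s', t0) ^+ 2) - (P (s, t0) + 2^-1 * U (s, t0) ^+ 2)
  = - J (fun x => OT (x, t0)) s s'.
Proof.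
move=> t0pi s1s ss' V0 O0.
have s1s' : s1 <= s' by exact: le_trans ss'.
have := @J_ftc _ (fun x => PS (x, t0) + U (x, t0) * US (x, t0) + (V (x, t0) + b) * VS (x, t0))
  (fun x => P (x, t0) + 2^-1 * U (x, t0) ^+ 2 + 2^-1 * (V (x, t0) + b) ^+ 2) s s' ltac:(cts).
have d x : der x (fun x => P (x, t0) + 2^-1 * U (x, t0) ^+ 2 + 2^-1 * (V (x, t0) + b) ^+ 2)
   (PS (x, t0) + U (x, t0) * US (x, t0) + (V (x, t0) + b) * VS (x, t0)).
  by der_by ltac:(first [exact: (C1_dx (sf_P F))|exact: (C1_dx (sf_U F))|exact: (C1_dx (sf_V F))]); field.
move=> /(_ d); rewrite !V0// => H.
rewrite -JN; last by cts.
rewrite (@J_ext _ (fun x => - OT (x, t0)) (fun x => PS (x, t0) + U (x, t0) * US (x, t0) + (V (x, t0) + b) * VS (x, t0))) //; [|cts|cts|].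
  by rewrite H; ring.
move=> x /andP[sx _]; have s1x : s1 <= x by exact: le_trans sx.
by rewrite (sf_FS F)// O0// mul0r addr0.
Qed.

Let OT_flux (e : R) : 0 < e -> exists S, s1 <= S /\ forall s s', S <= s -> s <= s' ->
  J (fun x => `|OT (x, 0)|) s s' <= e /\ J (fun x => `|OT (x, pi)|) s s' <= e.
Proof.
move=> e0; have [S [s1S HS]] := kato_bound F (divr_gt0 e0 (ltr0n _ 2)).
exists S; split => // s s' Ss ss'.
have cden d : 0 < d -> continuous (fun z => d / (d ^+ 2 + O z ^+ 2)).
  by move=> d0; exact: (cts_comp (hatan_dcts d0) cO).
have low d : 0 < d -> J (fun x => J (fun t => d / (d ^+ 2 + O (x, t) ^+ 2) * OT (x, t) ^+ 2) 0 pi) s s' <= e / 2.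
  move=> d0; apply: le_trans (HS d s s' d0 Ss ss').
  have c1 : continuous (fun z => d / (d ^+ 2 + O z ^+ 2) * OT z ^+ 2) by apply: ctsM; [exact: cden|cts].
  have c2 : continuous (fun z => d / (d ^+ 2 + O z ^+ 2) * (OS z ^+ 2 + OT z ^+ 2)) by apply: ctsM; [exact: cden|cts].
  apply: J_le => //.
  - exact: (@J_param_cts _ _ (fun z => d / (d ^+ 2 + O z ^+ 2) * OT z ^+ 2)).
  - exact: (@J_param_cts _ _ (fun z => d / (d ^+ 2 + O z ^+ 2) * (OS z ^+ 2 + OT z ^+ 2))).
  move=> x _.
  apply: J_le => //.
  - exact: (cts_comp2 (h := fun z => d / (d ^+ 2 + O z ^+ 2) * OT z ^+ 2) c1 (cts_cst x) (@cts_id _)).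
  - exact: (cts_comp2 (h := fun z => d / (d ^+ 2 + O z ^+ 2) * (OS z ^+ 2 + OT z ^+ 2)) c2 (cts_cst x) (@cts_id _)).
  - move=> t _; apply: ler_wpM2l; first by rewrite divr_ge0 ?ltW// hatan_den.
    by rewrite lerDr sqr_ge0.
have eE : e = 2 * (e / 2) by lra.
split.
  rewrite eE; apply: (boundary_flux (W := O)) => //.
    by move=> x t; exact: (C1_dy (sf_O F)).
  by move=> x /andP[sx _]; apply: (sf_O0 F); apply: le_trans sx; exact: le_trans Ss.
have -> : (fun x => `|OT (x, pi)|) = (fun x => `|(fun z : R * R => - OT (z.1, pi - z.2)) (x, 0)|).
  by apply/funext => x /=; rewrite normrN subr0.
rewrite eE; apply: (@boundary_flux _ (fun z : R * R => O (z.1, pi - z.2)) (fun z : R * R => - OT (z.1, pi - z.2))) => //.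
- by cts.
- by cts.
- move=> x t /=.
  have dr : der t (fun t => pi - t) (-1) by der_by fail; ring.
  refine (der_eq (@der_comp _ (fun t => O (x, t)) (fun t => pi - t) t _ _ (C1_dy (sf_O F) _ _) dr) _).
  by ring.
- move=> x /andP[sx _] /=; rewrite subr0; apply: (sf_Opi F); apply: le_trans sx; exact: le_trans Ss.
- move=> d d0; apply: le_trans (low d d0); rewrite le_eqVlt; apply/orP; left; apply/eqP.
  congr J; apply/funext => x.
  rewrite -(@J_reflect _ (fun t => d / (d ^+ 2 + O (x, t) ^+ 2) * OT (x, t) ^+ 2)).
    by congr J; apply/funext => t /=; rewrite sqrrN.
  apply: (cts_comp2 (h := fun z => d / (d ^+ 2 + O z ^+ 2) * OT z ^+ 2) _ (cts_cst x) (@cts_id _)).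
  by apply: ctsM; [exact: cden|cts].
Qed.

Lemma head_tends : (exists L0, tends (fun s => P (s, 0) + 2^-1 * U (s, 0) ^+ 2) L0) /\
  (exists Lpi, tends (fun s => P (s, pi) + 2^-1 * U (s, pi) ^+ 2) Lpi).
Proof.
split; apply: cauchy_tends => e e0; have [S [s1S HS]] := OT_flux e0; exists S => s s' Ss ss'.
  have s1s := le_trans s1S Ss.
  rewrite head_increment ?lexx//; [|exact: (sf_V0 F)|exact: (sf_O0 F)].
  rewrite normrN; apply: le_trans (proj1 (HS s s' Ss ss')).
  by apply: J_abs => //; cts.
have s1s := le_trans s1S Ss.
rewrite head_increment ?lexx ?andbT//; [|exact: (sf_Vpi F)|exact: (sf_Opi F)].
rewrite normrN; apply: le_trans (proj2 (HS s s' Ss ss')).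
by apply: J_abs => //; cts.
Qed.

(** In the plane this is an integral over the half annulus $e^{s-2} \le r \le e^{s+2}$, with respect
    to the scale-invariant measure; its width leaves room for half discs of radius $e^s/2$ about
    points of modulus $e^s$. *)
Definition pressure_block (c s : R) : R :=
  J (fun x => J (fun t => `|P (x, t) - c|) 0 pi) (s - 2) (s + 2).

(** [P] differs from its angular mean by at most the angular integral of [|PT|], in which [OS] is
    small by [vorticity_block] and the products are split by Young's inequality. The speed is not
    yet known to be bounded, so it stays on the right; its small coefficient permits the later
    absorption. *)
Lemma pressure_block_bound (c e : R) : tends (fun s => J (fun t => P (s, t)) 0 pi) (pi * c) -> 0 < e ->
  exists S, s1 <= S /\ forall s, S <= s ->
    pressure_block c s <= e * (1 + J w (s - 2) (s + 2)) /\
    J (fun x => `|P (x, 0) - c|) (s - 2) (s + 2) <= e * (1 + J w (s - 2) (s + 2)).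
Proof.
move=> Mc e0.
have e16 : 0 < e / 16 by rewrite divr_gt0.
have e64 : 0 < e / 64 by rewrite divr_gt0.
(* Young's inequality puts [e / 4] on the speed and [e^-1] on the energy, whose tail must therefore
   be of order $e^2$. *)
have eta0 : 0 < e * (e / 16) by rewrite mulr_gt0.
have [S1 [s1S1 H1]] := vorticity_block F e16.
have [S2 [s1S2 H2]] := energy_tail_at F eta0.
have [S3 H3] := Mc _ e64.
exists (Num.max (Num.max S1 S2) S3 + 2); split.
  have : S1 <= Num.max (Num.max S1 S2) S3 by rewrite !le_max lexx.
  by lra.
move=> s Ss.
have [sS1 sS2 sS3] : [/\ S1 <= s - 2, S2 <= s - 2 & S3 <= s - 2].
  have h : Num.max (Num.max S1 S2) S3 <= s - 2 by lra.
  by move: h; rewrite !ge_max => /andP[/andP[-> ->] ->].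
have ss : s - 2 <= s + 2 by lra.
have h1 := H1 s ltac:(lra).
have h2 := H2 (s - 2) (s + 2) sS2 ss.
have cPTn : continuous (fun x => J (fun t => `|PT (x, t)|) 0 pi).
  by apply: (@J_param_cts _ _ (fun z => `|PT z|)); cts.
have cOSn : continuous (fun x => J (fun t => `|OS (x, t)|) 0 pi).
  by apply: (@J_param_cts _ _ (fun z => `|OS z|)); cts.
pose G x := J (fun t => `|PT (x, t)|) 0 pi + e / 64.
have cG : continuous G by rewrite /G; cts.
have point x t0 : s - 2 <= x <= s + 2 -> 0 <= t0 <= pi -> `|P (x, t0) - c| <= G x.
  move=> /andP[x1 x2] t0pi.
  have hM := H3 x ltac:(slra OT_flux).
  set M := J (fun t => P (x, t)) 0 pi in hM.
  have hP : `|pi * P (x, t0) - M| <= pi * J (fun t => `|PT (x, t)|) 0 pi.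
    have -> : pi * P (x, t0) - M = J (fun t => P (x, t0) - P (x, t)) 0 pi.
      by rewrite JB; [rewrite J_cst /M; ring|cts|cts].
    have -> : pi * J (fun t => `|PT (x, t)|) 0 pi = J (fun _ => J (fun t => `|PT (x, t)|) 0 pi) 0 pi.
      by rewrite J_cst; ring.
    apply: J_abs_le => //; [cts|cts|move=> t tpi].
    rewrite -(@J_ftc _ (fun t => PT (x, t)) (fun t => P (x, t))); [|cts|exact: (C1_dy (sf_P F))].
    have [tt0|/ltW tt0] := leP t t0.
      apply: le_trans (J_abs tt0 _) _; first by cts.
      by apply: J_sub_itv => //; [cts|slra OT_flux|slra OT_flux].
    rewrite J_sym normrN; apply: le_trans (J_abs tt0 _) _; first by cts.
    by apply: J_sub_itv => //; [cts|slra OT_flux|slra OT_flux].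
  rewrite -(ler_pM2l pi0) -[X in X * `|_|](ger0_norm pi0') -normrM.
  have -> : pi * (P (x, t0) - c) = (pi * P (x, t0) - M) + (M - pi * c) by ring.
  apply: le_trans (ler_normD _ _) _.
  rewrite /G mulrDr lerD//; apply: le_trans hM _.
  by rewrite ler_pMl//; have := @pihalf_ge1 R; slra OT_flux.
have s1x x : s - 2 <= x -> s1 <= x by move=> h; slra OT_flux.
have JG : J G (s - 2) (s + 2) <= (e / 4) * (1 + J w (s - 2) (s + 2)).
  rewrite /G JD; [|cts|cts]; rewrite J_cst.
  suff : J (fun x => J (fun t => `|PT (x, t)|) 0 pi) (s - 2) (s + 2) <=
      J (fun x => J (fun t => `|OS (x, t)|) 0 pi) (s - 2) (s + 2) +
      (e / 4) * J w (s - 2) (s + 2) + e^-1 * J D (s - 2) (s + 2).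
    have : e^-1 * J D (s - 2) (s + 2) <= e / 16.
      by rewrite ler_pdivrMl.
    by slra OT_flux.
  rewrite -!JZ//; rewrite -JD//; last by cts.
  rewrite -JD//; [|cts|cts].
  apply: J_le => //; [cts|move=> x /andP[x1 x2]].
  have cwx : continuous (fun t => W (x, t)) by cts.
  have cEx : continuous (fun t => E (x, t)) by cts.
  rewrite /energy_at /speed2_at -!JZ//; rewrite -JD; [|cts|cts].
  rewrite -JD; [|cts|cts].
  apply: J_le => //; [cts|cts|move=> t tpi].
  rewrite (sf_PT F) ?s1x//.
  set u := U _; set vs := VS _; set vb := V _ + b; set us := US _; set os := OS _.
  have am (X Y : R) : `|X * Y| <= e / 4 * X ^+ 2 + e^-1 * Y ^+ 2.
    rewrite normrM -(real_normK (num_real X)) -(real_normK (num_real Y)).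
    have : 0 <= e^-1 * (`|Y| - e / 2 * `|X|) ^+ 2 by rewrite mulr_ge0 ?sqr_ge0// invr_ge0 ltW.
    have -> : e^-1 * (`|Y| - e / 2 * `|X|) ^+ 2 = e^-1 * `|Y| ^+ 2 - `|X| * `|Y| + e / 4 * `|X| ^+ 2.
      by field; rewrite gt_eqF.
    by slra OT_flux.
  have h3 := am u vs; have h4 := am vb us.
  have h5 : e^-1 * (us ^+ 2 + vs ^+ 2) <= e^-1 * E (x, t).
    rewrite ler_pM2l ?invr_gt0// /strip_energy -/us -/vs.
    by have := sqr_ge0 (UT (x, t)); have := sqr_ge0 (VT (x, t)); slra OT_flux.
  apply: le_trans (ler_normD _ _) _; apply: le_trans (lerD (ler_normB _ _) (lexx _)) _.
  by rewrite /strip_speed2 -/u -/vb; slra OT_flux.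
have JG0 : 0 <= J G (s - 2) (s + 2).
  apply: J_ge0 => // x xs; apply: le_trans (point x 0 xs _); [exact: normr_ge0|by rewrite lexx].
have w00 : 0 <= J w (s - 2) (s + 2) by apply: J_ge0.
have e1w : 0 <= e * (1 + J w (s - 2) (s + 2)) by apply: mulr_ge0; slra OT_flux.
split.
  apply: (@le_trans _ _ (J (fun x => pi * G x) (s - 2) (s + 2))).
    apply: J_le => //; [|cts|move=> x xs].
      by apply: (@J_param_cts _ _ (fun z => `|P z - c|)); cts.
    have -> : pi * G x = J (fun _ => G x) 0 pi by rewrite J_cst; ring.
    by apply: J_le => //; [cts|cts|move=> t tpi; exact: point].
  have : pi * J G (s - 2) (s + 2) <= 4 * J G (s - 2) (s + 2) by rewrite ler_wpM2r// ltW.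
  by rewrite JZ//; slra OT_flux.
apply: (@le_trans _ _ (J G (s - 2) (s + 2))); last by slra OT_flux.
by apply: J_le => //; [cts|move=> x xs; apply: point => //; rewrite lexx].
Qed.

End Limits.

(** * Bounded speed and the limits of the pressure on the axis *)

Section Limits.
Context {R : realType} (b s1 : R).
Context (U US UT V VS VT O OS OT P PS PT A AS AT B BS BT : R * R -> R).
Context (F : strip_flow b s1 U US UT V VS VT O OS OT P PS PT A AS AT B BS BT).

Let cU := C1_cts (sf_U F).
Let cV := C1_cts (sf_V F).
Let cO := C1_cts (sf_O F).
Let cP := C1_cts (sf_P F).
Let cB := C1_cts (sf_B F).
Let cUS := C1_cx (sf_U F).
Let cUT := C1_cy (sf_U F).
Let cVS := C1_cx (sf_V F).
Let cVT := C1_cy (sf_V F).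
Let cOS := C1_cx (sf_O F).
Let cOT := C1_cy (sf_O F).
Let cPS := C1_cx (sf_P F).
Let cPT := C1_cy (sf_P F).
Let s1_ge1 := sf_s1 F.
Let pi0 : 0 < pi :> R := @pi_gt0 R.
Let pi0' : 0 <= pi :> R := @pi_ge0 R.
Let pi4 := @pi_lt4 R.
Local Notation E := (strip_energy US UT VS VT).
Local Notation W := (strip_speed2 b U V).
Local Notation D := (energy_at US UT VS VT).
Local Notation w := (speed2_at b U V).
Let cE : continuous E. Proof. by rewrite /strip_energy; cts. Qed.
Let cW : continuous W. Proof. by rewrite /strip_speed2; cts. Qed.
Let cD : continuous D. Proof. exact: J_param_cts. Qed.
Let cw : continuous w. Proof. exact: J_param_cts. Qed.
Let E0 z : 0 <= E z.
Proof. by rewrite /strip_energy; have := sqr_ge0 (US z); have := sqr_ge0 (UT z);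
  have := sqr_ge0 (VS z); have := sqr_ge0 (VT z); lra. Qed.
Let W0 z : 0 <= W z.
Proof. by rewrite /strip_speed2; have := sqr_ge0 (U z); have := sqr_ge0 (V z + b); lra. Qed.
Let D0 s : 0 <= D s. Proof. by apply: J_ge0 => //; cts. Qed.
Let w0 s : 0 <= w s. Proof. by apply: J_ge0 => //; cts. Qed.


Context (c : R) (Mc : tends (fun s => J (fun t => P (s, t)) 0 pi) (pi * c)).
Local Notation blk := (pressure_block P c).
Context (C : R) (C0 : 0 < C).
(** The half disc comparison about points of the axis, supplied later in Cartesian coordinates by
    [half_discs]. Each end is controlled separately only when [b = 0]. *)
Context (HB : forall e : R, 0 < e -> exists S, forall s, S <= s ->
  (b = 0 -> `|P (s, 0) - c| <= C * blk s + e /\ `|P (s, pi) - c| <= C * blk s + e) /\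
  `|P (s, 0) + P (s, pi) - 2 * c| <= C * blk s + e).

(** A slice of energy at most 1 bounds the speed on the half circle by its value [U0] on the axis;
    [speed2_growth] carries the bound over the block. The block then bounds the pressure on the
    axis, and the convergent head turns this into a bound on [U0 ^+ 2] by a constant plus a fraction
    of itself. *)
Lemma speed2_bounded : exists K S, s1 <= S /\ forall s, S <= s -> w s <= K.
Proof.
have [L0 HL0] := (head_tends F).1; have [Lpi HLpi] := (head_tends F).2.
pose K1 := 8 * (96 + 8 * b ^+ 2) + 16.
have b2 := sqr_ge0 b.
(* The speed of the block is at most [64 * U0 ^+ 2 + K1], so [C * e = 1 / 256] leaves $U_0^2/4$
   against the $U_0^2/2$ of the head. *)
pose e := (256 * C)^-1.
have e0 : 0 < e by rewrite invr_gt0; have := C0; lra.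
have eC : C * e = 1 / 256 by rewrite /e; field; rewrite gt_eqF.
have [S1 [s1S1 H1]] := pressure_block_bound F Mc e0.
have [S2 [s1S2 H2]] := energy_tail_at F (@ltr01 R).
have [S3 H3] := HB (@ltr01 R).
have [S4 H4] := HL0 _ (@ltr01 R).
have [S5 H5] := HLpi _ (@ltr01 R).
pose K2 := 4 * (`|L0| + `|Lpi| + 2 * `|c| + 4 + (1 + K1) / 256).
pose S0 := Num.max (Num.max (Num.max S1 S2) (Num.max S3 S4)) S5.
exists (2 * (8 * K2 + 96 + 8 * b ^+ 2) + 2), (S0 + 2).
have S0s : forall s, S0 + 2 <= s -> [/\ S1 <= s - 2, S2 <= s - 2, S3 <= s, S4 <= s & S5 <= s].
  move=> s h; have : S0 <= s - 2 by slra HB.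
  by rewrite /S0 !ge_max => /andP[/andP[/andP[h1 h2] /andP[h3 h4]] h5]; split => //; slra HB.
split.
  by have [] := S0s _ (lexx _); slra HB.
move=> s Ss.
have s1s1 : s < s + 1 by rewrite ltrDl.
have [sS1 sS2 _ _ _] := S0s s Ss.
have [x /andP[sx xs] Dx] := J_exists_le s1s1 cD.
have {Dx} Dx : D x <= 1.
  have := H2 s (s + 1) ltac:(slra HB) (ltW s1s1).
  by move: Dx; rewrite addrAC subrr add0r mulr1; slra HB.
have [xS1 xS2 xS3 xS4 xS5] := S0s x ltac:(slra HB).
have s1x : s1 <= x by slra HB.
set U0 := U (x, 0).
have wx : w x <= 8 * U0 ^+ 2 + 96 + 8 * b ^+ 2.
  have cont2 (f f' : R * R -> R) t : continuous f' -> 0 <= t <= pi ->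
      (forall x t : R, der t (fun t => f (x, t)) (f' (x, t))) ->
      (forall z, f' z ^+ 2 <= E z) -> f (x, t) ^+ 2 <= 2 * f (x, 0) ^+ 2 + 8.
    move=> cf' /andP[t0 tpi] df fE.
    have cfx : continuous (fun t => f' (x, t)) by cts.
    have := sqr_J_le t0 cfx.
    rewrite (@J_ftc _ _ (fun t => f (x, t)))//.
    have h : J (fun t => f' (x, t) ^+ 2) 0 t <= D x.
      apply: (@le_trans _ _ (J (fun t => f' (x, t) ^+ 2) 0 pi)).
        by apply: J_sub_itv => //; [cts|move=> y _; exact: sqr_ge0].
      by apply: J_le => //; cts.
    have h0 : 0 <= J (fun t => f' (x, t) ^+ 2) 0 t by apply: J_ge0 => //; [cts|move=> y _; exact: sqr_ge0].
    have := sqr_ge0 (2 * f (x, 0) - f (x, t)).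
    rewrite subr0; set X := J _ 0 t in h h0 *; set f0 := f (x, 0); set f1 := f (x, t).
    have tX : t * X <= 4 by rewrite -[leRHS]mulr1; apply: ler_pM => //; [exact: le_trans tpi (ltW pi4)|exact: le_trans h Dx].
    by nra.
  have -> : 8 * U0 ^+ 2 + 96 + 8 * b ^+ 2 = (2 * U0 ^+ 2 + 24 + 2 * b ^+ 2) * 4 by ring.
  apply: (@le_trans _ _ ((2 * U0 ^+ 2 + 24 + 2 * b ^+ 2) * (pi - 0))); last first.
    by apply: ler_wpM2l; [have := sqr_ge0 U0; slra HB|rewrite subr0 ltW].
  rewrite -J_cst; apply: J_le => //; [cts|cts|move=> t tpi].
  rewrite /strip_speed2.
  have h1 := cont2 U UT t cUT tpi (C1_dy (sf_U F)) (fun z => ltac:(rewrite /strip_energy;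
    have := sqr_ge0 (US z); have := sqr_ge0 (VS z); have := sqr_ge0 (VT z); slra HB)).
  have h2 := cont2 V VT t cVT tpi (C1_dy (sf_V F)) (fun z => ltac:(rewrite /strip_energy;
    have := sqr_ge0 (US z); have := sqr_ge0 (VS z); have := sqr_ge0 (UT z); slra HB)).
  rewrite (sf_V0 F)// in h2.
  have := sqr_ge0 (V (x, t) - b); rewrite -/U0 in h1.
  by nra.
have near y : x - 2 <= y -> y <= x + 2 -> w y <= 2 * w x + 4.
  move=> y1 y2; apply: le_trans (speed2_growth F x y) _.
  rewrite lerD2l.
  have h1 : `|y - x| <= 2 by rewrite ler_norml; move: y1 y2; slra HB.
  have h2 : `|J D x y| <= 1.
    have [xy|/ltW yx] := leP x y; move: (sS2) (sx) (xS2) => ? ? ?.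
      by rewrite ger0_norm; [apply: H2; slra HB|exact: J_ge0].
    by rewrite J_sym normrN ger0_norm; [apply: H2; slra HB|exact: J_ge0].
  rewrite -[leRHS]mulr1; apply: ler_pM => //.
  by slra HB.
have xx : x - 2 <= x + 2 by slra HB.
have W4 : J w (x - 2) (x + 2) <= 64 * U0 ^+ 2 + K1.
  apply: (@le_trans _ _ ((2 * w x + 4) * (x + 2 - (x - 2)))).
    by rewrite -J_cst; apply: J_le => //; [cts|move=> y /andP[y1 y2]; exact: near].
  by rewrite /K1; slra HB.
have blkx : C * blk x <= (1 + K1) / 256 + 4^-1 * U0 ^+ 2.
  have := (H1 x ltac:(move: xS1; slra HB)).1.
  move=> h; apply: (@le_trans _ _ (C * (e * (1 + J w (x - 2) (x + 2))))).
    by rewrite ler_pM2l.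
  by rewrite mulrA eC; slra HB.
have U0K : U0 ^+ 2 <= K2.
  have [hb hsum] := H3 x xS3.
  have q0 := H4 x xS4; have q5 := H5 x xS5.
  move: q0 q5; rewrite -/U0 !ler_norml => /andP[q1 q2] /andP[q3 q4].
  have nL0 := ler_norm L0; have nLpi := ler_norm Lpi.
  have nc := ler_norm (- c); rewrite normrN in nc.
  have nL0' := normr_ge0 L0; have nLpi' := normr_ge0 Lpi; have nc' := normr_ge0 c.
  have [b0|bn] := eqVneq b 0.
    have [] := hb b0; rewrite !ler_norml => /andP[p1 p2] _.
    by rewrite /K2; move: p1 q2 blkx nL0 nc; slra HB.
  (* For [b <> 0] the two heads add up to [P (x, 0) + P (x, pi) + U0 ^+ 2], so control of the sum of
     the pressures is enough. *)
  have Upi : U (x, pi) = U0.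
    by have := sf_b F s1x => /(mulfI bn) <-.
  rewrite Upi in q3 q4.
  move: hsum; rewrite ler_norml => /andP[p1 p2].
  by rewrite /K2; move: p1 q2 q4 blkx nL0 nLpi nc nc'; slra HB.
have wx2 : w x <= 8 * K2 + 96 + 8 * b ^+ 2 by move: wx U0K; slra HB.
apply: le_trans (speed2_growth F x s) _.
have h1 : `|s - x| <= 1 by rewrite ler_norml; move: sx xs; slra HB.
have h2 : `|J D x s| <= 1.
  by rewrite J_sym normrN ger0_norm; [apply: H2; move: sx xs sS2; slra HB|exact: J_ge0].
have h3 : `|s - x| * `|J D x s| <= 1 by rewrite -[leRHS]mulr1; apply: ler_pM.
by rewrite -mulrA; slra HB.
Qed.

Lemma pressure_block_tends : tends blk 0 /\
  tends (fun s => J (fun x => `|P (x, 0) - c|) (s - 2) (s + 2)) 0.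
Proof.
have [K [S0 [s1S0 wK]]] := speed2_bounded.
have key e : 0 < e -> exists S, forall s, S <= s -> blk s <= e /\
    J (fun x => `|P (x, 0) - c|) (s - 2) (s + 2) <= e.
  move=> e0.
  have K0 : 0 <= K by apply: le_trans (w0 S0) (wK _ (lexx _)).
  have d0 : 0 < e / (1 + 4 * K) by rewrite divr_gt0//; lra.
  have [S1 [s1S1 H1]] := pressure_block_bound F Mc d0.
  exists (Num.max S0 S1 + 2) => s Ss.
  have [s0 s11] : S0 <= s - 2 /\ S1 <= s - 2.
    have hm : Num.max S0 S1 <= s - 2 by lra.
    by move: hm; rewrite ge_max => /andP[].
  have ss : s - 2 <= s + 2 by lra.
  have hw : J w (s - 2) (s + 2) <= 4 * K.
    have -> : 4 * K = K * (s + 2 - (s - 2)) by ring.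
    by rewrite -J_cst; apply: J_le => //; [cts|move=> x /andP[x1 x2]; apply: wK; lra].
  have [h1 h2] := H1 s ltac:(lra).
  have h3 : e / (1 + 4 * K) * (1 + J w (s - 2) (s + 2)) <= e.
    by rewrite mulrAC ler_pdivrMr; [apply: ler_wpM2l; [exact: ltW|lra]|lra].
  by split; [exact: le_trans h1 h3|exact: le_trans h2 h3].
split=> e e0; have [S HS] := key e e0; exists S => s Ss; rewrite subr0.
  rewrite ger0_norm; first by have [] := HS s Ss.
  apply: J_ge0; [lra| |move=> x _].
    by apply: (@J_param_cts _ _ (fun z => `|P z - c|)); cts.
  by apply: J_ge0 => //; cts.
rewrite ger0_norm; first by have [] := HS s Ss.
by apply: J_ge0; [lra|cts|].
Qed.

Lemma boundary_pressure_tends : tends (fun s => P (s, 0)) c /\ tends (fun s => P (s, pi)) c.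
Proof.
have [Tb Tb0] := pressure_block_tends.
have [b0|bn] := eqVneq b 0.
  suff key e : 0 < e -> exists S, forall s, S <= s -> `|P (s, 0) - c| <= e /\ `|P (s, pi) - c| <= e.
    by split=> e e0; have [S HS] := key e e0; exists S => s /HS[].
  move=> e0; have e2 : 0 < e / 2 by lra.
  have eC : 0 < e / 2 / C by rewrite divr_gt0.
  have [S1 H1] := HB e2; have [S2 H2] := Tb _ eC.
  exists (Num.max S1 S2) => s; rewrite ge_max => /andP[sS1 sS2].
  have [h1 h2] := (H1 s sS1).1 b0.
  have := H2 s sS2; rewrite subr0 => h; have := le_trans (ler_norm _) h.
  rewrite ler_pdivlMr// mulrC => h3.
  by split; lra.
have [L0 HL0] := (head_tends F).1; have [Lpi HLpi] := (head_tends F).2.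
pose c0 := c + (L0 - Lpi) / 2.
have sumT e : 0 < e -> exists S, forall s, S <= s -> `|P (s, 0) + P (s, pi) - 2 * c| <= e.
  move=> e0; have e2 : 0 < e / 2 by lra.
  have eC : 0 < e / 2 / C by rewrite divr_gt0.
  have [S1 H1] := HB e2; have [S2 H2] := Tb _ eC.
  exists (Num.max S1 S2) => s; rewrite ge_max => /andP[sS1 sS2].
  have h1 := (H1 s sS1).2.
  have := H2 s sS2; rewrite subr0 => h; have := le_trans (ler_norm _) h.
  rewrite ler_pdivlMr// mulrC => h3; lra.
have T0 : tends (fun s => P (s, 0)) c0.
  move=> e e0; have e2 : 0 < e / 2 by lra.
  have [S1 H1] := HL0 _ e2; have [S2 H2] := HLpi _ e2; have [S3 H3] := sumT _ e2.
  exists (Num.max (Num.max S1 S2) (Num.max S3 s1)) => s; rewrite !ge_max.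
  move=> /andP[/andP[sS1 sS2] /andP[sS3 s1s]].
  have Upi : U (s, pi) = U (s, 0) by have := sf_b F s1s => /(mulfI bn) <-.
  have := H1 s sS1; have := H2 s sS2; have := H3 s sS3; rewrite Upi /c0 !ler_norml.
  by move=> /andP[? ?] /andP[? ?] /andP[? ?]; apply/andP; split; lra.
(* Otherwise [|P - c|] would stay above half the gap on whole blocks of length 4, whose integrals
   tend to 0. *)
have c0E : c0 = c.
  apply/eqP; rewrite -subr_eq0 -normr_eq0 eq_le normr_ge0 andbT leNgt; apply/negP => gap.
  set g := `|c0 - c| in gap.
  have g2 : 0 < g / 2 by lra.
  have [S1 H1] := T0 _ g2; have [S2 H2] := Tb0 _ g2.
  pose s := Num.max S1 S2 + 2.
  have [h1 h2] : S1 <= s - 2 /\ S2 <= s - 2.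
    have hm : Num.max S1 S2 <= s - 2 by rewrite /s; lra.
    by move: hm; rewrite ge_max => /andP[].
  have ss : s - 2 <= s + 2 by lra.
  have := H2 s ltac:(lra); rewrite subr0 => h; have {}h := le_trans (ler_norm _) h.
  have : (g / 2) * (s + 2 - (s - 2)) <= J (fun x => `|P (x, 0) - c|) (s - 2) (s + 2).
    rewrite -J_cst; apply: J_le => //; [cts|cts|move=> x /andP[x1 _]].
    have := H1 x ltac:(lra); have := ler_normD (c0 - P (x, 0)) (P (x, 0) - c).
    by rewrite distrC addrA subrK -/g; lra.
  by lra.
split; first by rewrite -c0E.
move=> e e0; have e2 : 0 < e / 2 by lra.
have [S1 H1] := T0 _ e2; have [S2 H2] := sumT _ e2.
exists (Num.max S1 S2) => s; rewrite ge_max => /andP[sS1 sS2].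
have := H1 s sS1; have := H2 s sS2; rewrite c0E !ler_norml.
by move=> /andP[? ?] /andP[? ?]; apply/andP; split; lra.
Qed.

End Limits.

(** * The flow in the half plane *)

Section Clamp.
Context {R : realType}.
Implicit Types t : R.

Definition clamp t : R := Num.max 0 (Num.min 1 t).

Lemma clamp_cts : continuous clamp.
Proof. by rewrite /clamp; cts. Qed.

Lemma clamp_ge0 t : 0 <= clamp t. Proof. by rewrite /clamp le_max lexx. Qed.

Lemma clamp_le1 t : clamp t <= 1.
Proof. by rewrite /clamp ge_max ler01 ge_min lexx. Qed.

Lemma clamp0 t : t <= 0 -> clamp t = 0.
Proof. by move=> t0; apply/max_idPl; rewrite ge_min t0 orbT. Qed.

Lemma clamp1 t : 1 <= t -> clamp t = 1.
Proof. by move=> t1; rewrite /clamp (min_idPl t1); apply/max_idPr. Qed.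

Lemma cts_clamp (T : topologicalType) (f : T -> R) : continuous f -> continuous (fun x => clamp (f x)).
Proof. by move=> cf; apply: (cts_comp clamp_cts). Qed.

End Clamp.

Section PolarSub.
Context {R : realType}.

Lemma cts_abs2 (f : R * R -> R) : continuous f -> continuous (fun z : R * R => f (z.1, `|z.2|)).
Proof. by move=> cf; cts. Qed.

Lemma sqr_norm_sum (r c1 c2 t : R) :
  (c1 + r * cos t - c1) ^+ 2 + (c2 + r * sin t - c2) ^+ 2 = r ^+ 2.
Proof.
have := cos2Dsin2 t => h.
have -> : (c1 + r * cos t - c1) ^+ 2 + (c2 + r * sin t - c2) ^+ 2 = r ^+ 2 * (cos t ^+ 2 + sin t ^+ 2) by ring.
by rewrite h mulr1.
Qed.

(** A common measure for polar integrals about different centres: the sector integral is bounded by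
    one over a square about the origin. The majorant [f] carries the cutoff. *)
Lemma polar_sub (f g : R * R -> R) (c : R * R) (A B r1 r2 a1 a2 : R) :
  continuous f -> continuous g -> (forall z, 0 <= f z) -> 0 < A ->
  (forall z : R * R, A ^+ 2 <= (z.1 - c.1) ^+ 2 + (z.2 - c.2) ^+ 2 -> f z = 0) ->
  `|c.1| + A <= B -> `|c.2| + A <= B ->
  0 <= r1 -> r1 <= r2 -> r2 <= A -> - (pi / 4) <= a1 -> a1 <= a2 -> a2 <= 7 * (pi / 4) ->
  (forall r t, r1 <= r <= r2 -> a1 <= t <= a2 ->
     g (c.1 + r * cos t, c.2 + r * sin t) <= f (c.1 + r * cos t, c.2 + r * sin t)) ->
  J (fun r => J (fun t => r * g (c.1 + r * cos t, c.2 + r * sin t)) a1 a2) r1 r2 <=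
  J (fun x => J (fun y => f (x, y)) (- B) B) (- B) B.
Proof.
move=> cf cg f0 A0 fz B1 B2 r10 r12 r2A a1p a12 a2p gf.
rewrite (polar_box A0 cf fz B1 B2).
rewrite -(@J_fubini _ (fun z : R * R => f (c.1 + z.1 * cos z.2, c.2 + z.1 * sin z.2) * z.1)); last by cts.
have cF (a b : R) : continuous (fun r : R => J (fun t => f (c.1 + r * cos t, c.2 + r * sin t) * r) a b).
  by apply: (@J_param_cts _ _ (fun z : R * R => f (c.1 + z.1 * cos z.2, c.2 + z.1 * sin z.2) * z.1)); cts.
have cG : continuous (fun r : R => J (fun t => r * g (c.1 + r * cos t, c.2 + r * sin t)) a1 a2).
  by apply: (@J_param_cts _ _ (fun z : R * R => z.1 * g (c.1 + z.1 * cos z.2, c.2 + z.1 * sin z.2))); cts.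
apply: (@le_trans _ _ (J (fun r => J (fun t => f (c.1 + r * cos t, c.2 + r * sin t) * r) a1 a2) r1 r2)).
  apply: J_le => // r rr; apply: J_le => //; [cts|cts|move=> t tt].
  by rewrite mulrC; apply: ler_wpM2r; [lra|exact: gf].
apply: (@le_trans _ _ (J (fun r => J (fun t => f (c.1 + r * cos t, c.2 + r * sin t) * r) (- (pi / 4)) (7 * (pi / 4))) r1 r2)).
  apply: J_le => // r rr; apply: J_sub_itv => //; first by cts.
  by move=> t _; rewrite mulr_ge0//; lra.
apply: J_sub_itv => // r rr; apply: J_ge0; [lra|cts|].
by move=> t _; rewrite mulr_ge0//; lra.
Qed.

End PolarSub.

(* A stationary flow in the half plane outside a disc: u, v are the velocity
   components, o is the vorticity, p the pressure; all functions are extended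
   to the whole plane, the equations hold where [0 <= y] and [r1 <= |z|]. *)
Record plane_flow {R : realType} (b r1 : R) (u ux uy v vx vy o ox oy p px py : R * R -> R) : Prop := PlaneFlow {
  pf_u : C1 u ux uy; pf_v : C1 v vx vy; pf_o : C1 o ox oy; pf_p : C1 p px py;
  pf_r1 : expR 1 <= r1;
  pf_div : forall x y : R, 0 <= y -> r1 ^+ 2 <= x ^+ 2 + y ^+ 2 -> ux (x, y) + vy (x, y) = 0;
  pf_oE : forall x y : R, 0 <= y -> r1 ^+ 2 <= x ^+ 2 + y ^+ 2 -> o (x, y) = vx (x, y) - uy (x, y);
  pf_px : forall x y : R, 0 <= y -> r1 ^+ 2 <= x ^+ 2 + y ^+ 2 ->
    px (x, y) = - oy (x, y) - u (x, y) * ux (x, y) - (v (x, y) + b) * uy (x, y);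
  pf_py : forall x y : R, 0 <= y -> r1 ^+ 2 <= x ^+ 2 + y ^+ 2 ->
    py (x, y) = ox (x, y) - u (x, y) * vx (x, y) - (v (x, y) + b) * vy (x, y);
  pf_v0 : forall x : R, r1 ^+ 2 <= x ^+ 2 -> v (x, 0) = 0;
  pf_o0 : forall x : R, r1 ^+ 2 <= x ^+ 2 -> o (x, 0) = 0;
  pf_b : forall x : R, r1 ^+ 2 <= x ^+ 2 -> b * u (x, 0) = b * u (- x, 0);
  pf_en : exists En : R, forall (B : R) (f : R * R -> R), 0 <= B -> continuous f ->
    (forall x y : R, 0 <= f (x, y) <=
       ux (x, `|y|) ^+ 2 + uy (x, `|y|) ^+ 2 + vx (x, `|y|) ^+ 2 + vy (x, `|y|) ^+ 2) ->
    (forall x y : R, x ^+ 2 + y ^+ 2 <= r1 ^+ 2 -> f (x, y) = 0) ->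
    J (fun x => J (fun y => f (x, y)) (- B) B) (- B) B <= En }.

(** * The tail of the Dirichlet integral *)

Section PlaneEnergy.
Context {R : realType} (b r1 : R) (u ux uy v vx vy o ox oy p px py : R * R -> R).
Context (F : plane_flow b r1 u ux uy v vx vy o ox oy p px py).
Let cux := C1_cx (pf_u F).
Let cuy := C1_cy (pf_u F).
Let cvx := C1_cx (pf_v F).
Let cvy := C1_cy (pf_v F).

Definition plane_energy (z : R * R) : R := ux z ^+ 2 + uy z ^+ 2 + vx z ^+ 2 + vy z ^+ 2.
Local Notation e := plane_energy.

Lemma plane_energy_cts : continuous e.
Proof. by rewrite /plane_energy; cts. Qed.

Lemma plane_energy_ge0 z : 0 <= e z.
Proof. by rewrite /plane_energy !addr_ge0 ?sqr_ge0. Qed.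

Lemma plane_energy_tail (eps : R) : 0 < eps -> exists R0, r1 <= R0 /\
  forall (c : R * R) (rho1 rho2 a1 a2 : R), 0 <= rho1 -> rho1 <= rho2 ->
  - (pi / 4) <= a1 -> a1 <= a2 -> a2 <= 7 * (pi / 4) ->
  (forall r t, rho1 <= r <= rho2 -> a1 <= t <= a2 -> 0 <= c.2 + r * sin t /\
     R0 ^+ 2 <= (c.1 + r * cos t) ^+ 2 + (c.2 + r * sin t) ^+ 2) ->
  J (fun r => J (fun t => r * e (c.1 + r * cos t, c.2 + r * sin t)) a1 a2) rho1 rho2 <= eps.
Proof.
move=> eps0; have [En HEn] := pf_en F.
have ce := plane_energy_cts; have e0 := plane_energy_ge0.
have cea := cts_abs2 ce.
have r10 : 0 < r1 by apply: lt_le_trans (expR_gt0 1) (pf_r1 F).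
pose f1 (z : R * R) := clamp (z.1 ^+ 2 + z.2 ^+ 2 - r1 ^+ 2) * e (z.1, `|z.2|).
have cf1 : continuous f1 by apply: ctsM; [apply: cts_clamp; cts|exact: cea].
have f1b x y : 0 <= f1 (x, y) <= e (x, `|y|).
  rewrite /f1 mulr_ge0 ?clamp_ge0//=.
  by rewrite ler_piMl// clamp_le1.
pose I (f : R * R -> R) B := J (fun x => J (fun y => f (x, y)) (- B) B) (- B) B.
have I1 B : 0 <= B -> I f1 B <= En.
  by move=> B0; apply: HEn => // x y xy; rewrite /f1/= clamp0 ?mul0r//; lra.
pose S := [set I f1 B | B in [set B | 0 <= B]].
have supS : has_sup S.
  split; first by exists (I f1 0), 0 => //=.
  by exists En => _ [B B0 <-]; exact: I1.
have [_ [B0 /= B00 <-] HB0] := sup_adherent eps0 supS.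
pose R0 := r1 + 2 * B0 + 1.
exists R0; split; first by rewrite /R0; lra.
move=> c rho1 rho2 a1 a2 rho10 rho12 a1p a12 a2p reg.
pose f2 (z : R * R) := f1 z * clamp (z.1 ^+ 2 + z.2 ^+ 2 - 2 * B0 ^+ 2).
pose f (z : R * R) := f2 z * clamp (rho2 ^+ 2 + 1 - ((z.1 - c.1) ^+ 2 + (z.2 - c.2) ^+ 2)).
have cf2 : continuous f2 by apply: ctsM; [exact: cf1|apply: cts_clamp; cts].
have cf : continuous f by apply: ctsM; [exact: cf2|apply: cts_clamp; cts].
have f10 z : 0 <= f1 z by case: z => x y; have /andP[] := f1b x y.
have f20 z : 0 <= f2 z by rewrite mulr_ge0// clamp_ge0.
have f0 z : 0 <= f z by rewrite mulr_ge0// clamp_ge0.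
pose A := rho2 + 1.
pose B := Num.max B0 (Num.max (`|c.1| + A) (`|c.2| + A)).
have BB0 : B0 <= B by rewrite le_max lexx.
have Bc1 : `|c.1| + A <= B by rewrite !le_max lexx orbT.
have Bc2 : `|c.2| + A <= B by rewrite !le_max lexx !orbT.
have A0 : 0 < A by rewrite /A; slra cvy.
apply: (@le_trans _ _ (I f B)).
  apply: (polar_sub (A := A)) => //.
  - move=> z hz; rewrite /f [X in _ * X]clamp0 ?mulr0//.
    by move: hz; rewrite /A; nra.
  - by rewrite /A; slra cvy.
  - move=> r t rr tt; have [y0 q0] := reg r t rr tt.
    rewrite /f /f2 /f1 /= sqr_norm_sum (ger0_norm y0).
    have h1 : 1 <= (c.1 + r * cos t) ^+ 2 + (c.2 + r * sin t) ^+ 2 - r1 ^+ 2.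
      by move: q0; rewrite /R0; nra.
    have h2 : 1 <= (c.1 + r * cos t) ^+ 2 + (c.2 + r * sin t) ^+ 2 - 2 * B0 ^+ 2.
      by move: q0; rewrite /R0; nra.
    have h3 : 1 <= rho2 ^+ 2 + 1 - r ^+ 2 by nra.
    by rewrite !clamp1// !mulr1 mul1r.
have cdiff : continuous (fun z => f1 z - f2 z) by cts.
have cI (h : R * R -> R) (B' : R) : continuous h -> continuous (fun x : R => J (fun y => h (x, y)) (- B') B').
  by move=> ch; exact: J_param_cts.
have BB : - B <= B by slra cvy.
have BB0' : - B0 <= B0 by slra cvy.
have cx (h : R * R -> R) (x : R) : continuous h -> continuous (fun y => h (x, y)) by move=> ch; cts.
have f12 z : 0 <= f1 z - f2 z.
  by rewrite subr_ge0 /f2 ler_piMr// clamp_le1.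
have le2 : I f B <= I f2 B.
  rewrite /I; apply: J_le => //; [exact: cI|exact: cI|move=> x _].
  apply: J_le => //; [exact: cx|exact: cx|move=> y _].
  by rewrite /f ler_piMr// clamp_le1.
have IB : I (fun z => f1 z - f2 z) B = I f1 B - I f2 B.
  rewrite /I -JB; [|exact: cI|exact: cI]; congr J; apply/funext => x.
  by rewrite JB//; exact: cx.
have IB0 : I f1 B0 = I (fun z => f1 z - f2 z) B0.
  rewrite /I; apply: J_ext => //; [exact: cI|exact: (cI (fun z => f1 z - f2 z))|move=> x xB].
  apply: J_ext => //; [exact: cx|exact: (cx (fun z => f1 z - f2 z))|move=> y yB].
  by rewrite /f2 /= clamp0 ?mulr0 ?subr0//; nra.
have mono : I (fun z => f1 z - f2 z) B0 <= I (fun z => f1 z - f2 z) B.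
  rewrite /I; apply: (@le_trans _ _ (J (fun x => J (fun y => f1 (x, y) - f2 (x, y)) (- B) B) (- B0) B0)).
    apply: J_le => //; [exact: (cI (fun z => f1 z - f2 z))|exact: (cI (fun z => f1 z - f2 z))|move=> x _].
    by apply: J_sub_itv => //; [exact: (cx (fun z => f1 z - f2 z))|slra cvy].
  apply: J_sub_itv => //; [exact: (cI (fun z => f1 z - f2 z))|slra cvy|move=> x _].
  by apply: J_ge0 => //; exact: (cx (fun z => f1 z - f2 z)).
have : I f1 B <= sup S by apply: ub_le_sup; [case: supS|exists B => //=; slra cvy].
by slra cvy.
Qed.

End PlaneEnergy.

Section PolarC1.
Context {R : realType}.

Lemma C1_polar (c : R * R) (f fx fy : R * R -> R) : C1 f fx fy ->
  C1 (fun z => f (c.1 + z.1 * cos z.2, c.2 + z.1 * sin z.2))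
     (fun z => fx (c.1 + z.1 * cos z.2, c.2 + z.1 * sin z.2) * cos z.2 +
               fy (c.1 + z.1 * cos z.2, c.2 + z.1 * sin z.2) * sin z.2)
     (fun z => z.1 * (- fx (c.1 + z.1 * cos z.2, c.2 + z.1 * sin z.2) * sin z.2 +
               fy (c.1 + z.1 * cos z.2, c.2 + z.1 * sin z.2) * cos z.2)).
Proof.
move=> Cf; have [cx cy _ _] := Cf.
split; [by cts|by cts| |] => r t /=.
- have da : der r (fun r => c.1 + r * cos t) (cos t) by der_by fail; ring.
  have db : der r (fun r => c.2 + r * sin t) (sin t) by der_by fail; ring.
  exact: (C1_chain Cf da db).
- have da : der t (fun t => c.1 + r * cos t) (- (r * sin t)) by der_by fail; ring.
  have db : der t (fun t => c.2 + r * sin t) (r * cos t) by der_by fail; ring.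
  by refine (der_eq (C1_chain Cf da db) _); ring.
Qed.

Lemma C1_logpolar (f fx fy : R * R -> R) : C1 f fx fy ->
  C1 (fun z => f (expR z.1 * cos z.2, expR z.1 * sin z.2))
     (fun z => expR z.1 * (fx (expR z.1 * cos z.2, expR z.1 * sin z.2) * cos z.2 +
               fy (expR z.1 * cos z.2, expR z.1 * sin z.2) * sin z.2))
     (fun z => expR z.1 * (- fx (expR z.1 * cos z.2, expR z.1 * sin z.2) * sin z.2 +
               fy (expR z.1 * cos z.2, expR z.1 * sin z.2) * cos z.2)).
Proof.
move=> Cf; have [cx cy _ _] := Cf.
split; [by cts|by cts| |] => s t /=.
- have da : der s (fun s => expR s * cos t) (expR s * cos t) by der_by fail; ring.
  have db : der s (fun s => expR s * sin t) (expR s * sin t) by der_by fail; ring.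
  by refine (der_eq (C1_chain Cf da db) _); ring.
- have da : der t (fun t => expR s * cos t) (- (expR s * sin t)) by der_by fail; ring.
  have db : der t (fun t => expR s * sin t) (expR s * cos t) by der_by fail; ring.
  by refine (der_eq (C1_chain Cf da db) _); ring.
Qed.

Lemma cos_7pi4 : cos (7 * (pi / 4)) = cos (- (pi / 4)) :> R.
Proof.
have -> : 7 * (pi / 4) = - (pi / 4) + pi + pi :> R by field.
by rewrite !cosDpi opprK.
Qed.

Lemma sin_7pi4 : sin (7 * (pi / 4)) = sin (- (pi / 4)) :> R.
Proof.
have -> : 7 * (pi / 4) = - (pi / 4) + pi + pi :> R by field.
by rewrite !sinDpi opprK.
Qed.

End PolarC1.

(** * Means of the pressure over circles *)

Section PlanePressure.
Context {R : realType} (b r1 : R) (u ux uy v vx vy o ox oy p px py : R * R -> R).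
Context (F : plane_flow b r1 u ux uy v vx vy o ox oy p px py).
Let cux := C1_cx (pf_u F).
Let cuy := C1_cy (pf_u F).
Let cvx := C1_cx (pf_v F).
Let cvy := C1_cy (pf_v F).
Let cox := C1_cx (pf_o F).
Let coy := C1_cy (pf_o F).
Let cpx := C1_cx (pf_p F).
Let cpy := C1_cy (pf_p F).
Let cu := C1_cts (pf_u F).
Let cv := C1_cts (pf_v F).
Let co := C1_cts (pf_o F).
Let cp := C1_cts (pf_p F).
Local Notation e := (plane_energy ux uy vx vy).
Let ce : continuous e := plane_energy_cts F.
Let e0 : forall z, 0 <= e z := plane_energy_ge0 ux uy vx vy.
Let pi0 : 0 < pi :> R := @pi_gt0 R.
Let pi4 := @pi_lt4 R.
Local Notation cpt c r t := (c.1 + r * cos t, c.2 + r * sin t).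

Lemma circle_pressure (c : R * R) (r a1 a2 : R) : a1 <= a2 ->
  (forall t, a1 <= t <= a2 -> 0 <= c.2 + r * sin t /\
     r1 ^+ 2 <= (c.1 + r * cos t) ^+ 2 + (c.2 + r * sin t) ^+ 2) ->
  o (cpt c r a1) = o (cpt c r a2) -> v (cpt c r a1) = v (cpt c r a2) ->
  v (cpt c r a1) * (u (cpt c r a2) - u (cpt c r a1)) = 0 ->
  `|r * J (fun t => px (cpt c r t) * cos t + py (cpt c r t) * sin t) a1 a2
    + b * (u (cpt c r a2) - u (cpt c r a1))| <=
  (a2 - a1) * (r ^+ 2 * J (fun t => e (cpt c r t)) a1 a2).
Proof.
move=> a12 reg oE vE vu.
have Cu := C1_polar c (pf_u F); have Cv := C1_polar c (pf_v F); have Co := C1_polar c (pf_o F).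
pose ut t := r * (- ux (cpt c r t) * sin t + uy (cpt c r t) * cos t).
pose vt t := r * (- vx (cpt c r t) * sin t + vy (cpt c r t) * cos t).
pose ot t := r * (- ox (cpt c r t) * sin t + oy (cpt c r t) * cos t).
have cut : continuous ut by rewrite /ut; cts.
have cvt : continuous vt by rewrite /vt; cts.
have cot : continuous ot by rewrite /ot; cts.
have dut t : der t (fun t => u (cpt c r t)) (ut t) by exact: (C1_dy Cu r t).
have dvt t : der t (fun t => v (cpt c r t)) (vt t) by exact: (C1_dy Cv r t).
have dot t : der t (fun t => o (cpt c r t)) (ot t) by exact: (C1_dy Co r t).
have -> : r * J (fun t => px (cpt c r t) * cos t + py (cpt c r t) * sin t) a1 a2
    + b * (u (cpt c r a2) - u (cpt c r a1)) =
    J (fun t => u (cpt c r t) * vt t - v (cpt c r t) * ut t) a1 a2.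
  rewrite -(J_ftc _ _ cut dut) -!JZ; try by cts.
  rewrite -JD; [|cts|cts].
  rewrite -[RHS]subr0 -[X in _ = _ - X](_ : J ot a1 a2 = 0); last first.
    by rewrite (J_ftc _ _ cot dot) oE subrr.
  rewrite -JB; [|cts|cts].
  apply: J_ext => //; [cts|cts|move=> t /reg[y0 far]].
  have vyE : vy (cpt c r t) = - ux (cpt c r t) by have := pf_div F y0 far; lra.
  by rewrite (pf_px F y0 far) (pf_py F y0 far) /ut /vt /ot vyE; ring.
apply: le_trans (wirtinger a12 cut cvt dut dvt vE vu) _.
apply: ler_wpM2l; first by rewrite subr_ge0.
rewrite -JZ; last by cts.
apply: J_le => //; [cts|cts|move=> t _].
have cs := cos2Dsin2 t.
rewrite /ut /vt !exprMn -mulrDr; apply: ler_wpM2l; first exact: sqr_ge0.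
rewrite /plane_energy.
set a := ux _; set a' := uy _; set d := vx _; set d' := vy _; set C := cos t in cs *; set S := sin t in cs *.
have -> : a ^+ 2 + a' ^+ 2 + d ^+ 2 + d' ^+ 2 = (a ^+ 2 + a' ^+ 2 + d ^+ 2 + d' ^+ 2) * (C ^+ 2 + S ^+ 2).
  by rewrite cs mulr1.
have := sqr_ge0 (a * C + a' * S); have := sqr_ge0 (d * C + d' * S); lra.
Qed.

Lemma mean_der (c : R * R) (a1 a2 r : R) :
  der r (fun r => J (fun t => p (cpt c r t)) a1 a2)
    (J (fun t => px (cpt c r t) * cos t + py (cpt c r t) * sin t) a1 a2).
Proof.
have Cp := C1_polar c (pf_p F).
apply: (@J_der_param _ (fun z => p (cpt c z.1 z.2)) (fun z => px (cpt c z.1 z.2) * cos z.2 + py (cpt c z.1 z.2) * sin z.2)).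
- by cts.
- by cts.
- by move=> t y; exact: (C1_dx Cp).
Qed.

Lemma mean_der_cts (c : R * R) (a1 a2 : R) :
  continuous (fun r : R => J (fun t => px (cpt c r t) * cos t + py (cpt c r t) * sin t) a1 a2).
Proof.
by apply: (@J_param_cts _ _ (fun z : R * R => px (cpt c z.1 z.2) * cos z.2 + py (cpt c z.1 z.2) * sin z.2)); cts.
Qed.

Lemma energy_circle_cts (c : R * R) (a1 a2 : R) :
  continuous (fun r : R => J (fun t => r * e (cpt c r t)) a1 a2).
Proof.
by apply: (@J_param_cts _ _ (fun z : R * R => z.1 * e (cpt c z.1 z.2))); cts.
Qed.

Lemma in_ball_far (c : R * R) (r t a : R) : 0 <= a -> a <= r -> r ^+ 2 <= c.1 ^+ 2 + c.2 ^+ 2 ->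
  (r - a) ^+ 2 <= (c.1 + a * cos t) ^+ 2 + (c.2 + a * sin t) ^+ 2.
Proof.
move=> a0 ar rc; have cs := cos2Dsin2 t.
set C := cos t in cs *; set S := sin t in cs *.
pose q := Num.sqrt (c.1 ^+ 2 + c.2 ^+ 2).
have q2 : q ^+ 2 = c.1 ^+ 2 + c.2 ^+ 2 by rewrite sqr_sqrtr// addr_ge0 ?sqr_ge0.
have q0 : 0 <= q by exact: sqrtr_ge0.
have rq : r <= q by rewrite -(@ler_sqr _ r q) ?nnegrE ?q2//; lra.
have cauchy : - q <= c.1 * C + c.2 * S.
  have h : (c.1 * C + c.2 * S) ^+ 2 <= q ^+ 2.
    rewrite q2 -[leRHS]mulr1 -cs; have := sqr_ge0 (c.1 * S - c.2 * C); lra.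
  have : `|c.1 * C + c.2 * S| <= q.
    by rewrite -(@ler_sqr _ _ q) ?nnegrE// real_normK ?num_real.
  by rewrite ler_norml => /andP[].
have -> : (c.1 + a * C) ^+ 2 + (c.2 + a * S) ^+ 2 =
   q ^+ 2 + 2 * a * (c.1 * C + c.2 * S) + a ^+ 2 * (C ^+ 2 + S ^+ 2) by rewrite q2; ring.
by rewrite cs mulr1; nra.
Qed.

Lemma in_ball_near (c : R * R) (r t a : R) : 0 <= a -> 0 <= r -> c.1 ^+ 2 + c.2 ^+ 2 <= r ^+ 2 ->
  (c.1 + a * cos t) ^+ 2 + (c.2 + a * sin t) ^+ 2 <= (r + a) ^+ 2.
Proof.
move=> a0 r0 rc; have cs := cos2Dsin2 t.
set C := cos t in cs *; set S := sin t in cs *.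
have cauchy : c.1 * C + c.2 * S <= r.
  have h : (c.1 * C + c.2 * S) ^+ 2 <= r ^+ 2.
    apply: le_trans rc; rewrite -[leRHS]mulr1 -cs; have := sqr_ge0 (c.1 * S - c.2 * C); lra.
  have : `|c.1 * C + c.2 * S| <= r.
    by rewrite -(@ler_sqr _ _ r) ?nnegrE// real_normK ?num_real.
  by rewrite ler_norml => /andP[].
have -> : (c.1 + a * C) ^+ 2 + (c.2 + a * S) ^+ 2 =
   c.1 ^+ 2 + c.2 ^+ 2 + 2 * a * (c.1 * C + c.2 * S) + a ^+ 2 * (C ^+ 2 + S ^+ 2) by ring.
by rewrite cs mulr1; nra.
Qed.

(** Over full circles the term with [b] closes up as well. Integrating the derivative of the mean
    from the centre costs $2\pi$ times the energy of the disc. *)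
Lemma disc_pressure (eps : R) : 0 < eps -> exists R0, r1 <= R0 /\
  forall (c : R * R) (a rho : R), 0 <= rho <= a -> a <= c.2 ->
  (R0 + a) ^+ 2 <= c.1 ^+ 2 + c.2 ^+ 2 ->
  `|J (fun t => p (cpt c rho t)) (- (pi / 4)) (7 * (pi / 4)) - 2 * pi * p c| <= eps.
Proof.
move=> eps0.
have pi1 := pi0.
have pi2 : 0 < 2 * pi :> R by lra.
have eps1 : 0 < eps / (2 * pi) by rewrite divr_gt0.
have [R0 [r1R0 HR0]] := plane_energy_tail F eps1; exists R0; split => // c a rho /andP[rho0 rhoa] ac Rc.
have r10 : 0 < r1 by apply: lt_le_trans (expR_gt0 1) (pf_r1 F).
have reg r t : 0 <= r <= rho -> 0 <= c.2 + r * sin t /\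
    R0 ^+ 2 <= (c.1 + r * cos t) ^+ 2 + (c.2 + r * sin t) ^+ 2.
  move=> /andP[h0 h1]; split.
    have := sin_geN1 t => hs.
    have : r * -1 <= r * sin t by apply: ler_wpM2l.
    by lra.
  apply: le_trans (@in_ball_far c (R0 + a) t r h0 _ Rc); last by lra.
  by rewrite ler_sqr ?nnegrE; lra.
have a12 : - (pi / 4) <= 7 * (pi / 4) :> R by lra.
have -> : 2 * pi * p c = J (fun t => p (cpt c 0 t)) (- (pi / 4)) (7 * (pi / 4)).
  rewrite (_ : (fun t => _) = fun=> p c); first by rewrite J_cst; field.
  by apply/funext => t; rewrite !mul0r !addr0; case: (c).
rewrite -(J_ftc _ _ (@mean_der_cts c _ _) (mean_der c _ _)).
apply: (@le_trans _ _ (J (fun r => (2 * pi) * J (fun t => r * e (cpt c r t)) (- (pi / 4)) (7 * (pi / 4))) 0 rho)).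
  have cE := @energy_circle_cts c (- (pi / 4)) (7 * (pi / 4)).
  have cM := @mean_der_cts c (- (pi / 4)) (7 * (pi / 4)).
  apply: le_trans (J_abs rho0 cM) _.
  apply: J_le_open => //; [cts|cts|move=> r r0 rrho].
  have h := @circle_pressure c r _ _ a12.
  have {h} := h _ _ _ _; rewrite cos_7pi4 sin_7pi4 !subrr !mulr0 addr0 => h.
  have {}h : `|r * J (fun t => px (cpt c r t) * cos t + py (cpt c r t) * sin t) (- (pi / 4)) (7 * (pi / 4))|
      <= (7 * (pi / 4) - - (pi / 4)) * (r ^+ 2 * J (fun t => e (cpt c r t)) (- (pi / 4)) (7 * (pi / 4))).
    apply: h => // t _; have [y0 q] := reg r t ltac:(lra).
    by split => //; apply: le_trans q; rewrite ler_sqr ?nnegrE; lra.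
  rewrite -(ler_pM2l r0) -[X in X * _ <= _](gtr0_norm r0) -normrM.
  apply: le_trans h _; rewrite JZ; last by cts.
  by rewrite le_eqVlt; apply/orP; left; apply/eqP; field.
rewrite JZ; last exact: energy_circle_cts.
rewrite mulrC -ler_pdivlMr//; apply: HR0 => //.
by move=> r t rr _; exact: reg.
Qed.

End PlanePressure.

(** * From rings about a point to logarithmic blocks *)

Section BallBlock.
Context {R : realType}.
Let pi0 : 0 < pi :> R := @pi_gt0 R.
Local Notation cpt c r t := (c.1 + r * cos t, c.2 + r * sin t).

Definition lp (z : R * R) : R * R := (expR z.1 * cos z.2, expR z.1 * sin z.2).

Lemma expR1_ge2 : 2 <= expR 1 :> R.
Proof. by have := @expR_ge1Dx R 1; lra. Qed.

(** Since $e \ge 2$, points within $e^s/2$ of [c] have modulus between $e^{s-1}$ and $e^{s+1}$. A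
    radial cutoff, 1 there and 0 outside $[e^{s-2}, e^{s+2}]$, lets polar coordinates about [c] and
    about 0 meet in one integral over a square. The factor 2 comes from the even reflection in $y$,
    the exponential bounds the Jacobian. *)
Lemma ball_block (g : R * R -> R) (s : R) (c : R * R) (rho1 rho2 a1 a2 : R) :
  continuous g -> (forall z, 0 <= g z) ->
  c.1 ^+ 2 + c.2 ^+ 2 = expR s ^+ 2 -> 0 <= rho1 -> rho1 <= rho2 -> 2 * rho2 <= expR s ->
  - (pi / 4) <= a1 -> a1 <= a2 -> a2 <= 7 * (pi / 4) ->
  (forall r t, rho1 <= r <= rho2 -> a1 <= t <= a2 -> 0 <= c.2 + r * sin t) ->
  J (fun r => J (fun t => r * g (cpt c r t)) a1 a2) rho1 rho2 <=
  2 * expR (s + 2) ^+ 2 * J (fun x => J (fun t => g (lp (x, t))) 0 pi) (s - 2) (s + 2).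
Proof.
move=> cg g0 cE rho10 rho12 rho2s a1p a12 a2p reg.
have es0 := expR_gt0 s; have e2 := expR1_ge2.
have [E1 E2] : expR (s - 1) * expR 1 = expR s /\ expR (s - 2) * expR 1 = expR (s - 1).
  by rewrite -!expRD; split; congr expR; ring.
have [E3 E4] : expR s * expR 1 = expR (s + 1) /\ expR (s + 1) * expR 1 = expR (s + 2).
  by rewrite -!expRD; split; congr expR; ring.
have p1 := expR_gt0 (s - 1); have p2 := expR_gt0 (s - 2).
have p3 := expR_gt0 (s + 1); have p4 := expR_gt0 (s + 2).
set A1 := expR (s - 2) in E2 p2 *; set A2 := expR (s - 1) in E1 E2 p1 *.
set A3 := expR (s + 1) in E3 E4 p3 *; set A := expR (s + 2) in E4 p4 *.
set r := expR s in E1 E3 es0 cE rho2s *.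
have A12 : A1 < A2 by nra.
have A34 : A3 < A by nra.
pose cut (q : R) := clamp ((q - A1 ^+ 2) / (A2 ^+ 2 - A1 ^+ 2)) * clamp ((A ^+ 2 - q) / (A ^+ 2 - A3 ^+ 2)).
have ccut : continuous cut.
  by apply: ctsM; apply: cts_clamp; cts.
have cut0 q : 0 <= cut q by rewrite mulr_ge0 ?clamp_ge0.
have cut1 q : cut q <= 1 by rewrite mulr_ile1 ?clamp_ge0 ?clamp_le1.
have d1 : 0 < A2 ^+ 2 - A1 ^+ 2 by nra.
have d2 : 0 < A ^+ 2 - A3 ^+ 2 by nra.
have cutin q : q <= A1 ^+ 2 -> cut q = 0.
  by move=> h; rewrite /cut clamp0 ?mul0r// pmulr_lle0 ?invr_gt0//; slra pi0.
have cutout q : A ^+ 2 <= q -> cut q = 0.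
  by move=> h; rewrite /cut [X in _ * X]clamp0 ?mulr0// pmulr_lle0 ?invr_gt0//; slra pi0.
have cutmid q : A2 ^+ 2 <= q -> q <= A3 ^+ 2 -> cut q = 1.
  by move=> h1 h2; rewrite /cut !clamp1 ?mulr1// ler_pdivlMr//; slra pi0.
pose f (z : R * R) := g (z.1, `|z.2|) * cut (z.1 ^+ 2 + z.2 ^+ 2).
have cga := cts_abs2 cg.
have cf : continuous f.
  apply: ctsM; [exact: cga|by cts].
have f0 z : 0 <= f z by rewrite mulr_ge0.
pose B := `|c.1| + `|c.2| + A + A.
have [n1 n2] : 0 <= `|c.1| /\ 0 <= `|c.2| by split.
have rA : r <= A by nra.
apply: (@le_trans _ _ (J (fun x => J (fun y => f (x, y)) (- B) B) (- B) B)).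
  apply: (@polar_sub _ f g c (A + A)) => //.
  - by slra pi0.
  - move=> z hz; rewrite /f cutout ?mulr0//.
    have h := sqr_ge0 (z.1 + c.1); have h' := sqr_ge0 (z.2 + c.2).
    by nra.
  - by rewrite /B; slra pi0.
  - by rewrite /B; slra pi0.
  - by slra pi0.
  - move=> q t qq tt; rewrite /f /= (ger0_norm (reg q t qq tt)).
    rewrite cutmid ?mulr1//.
      apply: le_trans (@in_ball_far _ c r t q _ _ _); [|slra pi0|slra pi0|by rewrite cE].
      rewrite ler_sqr ?nnegrE; [|slra pi0|slra pi0].
      by nra.
    apply: le_trans (@in_ball_near _ c r t q _ _ _) _; [slra pi0|slra pi0|by rewrite cE|].
    by rewrite ler_sqr ?nnegrE; nra.
rewrite (@polar_box _ f (0, 0) A B p4 cf); last 3 first.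
- by move=> z; rewrite !subr0 => hz; rewrite /f cutout ?mulr0.
- by rewrite normr0 /B; slra pi0.
- by rewrite normr0 /B; slra pi0.
pose K t := J (fun q => f (q * cos t, q * sin t) * q) 0 A.
have cK : continuous K.
  by apply: (@J_param_cts _ _ (fun z : R * R => f (z.2 * cos z.1, z.2 * sin z.1) * z.2)); cts.
rewrite (_ : (fun t => J _ _ _) = K); last first.
  by apply/funext => t; congr J; apply/funext => q /=; rewrite !add0r.
have Keven t : K (- t) = K t.
  rewrite /K; congr J; apply/funext => q; congr (_ * _).
  by rewrite /f /= cosN sinN !mulrN sqrrN normrN.
have Kper t : K (pi - t + pi) = K t.
  rewrite -[RHS]Keven (_ : pi - t + pi = - t + pi + pi); last by ring.
  by rewrite /K; congr J; apply/funext => q; rewrite !cosDpi !sinDpi !opprK.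
have JK : J K (- (pi / 4)) (7 * (pi / 4)) = 2 * J K 0 pi.
  rewrite (J_cat K _ 0) (J_cat K 0 pi).
  have -> : J K (- (pi / 4)) 0 = J K 0 (pi / 4).
    have := @J_opp _ K 0 (pi / 4) cK; rewrite oppr0 => <-.
    by congr J; apply/funext => t; exact: Keven.
  have -> : J K pi (7 * (pi / 4)) = J K (pi / 4) pi.
    have cK1 : continuous (fun t : R => K (t + pi)) by cts.
    have cK2 : continuous (fun t : R => K (t + pi + pi)) by cts.
    have h := @J_opp _ (fun t => K (t + pi + pi)) (pi / 4) pi cK2.
    have -> : J K (pi / 4) pi = J (fun t => K (- t + pi + pi)) (pi / 4) pi.
      by congr J; apply/funext => t; rewrite -[LHS]Kper; congr K; ring.
    rewrite h (J_shift _ _ _ cK1) (J_shift _ _ _ cK); congr J; field => //.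
  rewrite (J_cat K 0 (pi / 4) pi); ring.
have pip := pi0.
rewrite JK -mulrA; apply: ler_wpM2l => //.
have cPc : continuous (fun z : R * R => g (lp z)) by rewrite /lp /=; cts.
rewrite (@J_fubini _ (fun z => g (lp z)))// -JZ; last first.
  by apply: (@J_param_cts _ _ (fun z : R * R => g (lp (z.2, z.1)))); rewrite /lp /=; cts.
apply: J_le => //; [exact: ltW| |move=> t tt].
  apply: ctsM; first by cts.
  by apply: (@J_param_cts _ _ (fun z : R * R => g (lp (z.2, z.1)))); rewrite /lp /=; cts.
have cft : continuous (fun q : R => f (q * cos t, q * sin t) * q) by cts.
have nrm q : (q * cos t) ^+ 2 + (q * sin t) ^+ 2 = q ^+ 2 by rewrite !exprMn -mulrDr cos2Dsin2 mulr1.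
have -> : K t = J (fun q => f (q * cos t, q * sin t) * q) A1 A.
  have A1A : A1 <= A by nra.
  apply: (J_support cft); [slra pi0|slra pi0|slra pi0|].
  move=> q qA [q1|q2].
    by rewrite /f /= nrm cutin ?mulr0 ?mul0r//; nra.
  by rewrite /f /= nrm cutout ?mulr0 ?mul0r//; nra.
rewrite -(J_subst _ _ cft (@continuous_expR R) (fun x => is_derive_expR x)).
rewrite -JZ; last by rewrite /lp /=; cts.
apply: J_le => //.
- slra pi0.
- by cts.
- by rewrite /lp /=; cts.
move=> x /andP[x1 x2].
have ex0 := expR_gt0 x.
have exA : expR x <= A by rewrite ler_expR.
have st0 : 0 <= sin t by exact: sin_ge0_pi.
rewrite /f /lp /= (ger0_norm (mulr_ge0 (ltW ex0) st0)).
set P := g _; have P0 : 0 <= P by exact: g0.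
set k := cut _; have k0 : 0 <= k by exact: cut0.
have k1 : k <= 1 by exact: cut1.
have -> : P * k * expR x * expR x = (expR x ^+ 2) * (k * P) by ring.
apply: ler_pM; [exact: sqr_ge0|exact: mulr_ge0| |].
  by rewrite ler_sqr ?nnegrE; slra pi0.
by rewrite ler_piMl.
Qed.

End BallBlock.

(** * Passage to logarithmic polar coordinates *)

Section StripOfPlane.
Context {R : realType} (b r1 : R) (u ux uy v vx vy o ox oy p px py : R * R -> R).
Context (F : plane_flow b r1 u ux uy v vx vy o ox oy p px py).
Let cux := C1_cx (pf_u F).
Let cuy := C1_cy (pf_u F).
Let cvx := C1_cx (pf_v F).
Let cvy := C1_cy (pf_v F).
Let cox := C1_cx (pf_o F).
Let coy := C1_cy (pf_o F).
Let cpx := C1_cx (pf_p F).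
Let cpy := C1_cy (pf_p F).
Let cu := C1_cts (pf_u F).
Let cv := C1_cts (pf_v F).
Let co := C1_cts (pf_o F).
Let cp := C1_cts (pf_p F).
Local Notation e := (plane_energy ux uy vx vy).
Let ce : continuous e := plane_energy_cts F.
Let e0 : forall z, 0 <= e z := plane_energy_ge0 ux uy vx vy.
Let pi0 : 0 < pi :> R := @pi_gt0 R.
Let pi4 := @pi_lt4 R.
Local Notation cpt c r t := (c.1 + r * cos t, c.2 + r * sin t).

Definition lpS (fx fy : R * R -> R) (z : R * R) : R :=
  expR z.1 * (fx (lp z) * cos z.2 + fy (lp z) * sin z.2).
Definition lpT (fx fy : R * R -> R) (z : R * R) : R :=
  expR z.1 * (- fx (lp z) * sin z.2 + fy (lp z) * cos z.2).

Lemma r1_gt0 : 0 < r1.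
Proof. exact: lt_le_trans (expR_gt0 1) (pf_r1 F). Qed.

Lemma lp_norm2 s t : (expR s * cos t) ^+ 2 + (expR s * sin t) ^+ 2 = expR s ^+ 2 :> R.
Proof. by rewrite !exprMn -mulrDr cos2Dsin2 mulr1. Qed.

Lemma lp_far s t : ln r1 <= s -> 0 <= t <= pi ->
  0 <= expR s * sin t /\ r1 ^+ 2 <= (expR s * cos t) ^+ 2 + (expR s * sin t) ^+ 2.
Proof.
move=> s1 tt; split; first by rewrite mulr_ge0 ?expR_ge0 ?sin_ge0_pi// in_itv.
rewrite lp_norm2 ler_sqr; [|by rewrite nnegrE (ltW r1_gt0)|by rewrite nnegrE expR_ge0].
by rewrite -[leLHS](@lnK _ r1) ?ler_expR ?posrE ?r1_gt0.
Qed.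

(** The coordinates are conformal: each identity is the Cartesian one rotated by the angle and
    scaled by $e^s$, once [vy] is eliminated by incompressibility. The energy tail is carried over
    by the substitution $r = e^s$. *)
Lemma strip_of_plane :
  strip_flow b (ln r1) (fun z => u (lp z)) (lpS ux uy) (lpT ux uy)
    (fun z => v (lp z)) (lpS vx vy) (lpT vx vy)
    (fun z => o (lp z)) (lpS ox oy) (lpT ox oy)
    (fun z => p (lp z)) (lpS px py) (lpT px py)
    (fun z => expR z.1 * (u (lp z) * cos z.2 + (v (lp z) + b) * sin z.2))
    (fun z => expR z.1 * (u (lp z) * cos z.2 + (v (lp z) + b) * sin z.2) +
       expR z.1 * (lpS ux uy z * cos z.2 + lpS vx vy z * sin z.2))
    (fun z => expR z.1 * (lpT ux uy z * cos z.2 - u (lp z) * sin z.2 + lpT vx vy z * sin z.2 + (v (lp z) + b) * cos z.2))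
    (fun z => expR z.1 * (- u (lp z) * sin z.2 + (v (lp z) + b) * cos z.2))
    (fun z => expR z.1 * (- u (lp z) * sin z.2 + (v (lp z) + b) * cos z.2) +
       expR z.1 * (- lpS ux uy z * sin z.2 + lpS vx vy z * cos z.2))
    (fun z => expR z.1 * (- lpT ux uy z * sin z.2 - u (lp z) * cos z.2 + lpT vx vy z * cos z.2 - (v (lp z) + b) * sin z.2)).
Proof.
have Cu : C1 (fun z => u (lp z)) (lpS ux uy) (lpT ux uy) := C1_logpolar (pf_u F).
have Cv : C1 (fun z => v (lp z)) (lpS vx vy) (lpT vx vy) := C1_logpolar (pf_v F).
have Co : C1 (fun z => o (lp z)) (lpS ox oy) (lpT ox oy) := C1_logpolar (pf_o F).
have Cp : C1 (fun z => p (lp z)) (lpS px py) (lpT px py) := C1_logpolar (pf_p F).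
have cU := C1_cts Cu; have cV := C1_cts Cv.
have z0pi : 0 <= (0 : R) <= pi by rewrite lexx /= pi_ge0.
have zpipi : 0 <= (pi : R) <= pi by rewrite lexx andbT pi_ge0.
have cUS := C1_cx Cu; have cUT := C1_cy Cu; have cVS := C1_cx Cv; have cVT := C1_cy Cv.
split => //.
- split; [by cts|by cts| |] => s t.
    by der_by ltac:(first [exact: (C1_dx Cu)|exact: (C1_dx Cv)]) => /=; ring.
  by der_by ltac:(first [exact: (C1_dy Cu)|exact: (C1_dy Cv)]) => /=; ring.
- split; [by cts|by cts| |] => s t.
    by der_by ltac:(first [exact: (C1_dx Cu)|exact: (C1_dx Cv)]) => /=; ring.
  by der_by ltac:(first [exact: (C1_dy Cu)|exact: (C1_dy Cv)]) => /=; ring.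
- by rewrite -[leLHS]expRK ler_ln ?posrE ?expR_gt0 ?r1_gt0//; exact: (pf_r1 F).
- move=> s t s1 tt; have [y0 q] := lp_far s1 tt.
  have vyE : vy (lp (s, t)) = - ux (lp (s, t)) by have := pf_div F y0 q; rewrite /lp/=; lra.
  by rewrite /lpS /lpT /= (pf_px F y0 q) (pf_py F y0 q) vyE /lp /=; ring.
- move=> s t s1 tt; have [y0 q] := lp_far s1 tt.
  have vyE : vy (lp (s, t)) = - ux (lp (s, t)) by have := pf_div F y0 q; rewrite /lp/=; lra.
  by rewrite /lpS /lpT /= (pf_px F y0 q) (pf_py F y0 q) vyE /lp /=; ring.
- move=> s t s1 tt; have [y0 q] := lp_far s1 tt.
  have vyE : vy (lp (s, t)) = - ux (lp (s, t)) by have := pf_div F y0 q; rewrite /lp/=; lra.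
  by rewrite /lpS /lpT /= (pf_px F y0 q) (pf_py F y0 q) (pf_oE F y0 q) vyE /lp /=; ring.
- move=> s t s1 tt; have [y0 q] := lp_far s1 tt.
  have vyE : vy (lp (s, t)) = - ux (lp (s, t)) by have := pf_div F y0 q; rewrite /lp/=; lra.
  by rewrite /lpS /lpT /= (pf_px F y0 q) (pf_py F y0 q) (pf_oE F y0 q) vyE /lp /=; ring.
- move=> s t s1 tt; have [y0 q] := lp_far s1 tt.
  have vyE : vy (lp (s, t)) = - ux (lp (s, t)) by have := pf_div F y0 q; rewrite /lp/=; lra.
  by rewrite /lpS /lpT /= vyE; ring.
- move=> s t /=; rewrite exprMn; apply: ler_wpM2l; first exact: sqr_ge0.
  have cs := cos2Dsin2 t; rewrite -[leRHS]mulr1 -cs.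
  by have := sqr_ge0 (u (lp (s, t)) * sin t - (v (lp (s, t)) + b) * cos t); lra.
- move=> s t s1 tt; have [y0 q] := lp_far s1 tt.
  rewrite /lpS /lpT /= (pf_oE F y0 q) -/(lp (s, t)).
  set a := ux _; set a' := uy _; set d := vx _; set d' := vy _.
  have cs := cos2Dsin2 t; set C := cos t in cs *; set S := sin t in cs *.
  have -> : 2 * ((expR s * (a * C + a' * S)) ^+ 2 + (expR s * (- a * S + a' * C)) ^+ 2 +
     (expR s * (d * C + d' * S)) ^+ 2 + (expR s * (- d * S + d' * C)) ^+ 2) =
     (2 * ((a ^+ 2 + a' ^+ 2 + d ^+ 2 + d' ^+ 2) * (C ^+ 2 + S ^+ 2))) * expR s ^+ 2 by ring.
  apply: ler_wpM2r; first exact: sqr_ge0.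
  rewrite cs mulr1; have := sqr_ge0 (d + a'); have := sqr_ge0 a; have := sqr_ge0 d'; lra.
- move=> s s1; rewrite /lp /= sin0 cos0 mulr0 mulr1; apply: (pf_v0 F).
  by have [_] := lp_far s1 z0pi; rewrite sin0 cos0 mulr0 mulr1 expr0n addr0.
- move=> s s1; rewrite /lp /= sinpi cospi mulr0 mulrN1; apply: (pf_v0 F).
  by have [_] := lp_far s1 zpipi; rewrite sinpi cospi mulr0 mulrN1 expr0n addr0.
- move=> s s1; rewrite /lp /= sin0 cos0 mulr0 mulr1; apply: (pf_o0 F).
  by have [_] := lp_far s1 z0pi; rewrite sin0 cos0 mulr0 mulr1 expr0n addr0.
- move=> s s1; rewrite /lp /= sinpi cospi mulr0 mulrN1; apply: (pf_o0 F).
  by have [_] := lp_far s1 zpipi; rewrite sinpi cospi mulr0 mulrN1 expr0n addr0.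
- move=> s s1; rewrite /lp /= sin0 cos0 sinpi cospi !mulr0 mulrN1 mulr1; apply: (pf_b F).
  by have [_] := lp_far s1 z0pi; rewrite sin0 cos0 mulr0 mulr1 expr0n addr0.
- move=> eps eps0; have [R0 [r1R0 HR0]] := plane_energy_tail F eps0.
  have R00 : 0 < R0 by apply: lt_le_trans r1_gt0 r1R0.
  exists (ln R0) => s s' Ss ss'.
  have h := HR0 (0, 0) (expR s) (expR s') 0 pi (expR_ge0 _) _ _ (ltW pi0) _ _.
  apply: le_trans (h _ _ _ _).
  + have cg := energy_circle_cts F (c := (0, 0)) (a1 := 0) (a2 := pi).
    rewrite -(J_subst _ _ cg (@continuous_expR R) (fun x => is_derive_expR x)).
    rewrite le_eqVlt; apply/orP; left; apply/eqP; congr J; apply/funext => x.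
    rewrite mulrC -JZ; last by cts.
    congr J; apply/funext => t; rewrite /lpS /lpT /plane_energy /= !add0r -/(lp (x, t)).
    have cs := cos2Dsin2 t; set C := cos t in cs *; set S := sin t in cs *.
    set a := ux _; set a' := uy _; set d := vx _; set d' := vy _.
    rewrite -[a ^+ 2 + a' ^+ 2 + d ^+ 2 + d' ^+ 2]mulr1 -cs; ring.
  + by rewrite ler_expR.
  + by have := pi0; lra.
  + by have := pi0; lra.
  + move=> r t /andP[hr _] tt /=; rewrite !add0r; split.
      by rewrite mulr_ge0 ?sin_ge0_pi ?in_itv//; apply: le_trans hr; exact: expR_ge0.
    rewrite !exprMn -mulrDr cos2Dsin2 mulr1.
    have : R0 <= expR s by rewrite -[leLHS](@lnK _ R0) ?ler_expR ?posrE.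
    by move=> h1; rewrite ler_sqr ?nnegrE; lra.
Qed.

End StripOfPlane.

(** * Half circles centred on the axis *)

Section HalfDiscs.
Context {R : realType} (b r1 : R) (u ux uy v vx vy o ox oy p px py : R * R -> R).
Context (F : plane_flow b r1 u ux uy v vx vy o ox oy p px py).
Let cux := C1_cx (pf_u F).
Let cuy := C1_cy (pf_u F).
Let cvx := C1_cx (pf_v F).
Let cvy := C1_cy (pf_v F).
Let cpx := C1_cx (pf_p F).
Let cpy := C1_cy (pf_p F).
Let cp := C1_cts (pf_p F).
Local Notation e := (plane_energy ux uy vx vy).
Let ce : continuous e := plane_energy_cts F.
Let e0 : forall z, 0 <= e z := plane_energy_ge0 ux uy vx vy.
Let pi0 : 0 < pi :> R := @pi_gt0 R.
Let pi4 := @pi_lt4 R.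
Local Notation cpt c r t := (c.1 + r * cos t, c.2 + r * sin t).
Local Notation M x := (fun r : R => J (fun t => p (x + r * cos t, 0 + r * sin t)) 0 pi).
Local Notation M' x := (fun r : R => J (fun t => px (x + r * cos t, 0 + r * sin t) * cos t
  + py (x + r * cos t, 0 + r * sin t) * sin t) 0 pi).
Local Notation En x := (fun r : R => J (fun t => e (x + r * cos t, 0 + r * sin t)) 0 pi).

Lemma half_disc_far (x r t R0 : R) : 0 <= r -> 0 <= R0 -> R0 + r <= `|x| -> 0 <= t <= pi ->
  0 <= 0 + r * sin t /\ R0 ^+ 2 <= (x + r * cos t) ^+ 2 + (0 + r * sin t) ^+ 2.
Proof.
move=> r0 R00 h tt; split; first by rewrite add0r mulr_ge0 ?sin_ge0_pi.
have xx : (R0 + r) ^+ 2 <= x ^+ 2 + 0 ^+ 2.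
  by rewrite expr0n addr0 -(real_normK (num_real x)) ler_sqr ?nnegrE//; lra.
apply: le_trans (@in_ball_far _ (x, 0) (R0 + r) t r r0 _ xx); last by lra.
by rewrite ler_sqr ?nnegrE; lra.
Qed.

Lemma half_circle (x r : R) : 0 <= r -> r1 + r <= `|x| ->
  `|r * M' x r + b * (u (x - r, 0) - u (x + r, 0))| <= pi * (r ^+ 2 * En x r).
Proof.
move=> r0 h; have r10 := r1_gt0 F.
have reg t := @half_disc_far x r t r1 r0 (ltW r10) h.
have z0 : 0 <= (0 : R) <= pi by rewrite lexx /= ltW.
have z1 : 0 <= (pi : R) <= pi by rewrite lexx andbT ltW.
have [_ q0] := reg _ z0; have [_ q1] := reg _ z1; move: q0 q1.
rewrite cos0 sin0 cospi sinpi mulr1 mulrN1 !mulr0 !addr0 !expr0n !addr0 => q0 q1.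
have := @circle_pressure _ _ _ _ _ _ _ _ _ _ _ _ _ _ _ F (x, 0) r 0 pi (ltW pi0) reg.
rewrite /= cos0 sin0 cospi sinpi mulr1 mulrN1 !mulr0 !addr0 subr0.
by rewrite !(pf_v0 F)// !(pf_o0 F)// mul0r; apply.
Qed.

(** The weights [al] and [be] select one end of the axis or the sum of both. If [b <> 0] they are
    equal, and the values of [b * u] at the four points $\pm r \pm y$ cancel in pairs by evenness.
    The radius is then averaged over $[r/4, r/2]$ with weight [q], which turns half circles into
    half rings that [ball_block] compares with a block. *)
Lemma half_discs (al be c0 eps : R) : 0 <= al <= 1 -> 0 <= be <= 1 -> b * (al - be) = 0 -> 0 < eps ->
  exists S, forall s, S <= s ->
  `|al * (p (expR s, 0) - c0) + be * (p (- expR s, 0) - c0)| <=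
  64 * expR 4 * pressure_block (fun z => p (lp z)) c0 s + eps.
Proof.
move=> al01 be01 bab eps0; have r10 := r1_gt0 F.
have eps2 : 0 < eps / 2 by slra pi4.
have [R0 [r1R0 HR0]] := plane_energy_tail F eps2.
exists (ln (2 * R0)) => s hs.
have rR : 2 * R0 <= expR s by rewrite -[leLHS](@lnK _ (2 * R0)) ?ler_expR ?posrE//; slra pi4.
set r := expR s in rR *.
have r0 : 0 < r by exact: expR_gt0.
have nr : `|r| = r by rewrite ger0_norm ?ltW.
have Rq q : 0 <= q <= r / 2 -> R0 + q <= `|r| /\ R0 + q <= `|- r| by rewrite normrN nr; slra pi4.
set blk := pressure_block _ _ _.
have cM x : continuous (M x) by apply: (@J_param_cts _ _ (fun z : R * R => p (x + z.1 * cos z.2, 0 + z.1 * sin z.2))); cts.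
have cM' x : continuous (M' x) := @mean_der_cts _ _ _ _ _ _ _ _ _ _ _ _ _ _ _ F (x, 0) 0 pi.
have cE x : continuous (fun q : R => J (fun t => q * e (x + q * cos t, 0 + q * sin t)) 0 pi).
  exact: (@energy_circle_cts _ _ _ _ _ _ _ _ _ _ _ _ _ _ _ F (x, 0) 0 pi).
have dM x q : der q (M x) (M' x q) := @mean_der _ _ _ _ _ _ _ _ _ _ _ _ _ _ _ F (x, 0) 0 pi q.
have M0 x : M x 0 = pi * p (x, 0).
  rewrite (_ : (fun t => _) = fun=> p (x, 0)); first by rewrite J_cst subr0 mulrC.
  by apply/funext => t; rewrite !mul0r !addr0.
pose S q := al * M r q + be * M (- r) q.
pose S' q := al * M' r q + be * M' (- r) q.
have cS' : continuous S' by rewrite /S'; cts.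
have dS q : der q S (S' q).
  by der_by ltac:(exact: dM); rewrite /S'; ring.
pose I := pi * (al * (p (r, 0) - c0) + be * (p (- r, 0) - c0)).
have step q : 0 <= q <= r / 2 -> `|S q - S 0| <= pi * eps.
  move=> qq; rewrite -(J_ftc _ _ cS' dS).
  have q0 : 0 <= q by slra pi4.
  apply: le_trans (J_abs q0 cS') _.
  pose B y := pi * (J (fun t => y * e (r + y * cos t, 0 + y * sin t)) 0 pi +
     J (fun t => y * e (- r + y * cos t, 0 + y * sin t)) 0 pi).
  apply: (@le_trans _ _ (J B 0 q)).
    apply: J_le_open => //; [exact: cts_norm|by rewrite /B; cts|move=> y y0 yq].
    have [Ry1 Ry2] := Rq y ltac:(slra pi4).
    have h1 := @half_circle r y (ltW y0) ltac:(slra pi4).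
    have h2 := @half_circle (- r) y (ltW y0) ltac:(slra pi4).
    have bE1 : b * u (r + y, 0) = b * u (- r - y, 0).
      by rewrite (pf_b F) ?opprD//=; nra.
    have bE2 : b * u (r - y, 0) = b * u (- r + y, 0).
      rewrite (pf_b F) ?opprB; first by congr (_ * u (_, _)); ring.
      by rewrite nr in Ry1; nra.
    rewrite -(ler_pM2l y0) -[X in X * _ <= _](gtr0_norm y0) -normrM.
    have -> : y * S' y = al * (y * M' r y + b * (u (r - y, 0) - u (r + y, 0))) +
       be * (y * M' (- r) y + b * (u (- r - y, 0) - u (- r + y, 0))).
      rewrite /S' !(mulrBr b) bE1 bE2.
      have -> : forall X Y a c : R, al * (X + (a - c)) + be * (Y + (c - a)) = al * X + be * Y + (al - be) * (a - c) by move=> *; ring.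
      rewrite (_ : (al - be) * _ = 0); first by ring.
      transitivity (b * (al - be) * (u (- r + y, 0) - u (- r - y, 0))); first by ring.
      by rewrite bab mul0r.
    apply: le_trans (ler_normD _ _) _; rewrite !normrM.
    have cc x : continuous (fun t : R => e (x + y * cos t, 0 + y * sin t)) by cts.
    rewrite /B !JZ//.
    have -> : y * (pi * (y * En r y + y * En (- r) y)) = 1 * (pi * (y ^+ 2 * En r y)) + 1 * (pi * (y ^+ 2 * En (- r) y)) by ring.
    case/andP: (al01) => al0 al1; case/andP: (be01) => be0 be1.
    by apply: lerD; apply: ler_pM => //; rewrite ger0_norm.
  rewrite /B JZ; last by cts.
  rewrite JD//; apply: ler_wpM2l; first exact: ltW.
  have pp := pi0.
  have key x : `|x| = r -> J (fun y => J (fun t => y * e (x + y * cos t, 0 + y * sin t)) 0 pi) 0 q <= eps / 2.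
    move=> xr; apply: (HR0 (x, 0) 0 q 0 pi) => //; [slra pi4|slra pi4|slra pi4|].
    by move=> y t yq tt; apply: half_disc_far => //; slra pi4.
  by have := key r nr; have := key (- r) (etrans (normrN _) nr); slra pi4.
pose N x q := J (fun t => q * `|p (x + q * cos t, 0 + q * sin t) - c0|) 0 pi.
have cN x : continuous (N x).
  by apply: (@J_param_cts _ _ (fun z : R * R => z.1 * `|p (x + z.1 * cos z.2, 0 + z.1 * sin z.2) - c0|)); cts.
have NB x : `|x| = r -> J (N x) (r / 4) (r / 2) <= 2 * expR (s + 2) ^+ 2 * blk.
  move=> xr; apply: (@ball_block _ (fun z => `|p z - c0|) s (x, 0) (r / 4) (r / 2) 0 pi) => /=; rewrite -/r; try by have := pi0; slra pi4.
  - by cts.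
  - by move=> z; exact: normr_ge0.
  - by rewrite expr0n addr0 -xr real_normK ?num_real.
  - by move=> q t qq tt; rewrite add0r mulr_ge0 ?sin_ge0_pi//; slra pi4.
have MN x q : 0 <= q -> `|q * (M x q - pi * c0)| <= N x q.
  move=> q0.
  have cc : continuous (fun t : R => p (x + q * cos t, 0 + q * sin t)) by cts.
  have ck : continuous (fun t : R => c0) by cts.
  have -> : pi * c0 = J (fun=> c0) 0 pi by rewrite J_cst subr0 mulrC.
  rewrite -JB// -JZ; last by cts.
  by apply: J_abs_le => //; [exact: ltW|cts|cts|move=> t _; rewrite normrM (ger0_norm q0)].
have main q : r / 4 <= q <= r / 2 -> q * `|I| <= N r q + N (- r) q + q * (pi * eps).
  move=> qq; have q0 : 0 <= q by slra pi4.
  have -> : q * `|I| = `|al * (q * (M r q - pi * c0)) + be * (q * (M (- r) q - pi * c0)) - q * (S q - S 0)|.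
    by rewrite -[X in X * _ = _](ger0_norm q0) -normrM /S !M0; congr `|_|; rewrite /I; ring.
  apply: le_trans (ler_normB _ _) _; apply: lerD; last first.
    by rewrite normrM (ger0_norm q0); apply: ler_wpM2l => //; apply: step; slra pi4.
  apply: le_trans (ler_normD _ _) _.
  have h x k : 0 <= k <= 1 -> `|k * (q * (M x q - pi * c0))| <= N x q.
    move=> k01; rewrite normrM -[leRHS]mul1r; apply: ler_pM => //; last exact: MN.
    by rewrite ger0_norm; slra pi4.
  by apply: lerD; exact: h.
have fin : J (fun q => q * `|I|) (r / 4) (r / 2) <= 4 * expR (s + 2) ^+ 2 * blk + J (fun q => q * (pi * eps)) (r / 4) (r / 2).
  have h1 := NB r nr; have h2 := NB (- r) (etrans (normrN _) nr).
  apply: (@le_trans _ _ (J (fun q => N r q + N (- r) q + q * (pi * eps)) (r / 4) (r / 2))).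
    by apply: J_le; [slra pi4|cts|cts|exact: main].
  by rewrite JD; [rewrite JD//; slra pi4|cts|cts].
have Jq k : J (fun q => q * k) (r / 4) (r / 2) = 3 / 32 * r ^+ 2 * k.
  rewrite (@J_ftc _ _ (fun q => q ^+ 2 / 2 * k)); [by field|by cts|move=> q].
  by der_by fail; field.
move: fin; rewrite !Jq.
have -> : expR (s + 2) ^+ 2 = r ^+ 2 * expR 4.
  by rewrite expr2 -expRD /r expr2 -!expRD; congr expR; ring.
have r2 : 0 < r ^+ 2 by rewrite exprn_gt0.
have -> : 4 * (r ^+ 2 * expR 4) * blk + 3 / 32 * r ^+ 2 * (pi * eps) = r ^+ 2 * (4 * expR 4 * blk + 3 / 32 * (pi * eps)) by ring.
rewrite (_ : 3 / 32 * r ^+ 2 * `|I| = r ^+ 2 * (3 / 32 * `|I|)); last by ring.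
rewrite (ler_pM2l r2) /I normrM (gtr0_norm pi0).
set Q := `|_|; set B := expR 4 * blk.
have B0 : 0 <= B.
  rewrite mulr_ge0 ?expR_ge0// /blk /pressure_block; apply: J_ge0; first by slra pi4.
    by apply: (@J_param_cts _ _ (fun z : R * R => `|p (lp z) - c0|)); rewrite /lp; cts.
  by move=> x _; apply: J_ge0 => //; [exact: ltW|rewrite /lp /=; cts].
rewrite -!(mulrA _ (expR 4)) -/B => h.
have p1 : 1 <= pi :> R by have := @pi_ge2 R; slra pi4.
have p0 := pi0.
rewrite -(ler_pM2l p0); nra.
Qed.

Lemma plane_limits : exists c, 
  [/\ exists K S, forall s, S <= s -> J (fun t => u (lp (s, t)) ^+ 2) 0 pi <= K,
      tends (fun s => pressure_block (fun z => p (lp z)) c s) 0,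
      tends (fun s => p (expR s, 0)) c & tends (fun s => p (- expR s, 0)) c].
Proof.
have G := strip_of_plane F.
have [c HL] := mean_pressure_tends G.
have C0 : 0 < 64 * expR 4 :> R by rewrite mulr_gt0 ?expR_gt0.
have l0 s : lp (s, 0) = (expR s, 0) by rewrite /lp /= cos0 sin0 mulr1 mulr0.
have lpi s : lp (s, pi) = (- expR s, 0) by rewrite /lp /= cospi sinpi mulrN1 mulr0.
have HB : forall eps : R, 0 < eps -> exists S, forall s, S <= s ->
  (b = 0 -> `|p (lp (s, 0)) - c| <= 64 * expR 4 * pressure_block (fun z => p (lp z)) c s + eps /\
            `|p (lp (s, pi)) - c| <= 64 * expR 4 * pressure_block (fun z => p (lp z)) c s + eps) /\
  `|p (lp (s, 0)) + p (lp (s, pi)) - 2 * c| <= 64 * expR 4 * pressure_block (fun z => p (lp z)) c s + eps.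
  move=> eps eps0.
  have i0 : 0 <= (0 : R) <= 1 by rewrite lexx ler01.
  have i1 : 0 <= (1 : R) <= 1 by rewrite lexx ler01.
  have [S1 H1] := @half_discs 1 1 c eps i1 i1 ltac:(by rewrite subrr mulr0) eps0.
  have [b0|bn] := eqVneq b 0; last first.
    exists S1 => s /H1; rewrite l0 lpi => h; split; first by move=> b0; rewrite b0 eqxx in bn.
    by rewrite (_ : _ - _ = 1 * (p (expR s, 0) - c) + 1 * (p (- expR s, 0) - c)); [|ring].
  have [S2 H2] := @half_discs 1 0 c eps i1 i0 ltac:(by rewrite b0 mul0r) eps0.
  have [S3 H3] := @half_discs 0 1 c eps i0 i1 ltac:(by rewrite b0 mul0r) eps0.
  exists (Num.max S1 (Num.max S2 S3)) => s; rewrite !ge_max => /and3P[/H1 h1 /H2 h2 /H3 h3].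
  rewrite l0 lpi; split.
    by move=> _; move: h2 h3; rewrite !mul0r !mul1r add0r addr0.
  by rewrite (_ : _ - _ = 1 * (p (expR s, 0) - c) + 1 * (p (- expR s, 0) - c)); [|ring].
exists c; have [T1 T2] := boundary_pressure_tends G HL C0 HB; split.
- have [K [S [_ HK]]] := speed2_bounded G HL C0 HB; exists K, S => s /HK; apply: le_trans.
  have cu := C1_cts (pf_u F); have cv := C1_cts (pf_v F).
  apply: J_le; [exact: ltW|by rewrite /lp /=; cts|by rewrite /strip_speed2 /lp /=; cts|move=> t _].
  by rewrite /strip_speed2 lerDl sqr_ge0.
- by have [] := pressure_block_tends G HL C0 HB.
- by move=> eps eps0; have [S HS] := T1 eps eps0; exists S => s /HS; rewrite l0.
- by move=> eps eps0; have [S HS] := T2 eps eps0; exists S => s /HS; rewrite lpi.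
Qed.

End HalfDiscs.

(** * The Green function and the pressure near the axis *)

Section Green.
Context {R : realType}.
Implicit Types d s h : R.

(* [lam d s] is the derivative in s = |z|^2 of a radial function whose
   Laplacian is [kern d s], a weight of total mass 2 pi supported in s <= d;
   it coincides with that of ln |z| for s >= d. *)
Definition lamd d s : R := - (2 * Num.max s d ^+ 2)^-1.
Definition lam d s : R := d^-1 + J (lamd d) 0 s.
Definition kern d s : R := 4 / d * Num.max 0 (1 - s / d).

Lemma max_gt0 d s : 0 < d -> 0 < Num.max s d.
Proof. by move=> d0; rewrite lt_max d0 orbT. Qed.

Lemma lamd_cts d : 0 < d -> continuous (lamd d).
Proof.
move=> d0; apply: ctsN; apply: cts_inv; first by cts.
by move=> x; rewrite mulf_neq0// expf_neq0// gt_eqF ?max_gt0.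
Qed.

Lemma lam_der d s : 0 < d -> der s (lam d) (lamd d s).
Proof.
by move=> d0; rewrite /lam; der_by ltac:(exact: (J_der _ _ (lamd_cts d0))); rewrite add0r.
Qed.

Lemma kern_cts d : continuous (kern d).
Proof. by rewrite /kern; cts. Qed.

Lemma lam_in d s : 0 < d -> 0 <= s -> s <= d -> lam d s = d^-1 - s / (2 * d ^+ 2).
Proof.
move=> d0 s0 sd; rewrite /lam (@J_ext _ _ (fun=> - (2 * d ^+ 2)^-1) 0 s s0 (lamd_cts d0)).
- by rewrite J_cst subr0; congr (_ + _); rewrite mulNr mulrC.
- by cts.
- by move=> x /andP[x0 xs]; rewrite /lamd (max_idPr _)//; exact: le_trans sd.
Qed.

Lemma lam_out d s : 0 < d -> d <= s -> lam d s = (2 * s)^-1.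
Proof.
move=> d0 ds; rewrite /lam (J_cat _ 0 d s) addrA -/(lam d d) lam_in ?(ltW d0)//.
pose g (x : R) := (2 * x)^-1.
have c1 : continuous (fun _ : R => 1 : R) by cts.
have dn : d != 0 by rewrite gt_eqF.
have dg (x : R) : 0 < x -> der x g (- (2 * x ^+ 2)^-1).
  move=> x0; have h : der x (fun y => 2 * y) 2 by der_by fail; ring.
  have x2 : 2 * x != 0 by rewrite mulf_neq0// gt_eqF.
  have := @is_deriveV R (fun y => 2 * y) x 2 1 x2 h.
  move=> H; refine (der_eq H _); rewrite /GRing.scale /=; field.
  by rewrite gt_eqF.
rewrite (@J_subst_in _ (fun=> 1) g (fun x => - (2 * x ^+ 2)^-1) (lamd d) d s ds).
- by rewrite J_cst /g mul1r; field; rewrite dn gt_eqF//; exact: lt_le_trans ds.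
- by cts.
- exact: lamd_cts.
- by move=> x /andP[dx xs]; apply: dg; exact: lt_le_trans dx.
- by move=> x /andP[dx xs]; rewrite mul1r /lamd (max_idPl dx).
Qed.

(** A radial function whose derivative in $s = |z|^2$ is $\lambda$ has Laplacian $4\lambda + 4 s
    \lambda'$. *)
Lemma lam_kern d s : 0 < d -> 0 <= s -> 4 * lam d s + 4 * s * lamd d s = kern d s.
Proof.
move=> d0 s0; have dn : d != 0 by rewrite gt_eqF.
rewrite /lamd /kern; have [sd|ds] := leP s d.
  rewrite lam_in// (max_idPr _); first by field.
  by rewrite subr_ge0 ler_pdivrMr// mul1r.
rewrite lam_out ?(ltW ds)// (max_idPl _); last first.
  by rewrite subr_le0 ler_pdivlMr// mul1r ltW.
have sn : s != 0 by rewrite gt_eqF// (lt_trans d0 ds).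
by field; rewrite ?dn ?sn.
Qed.

Lemma lam_bound d s : 0 < d -> 0 <= s -> 0 <= lam d s <= (Num.max s d)^-1.
Proof.
move=> d0 s0; have [sd|ds] := leP s d.
  rewrite lam_in//.
  have h : 0 <= s / (2 * d ^+ 2) <= d^-1.
    apply/andP; split; first by apply: divr_ge0 => //; apply: mulr_ge0 => //; exact: sqr_ge0.
    rewrite ler_pdivrMr ?mulr_gt0 ?exprn_gt0//.
    rewrite (_ : d^-1 * _ = 2 * d); first by lra.
    by field; rewrite gt_eqF.
  lra.
have s1 : 0 < s := lt_trans d0 ds.
rewrite lam_out ?(ltW ds)// invr_ge0 mulr_ge0//= lef_pV2 ?posrE ?mulr_gt0//; lra.
Qed.

Lemma lam_diff d s s' : 0 < d -> 0 <= s -> s <= s' ->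
  0 <= lam d s - lam d s' <= (s' - s) / (2 * Num.max s d ^+ 2).
Proof.
move=> d0 s0 ss; have cl := lamd_cts d0.
have -> : lam d s - lam d s' = J (fun x => - lamd d x) s s'.
  rewrite JN// /lam (J_cat _ 0 s s'); ring.
have m0 := @max_gt0 d s d0.
have cnl : continuous (fun x => - lamd d x) by exact: ctsN.
apply/andP; split.
  by apply: J_ge0 => // x _; rewrite opprK invr_ge0 mulr_ge0 ?sqr_ge0.
have -> : (s' - s) / (2 * Num.max s d ^+ 2) = J (fun=> (2 * Num.max s d ^+ 2)^-1) s s'.
  by rewrite J_cst mulrC.
apply: J_le => //; first by cts.
move=> x /andP[sx xs]; rewrite opprK lef_pV2 ?posrE ?mulr_gt0 ?exprn_gt0 ?max_gt0//.
rewrite ler_pM2l// ler_sqr ?nnegrE ?(ltW (max_gt0 _ _))//.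
by rewrite ge_max !le_max sx lexx !orbT.
Qed.

Lemma kern_ge0 d s : 0 < d -> 0 <= kern d s.
Proof. by move=> d0; rewrite mulr_ge0 ?divr_ge0 ?(ltW d0)// le_max lexx. Qed.

Lemma kern_out d s : 0 < d -> d <= s -> kern d s = 0.
Proof.
move=> d0 ds; rewrite /kern (max_idPl _) ?mulr0//.
by rewrite subr_le0 ler_pdivlMr// mul1r.
Qed.

Lemma kern_mass a : 0 < a -> J (fun q => kern (a ^+ 2) (q ^+ 2) * q) 0 a = 1.
Proof.
move=> a0; have an : a != 0 by rewrite gt_eqF.
have ck : continuous (fun q : R => kern (a ^+ 2) (q ^+ 2) * q) by rewrite /kern; cts.
have ck' : continuous (fun q : R => 4 / a ^+ 2 * (1 - q ^+ 2 / a ^+ 2) * q) by cts.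
rewrite (J_ext (ltW a0) ck ck').
  rewrite (@J_ftc _ _ (fun q => 4 / a ^+ 2 * (q ^+ 2 / 2 - q ^+ 2 * q ^+ 2 / (4 * a ^+ 2)))) //.
    by field.
  by move=> q; der_by fail; field.
move=> q /andP[q0 qa]; rewrite /kern (max_idPr _)//.
by rewrite subr_ge0 ler_pdivrMr ?exprn_gt0// mul1r ler_sqr ?nnegrE// ltW.
Qed.

Section GreenField.
Context (x0 h : R) (h0 : 0 < h).
Let d := h ^+ 2 / 4.
Let d0 : 0 < d. Proof. by rewrite /d divr_gt0 ?exprn_gt0. Qed.
Let sp (z : R * R) : R := (z.1 - x0) ^+ 2 + (z.2 - h) ^+ 2.
Let sm (z : R * R) : R := (z.1 - x0) ^+ 2 + (z.2 + h) ^+ 2.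

(* The gradient of the Green function of the half plane with the regularised
   pole (x0, h), the image pole being (x0, - h). *)
Definition grx (z : R * R) : R := 2 * (z.1 - x0) * (lam d (sp z) - lam d (sm z)).
Definition gry (z : R * R) : R := 2 * (z.2 - h) * lam d (sp z) - 2 * (z.2 + h) * lam d (sm z).
Definition grxx (z : R * R) : R := 2 * (lam d (sp z) - lam d (sm z)) +
  4 * (z.1 - x0) ^+ 2 * (lamd d (sp z) - lamd d (sm z)).
Definition grxy (z : R * R) : R :=
  4 * (z.1 - x0) * ((z.2 - h) * lamd d (sp z) - (z.2 + h) * lamd d (sm z)).
Definition gryy (z : R * R) : R := 2 * (lam d (sp z) - lam d (sm z)) +
  4 * ((z.2 - h) ^+ 2 * lamd d (sp z) - (z.2 + h) ^+ 2 * lamd d (sm z)).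

Let C1sq k : C1 (fun z : R * R => (z.1 - x0) ^+ 2 + (z.2 - k) ^+ 2)
   (fun z => 2 * (z.1 - x0)) (fun z => 2 * (z.2 - k)).
Proof. by split; [cts|cts| |] => x y /=; der_by fail; ring. Qed.

Let C1lam k := C1_comp (lamd_cts d0) (fun x => lam_der x d0) (C1sq k).

Let smE : sm = fun z => (z.1 - x0) ^+ 2 + (z.2 - - h) ^+ 2.
Proof. by apply/funext => z; rewrite opprK. Qed.

Let C1p : C1 (fun z => lam d (sp z)) (fun z => lamd d (sp z) * (2 * (z.1 - x0)))
  (fun z => lamd d (sp z) * (2 * (z.2 - h))).
Proof. exact: C1lam. Qed.

Let C1m : C1 (fun z => lam d (sm z)) (fun z => lamd d (sm z) * (2 * (z.1 - x0)))
  (fun z => lamd d (sm z) * (2 * (z.2 + h))).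
Proof. by rewrite smE; apply: C1_eq (C1lam (- h)) _ _ => z //; rewrite opprK. Qed.

Lemma C1_grx : C1 grx grxx grxy.
Proof.
have clp := C1_cts C1p; have clm := C1_cts C1m.
have csp : continuous sp by rewrite /sp; cts.
have csm : continuous sm by rewrite /sm; cts.
have cld := lamd_cts d0.
split; [by rewrite /grxx; cts|by rewrite /grxy; cts| |] => x y.
  rewrite /grx; der_by ltac:(first [exact: (C1_dx C1p)|exact: (C1_dx C1m)]).
  by rewrite /grxx /=; ring.
rewrite /grx; der_by ltac:(first [exact: (C1_dy C1p)|exact: (C1_dy C1m)]).
by rewrite /grxy /=; ring.
Qed.

Lemma C1_gry : C1 gry grxy gryy.
Proof.
have clp := C1_cts C1p; have clm := C1_cts C1m.
have csp : continuous sp by rewrite /sp; cts.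
have csm : continuous sm by rewrite /sm; cts.
have cld := lamd_cts d0.
split; [by rewrite /grxy; cts|by rewrite /gryy; cts| |] => x y.
  rewrite /gry; der_by ltac:(first [exact: (C1_dx C1p)|exact: (C1_dx C1m)]).
  by rewrite /grxy /=; ring.
rewrite /gry; der_by ltac:(first [exact: (C1_dy C1p)|exact: (C1_dy C1m)]).
by rewrite /gryy /=; ring.
Qed.

Lemma gr_laplacian (z : R * R) : 0 <= z.2 -> grxx z + gryy z = kern d (sp z).
Proof.
move=> y0; have p0 : 0 <= sp z by rewrite addr_ge0 ?sqr_ge0.
have m0 : 0 <= sm z by rewrite addr_ge0 ?sqr_ge0.
have mo : kern d (sm z) = 0.
  apply: kern_out => //; rewrite /sm /d; have := sqr_ge0 (z.1 - x0).
  by have := mulr_ge0 y0 (ltW h0); have := sqr_ge0 z.2; have := sqr_ge0 h; lra.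
rewrite -[RHS]subr0 -mo -!lam_kern// /grxx /gryy /sp /sm; ring.
Qed.

(** Pole and image nearly cancel, as for a dipole: [sm - sp = 4 * y * h], so the values of [lam]
    differ by at most $2yh/m^2$ with [m] the maximum of [sp] and [d]. Both components are thus at
    most $44 h/m$, and $h^2 + r^2 \le 14 m$ for the distance $r$ to $(x_0, 0)$ gives $616 = 44 \cdot
    14$. *)
Lemma gr_bound (z : R * R) : 0 <= z.2 ->
  `|grx z| <= 616 * (h / (h ^+ 2 + ((z.1 - x0) ^+ 2 + z.2 ^+ 2))) /\
  `|gry z| <= 616 * (h / (h ^+ 2 + ((z.1 - x0) ^+ 2 + z.2 ^+ 2))).
Proof.
move=> y0; have p0 : 0 <= sp z by rewrite addr_ge0 ?sqr_ge0.
have m0 : 0 <= sm z by rewrite addr_ge0 ?sqr_ge0.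
have hh := h0; have hy := mulr_ge0 y0 (ltW h0).
have pm : sp z <= sm z by rewrite /sp /sm; lra.
have := lam_diff d0 p0 pm; have := lam_bound d0 p0; have := lam_bound d0 m0.
have smp : sm z - sp z = 4 * (z.2 * h) by rewrite /sp /sm; ring.
have mm : Num.max (sp z) d <= Num.max (sm z) d by rewrite ge_max !le_max pm lexx !orbT.
have M0 := @max_gt0 d (sp z) d0.
have M1 : (Num.max (sm z) d)^-1 <= (Num.max (sp z) d)^-1.
  by rewrite lef_pV2 ?posrE ?max_gt0.
have Md : d <= Num.max (sp z) d by rewrite le_max lexx orbT.
have Ms : sp z <= Num.max (sp z) d by rewrite le_max lexx.
rewrite smp /grx /gry; move: (lam d (sp z)) (lam d (sm z)) => l l' lb' lb ld.
set m := Num.max _ _ in M0 M1 Md Ms lb ld *; set m' := Num.max (sm z) d in M1 lb'.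
clearbody m m'; set X := z.1 - x0; move: Md Ms; rewrite /d /sp -/X => Md Ms.
set y := z.2 in y0 ld Ms hy *.
have X2 := sqr_ge0 X.
have yX : X ^+ 2 + y ^+ 2 <= 10 * m by have := sqr_ge0 (y - 2 * h); nra.
have L14 : h ^+ 2 + (X ^+ 2 + y ^+ 2) <= 14 * m by nra.
have L0 : 0 < h ^+ 2 + (X ^+ 2 + y ^+ 2) by nra.
set L := h ^+ 2 + _ in L14 L0 *.
have hmL : 44 * h / m <= 616 * (h / L).
  have hL : h * L <= h * (14 * m) by apply: ler_wpM2l => //; exact: ltW.
  rewrite (_ : 616 * (h / L) = 616 * h / L); last by rewrite mulrA.
  by rewrite ler_pdivrMr// mulrAC ler_pdivlMr//; slra C1m.
have mi0 : 0 < m^-1 by rewrite invr_gt0.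
have ldE : l - l' <= 2 * (y * h) * m^-1 ^+ 2.
  apply: le_trans (andP ld).2 _; rewrite le_eqVlt; apply/orP; left; apply/eqP.
  by field; rewrite gt_eqF.
have mE : m * m^-1 = 1 by rewrite divff// gt_eqF.
have key k : 0 <= k -> k * y <= 10 * m -> 2 * k * (l - l') <= 40 * h * m^-1.
  move=> k0 ky.
  apply: (@le_trans _ _ (2 * k * (2 * (y * h) * m^-1 ^+ 2))).
    by apply: ler_wpM2l ldE; slra C1m.
  have -> : 40 * h * m^-1 = 4 * h * m^-1 ^+ 2 * (10 * m).
    by transitivity (40 * h * m^-1 * (m * m^-1)); [rewrite mE mulr1|ring].
  have -> : 2 * k * (2 * (y * h) * m^-1 ^+ 2) = 4 * h * m^-1 ^+ 2 * (k * y) by ring.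
  by apply: ler_wpM2l ky; rewrite mulr_ge0 ?sqr_ge0//; slra C1m.
have hm0 : 0 < h * m^-1 by rewrite mulr_gt0.
have ld0 : 0 <= l - l' by case/andP: ld.
have Xn : `|X| ^+ 2 = X ^+ 2 by rewrite real_normK ?num_real.
have X0 := normr_ge0 X.
split.
  rewrite !normrM (ger0_norm ld0) (ger0_norm (ltW _))//.
  apply: le_trans (key _ _ _) _ => //; first by nra.
  by apply: le_trans hmL; rewrite -!mulrA; slra C1m.
have -> : 2 * (y - h) * l - 2 * (y + h) * l' = 2 * y * (l - l') - 2 * (h * (l + l')) by ring.
apply: le_trans (ler_normB _ _) _; rewrite ger0_norm; last by rewrite mulr_ge0//; slra C1m.
rewrite ger0_norm; last by rewrite mulr_ge0 ?mulr_ge0//; slra C1m.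
have h1 := key y y0 ltac:(nra).
have h2 : h * (l + l') <= h * (2 * m^-1) by apply: ler_wpM2l; slra C1m.
by move: hmL h1 h2; rewrite -!mulrA; slra C1m.
Qed.

End GreenField.

(** Makes the constant abstract, so that the numeral stays out of the later arithmetic. *)
Lemma gr_bound_ex : exists2 k : R, 0 <= k & forall (x0 h : R) (z : R * R), 0 < h -> 0 <= z.2 ->
  `|grx x0 h z| <= k * (h / (h ^+ 2 + ((z.1 - x0) ^+ 2 + z.2 ^+ 2))) /\
  `|gry x0 h z| <= k * (h / (h ^+ 2 + ((z.1 - x0) ^+ 2 + z.2 ^+ 2))).
Proof. by exists 616 => [|x0 h z h0]; [lra|exact: gr_bound]. Qed.

End Green.

(** * The divergence theorem on a half disc *)

Section HalfDiscDivergence.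
Context {R : realType}.

(** For a field $X$, $r\,\mathrm{div} X = \partial_r (r X \cdot e_r) + \partial_t (X \cdot e_t)$:
    the first term integrates to the arc, the second to the flat side. *)
Lemma half_disc_divergence (x0 a : R) (f fx fy g gx gy : R * R -> R) : C1 f fx fy -> C1 g gx gy ->
  J (fun r => J (fun t => r * (fx (x0 + r * cos t, r * sin t) + gy (x0 + r * cos t, r * sin t))) 0 pi) 0 a =
  J (fun t => a * (f (x0 + a * cos t, a * sin t) * cos t + g (x0 + a * cos t, a * sin t) * sin t)) 0 pi
  - J (fun r => g (x0 - r, 0) + g (x0 + r, 0)) 0 a.
Proof.
move=> Cf Cg.
have PP (h hx hy : R * R -> R) : C1 h hx hy ->
    C1 (fun z => h (x0 + z.1 * cos z.2, z.1 * sin z.2))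
     (fun z => hx (x0 + z.1 * cos z.2, z.1 * sin z.2) * cos z.2 +
               hy (x0 + z.1 * cos z.2, z.1 * sin z.2) * sin z.2)
     (fun z => z.1 * (- hx (x0 + z.1 * cos z.2, z.1 * sin z.2) * sin z.2 +
               hy (x0 + z.1 * cos z.2, z.1 * sin z.2) * cos z.2)).
  move=> Ch; refine (eq_ind _ id (C1_polar (x0, 0) Ch) _ _).
  by congr C1; apply/funext => z /=; rewrite add0r.
have Pf := PP _ _ _ Cf; have Pg := PP _ _ _ Cg.
have [cfx cfy _ _] := Cf; have [cgx cgy _ _] := Cg.
have cf := C1_cts Cf; have cg := C1_cts Cg.
pose Xr (z : R * R) := f (x0 + z.1 * cos z.2, z.1 * sin z.2) * cos z.2 + g (x0 + z.1 * cos z.2, z.1 * sin z.2) * sin z.2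
  + z.1 * ((fx (x0 + z.1 * cos z.2, z.1 * sin z.2) * cos z.2 + fy (x0 + z.1 * cos z.2, z.1 * sin z.2) * sin z.2) * cos z.2
   + (gx (x0 + z.1 * cos z.2, z.1 * sin z.2) * cos z.2 + gy (x0 + z.1 * cos z.2, z.1 * sin z.2) * sin z.2) * sin z.2).
pose Yt (z : R * R) := - f (x0 + z.1 * cos z.2, z.1 * sin z.2) * cos z.2 - g (x0 + z.1 * cos z.2, z.1 * sin z.2) * sin z.2
  + z.1 * ((fx (x0 + z.1 * cos z.2, z.1 * sin z.2) * sin z.2 - fy (x0 + z.1 * cos z.2, z.1 * sin z.2) * cos z.2) * sin z.2
   + (- gx (x0 + z.1 * cos z.2, z.1 * sin z.2) * sin z.2 + gy (x0 + z.1 * cos z.2, z.1 * sin z.2) * cos z.2) * cos z.2).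
have cXr : continuous Xr by rewrite /Xr; cts.
have cYt : continuous Yt by rewrite /Yt; cts.
have cXr1 (r : R) : continuous (fun t : R => Xr (r, t)) by cts.
have cXr2 (t : R) : continuous (fun r : R => Xr (r, t)) by cts.
have cYt1 (r : R) : continuous (fun t : R => Yt (r, t)) by cts.
have dX r t : der r (fun r => r * (f (x0 + r * cos t, r * sin t) * cos t + g (x0 + r * cos t, r * sin t) * sin t)) (Xr (r, t)).
  by der_by ltac:(first [exact: (C1_dx Pf r t)|exact: (C1_dx Pg r t)]); rewrite /Xr /=; ring.
have dY r t : der t (fun t => - f (x0 + r * cos t, r * sin t) * sin t + g (x0 + r * cos t, r * sin t) * cos t) (Yt (r, t)).
  by der_by ltac:(first [exact: (C1_dy Pf r t)|exact: (C1_dy Pg r t)]); rewrite /Yt /=; ring.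
transitivity (J (fun r => J (fun t => Xr (r, t)) 0 pi) 0 a + J (fun r => J (fun t => Yt (r, t)) 0 pi) 0 a).
  rewrite -JD; [|exact: J_param_cts|exact: J_param_cts].
  congr J; apply/funext => r; rewrite -JD//; congr J; apply/funext => t.
  have cs := cos2Dsin2 t; rewrite /Xr /Yt /=.
  set A := fx _; set B := gy _; rewrite -[A + B]mulr1 -cs; ring.
congr (_ + _).
  rewrite (@J_fubini _ Xr)//; congr J; apply/funext => t.
  by rewrite (J_ftc _ _ (cXr2 t) (dX ^~ t)) mul0r subr0.
rewrite -JN; last by cts.
congr J; apply/funext => r; rewrite (J_ftc _ _ (cYt1 r) (dY r)).
by rewrite cospi sinpi cos0 sin0 !mulr0 !mulr1 !mulrN1 add0r; ring.
Qed.

Lemma half_disc_divergence_on (x0 a : R) (f fx fy g gx gy k : R * R -> R) : C1 f fx fy -> C1 g gx gy ->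
  continuous k -> 0 <= a ->
  (forall r t, 0 <= r <= a -> 0 <= t <= pi ->
    fx (x0 + r * cos t, r * sin t) + gy (x0 + r * cos t, r * sin t) = k (x0 + r * cos t, r * sin t)) ->
  J (fun r => J (fun t => r * k (x0 + r * cos t, r * sin t)) 0 pi) 0 a =
  J (fun t => a * (f (x0 + a * cos t, a * sin t) * cos t + g (x0 + a * cos t, a * sin t) * sin t)) 0 pi
  - J (fun r => g (x0 - r, 0) + g (x0 + r, 0)) 0 a.
Proof.
move=> Cf Cg ck a0 H; rewrite -(half_disc_divergence x0 a Cf Cg).
have [cfx _ _ _] := Cf; have [_ cgy _ _] := Cg; have pp := @pi_ge0 R.
apply: J_ext => //.
- by apply: (@J_param_cts _ _ (fun z : R * R => z.1 * k (x0 + z.1 * cos z.2, z.1 * sin z.2))); cts.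
- by apply: (@J_param_cts _ _ (fun z : R * R => z.1 * (fx (x0 + z.1 * cos z.2, z.1 * sin z.2) + gy (x0 + z.1 * cos z.2, z.1 * sin z.2)))); cts.
move=> r ra; apply: J_ext => //; [by cts|by cts|move=> t tt].
by rewrite H.
Qed.

End HalfDiscDivergence.

(** * Averages against the regularised pole *)

Section KernelMass.
Context {R : realType}.
Let pi0 : 0 < pi :> R := @pi_gt0 R.

Lemma sin_le0_out (t : R) : - (pi / 4) <= t <= 7 * (pi / 4) -> t <= 0 \/ pi <= t -> sin t <= 0.
Proof.
have pp := pi0; move=> tt [t0|t1].
  have h : 0 <= - t <= pi by lra.
  by have := sin_ge0_pi h; rewrite sinN; lra.
have h : 0 <= t - pi <= pi by lra.
have := sin_ge0_pi h => hs; have := @sinDpi R (t - pi).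
by rewrite subrK => ->; lra.
Qed.

(** The kernel lives in the disc of radius [h / 2] about [(x0, h)], which lies in the half disc
    because [3 / 2 * h <= a]. Both sides therefore equal the same integral over a square. *)
Lemma half_disc_kern (f : R * R -> R) (x0 h a : R) : continuous f -> 0 < h -> 3 / 2 * h <= a ->
  J (fun r => J (fun t => r * (f (x0 + r * cos t, r * sin t) *
     kern (h ^+ 2 / 4) ((x0 + r * cos t - x0) ^+ 2 + (r * sin t - h) ^+ 2))) 0 pi) 0 a =
  J (fun q => kern (h ^+ 2 / 4) (q ^+ 2) * q *
     J (fun t => f (x0 + q * cos t, h + q * sin t)) (- (pi / 4)) (7 * (pi / 4))) 0 (h / 2).
Proof.
move=> cf h0 ha; have pp := pi0; pose d := h ^+ 2 / 4.
have d0 : 0 < d by rewrite divr_gt0 ?exprn_gt0.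
have ck := @kern_cts R d.
pose g (z : R * R) := f z * kern d ((z.1 - x0) ^+ 2 + (z.2 - h) ^+ 2).
have cg : continuous g by rewrite /g; cts.
have g0 (z : R * R) : z.2 <= 0 -> g z = 0.
  move=> z0; rewrite /g kern_out ?mulr0// /d.
  have := sqr_ge0 (z.1 - x0); have : h ^+ 2 <= (z.2 - h) ^+ 2 by nra.
  by have := sqr_ge0 h; lra.
have a0 : 0 < a by lra.
have h20 : 0 < h / 2 by lra.
pose B := `|x0| + h + a.
have e1 := @polar_box _ g (x0, 0) a B a0 cg.
have {}e1 := e1 _ _ _.
have e2 := @polar_box _ g (x0, h) (h / 2) B h20 cg.
have {}e2 := e2 _ _ _.
transitivity (J (fun x => J (fun y => g (x, y)) (- B) B) (- B) B).
  rewrite e1 //=; last 3 first.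
  - move=> z hz; rewrite /g kern_out ?mulr0// /d.
    have [z0|z0] := leP z.2 0.
      have := sqr_ge0 (z.1 - x0); have : h ^+ 2 <= (z.2 - h) ^+ 2 by nra.
      by have := sqr_ge0 h; slra pi0.
    move: hz; rewrite subr0; set X := z.1 - x0; set y := z.2 => hz.
    have h1 : (3 / 2 * h) ^+ 2 <= X ^+ 2 + y ^+ 2.
      by apply: le_trans hz; rewrite ler_sqr ?nnegrE; slra pi0.
    have := sqr_ge0 X; have [yh|yh] := leP y (3 / 2 * h); first by nra.
    by nra.
  - by rewrite /B; slra pi0.
  - by rewrite normr0 /B; have := normr_ge0 x0; slra pi0.
  pose G (z : R * R) := g (x0 + z.1 * cos z.2, 0 + z.1 * sin z.2) * z.1.
  have cG : continuous G by rewrite /G; cts.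
  rewrite -(@J_fubini _ G)//.
  have cG1 (r : R) : continuous (fun t : R => G (r, t)) by cts.
  have cLt (r : R) : continuous (fun t : R => r * (f (x0 + r * cos t, r * sin t) *
     kern (h ^+ 2 / 4) ((x0 + r * cos t - x0) ^+ 2 + (r * sin t - h) ^+ 2))).
    by rewrite -/d; cts.
  apply: J_ext => //; first exact: ltW.
  - apply: (@J_param_cts _ _ (fun z : R * R => z.1 * (f (x0 + z.1 * cos z.2, z.1 * sin z.2) *
     kern (h ^+ 2 / 4) ((x0 + z.1 * cos z.2 - x0) ^+ 2 + (z.1 * sin z.2 - h) ^+ 2)))).
    by rewrite -/d; cts.
  - exact: J_param_cts.
  move=> r /andP[r0 ra]; symmetry.
  rewrite (@J_support _ (fun t => G (r, t)) _ 0 pi _ (cG1 r)); [|slra pi0|slra pi0|slra pi0|].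
    by congr J; apply/funext => t; rewrite /G /g /= !add0r mulrC -/d.
  move=> t tt out; rewrite /G g0 ?mul0r//= add0r.
  by have := sin_le0_out tt out; nra.
rewrite e2 //=; last 3 first.
- by move=> z hz; rewrite /g kern_out ?mulr0// /d; apply: le_trans hz; rewrite le_eqVlt; apply/orP; left; apply/eqP; field.
- by rewrite /B; slra pi0.
- by rewrite (gtr0_norm h0) /B; have := normr_ge0 x0; slra pi0.
rewrite -(@J_fubini _ (fun z : R * R => g (x0 + z.1 * cos z.2, h + z.1 * sin z.2) * z.1)); last by cts.
congr J; apply/funext => q; rewrite -JZ; last by cts.
congr J; apply/funext => t; rewrite /g /= (sqr_norm_sum q x0 h t) -/d; ring.
Qed.

Lemma kern_average (f : R * R -> R) (x0 h a eps : R) : continuous f -> 0 < h -> 3 / 2 * h <= a ->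
  (forall q, 0 <= q <= h / 2 ->
    `|J (fun t => f (x0 + q * cos t, h + q * sin t)) (- (pi / 4)) (7 * (pi / 4)) - 2 * pi * f (x0, h)| <= eps) ->
  `|J (fun r => J (fun t => r * (f (x0 + r * cos t, r * sin t) *
     kern (h ^+ 2 / 4) ((x0 + r * cos t - x0) ^+ 2 + (r * sin t - h) ^+ 2))) 0 pi) 0 a
    - 2 * pi * f (x0, h)| <= eps.
Proof.
move=> cf h0 ha H; rewrite half_disc_kern//.
have h20 : 0 < h / 2 by lra.
have d0 : 0 < h ^+ 2 / 4 by rewrite divr_gt0 ?exprn_gt0.
have mass : J (fun q => kern (h ^+ 2 / 4) (q ^+ 2) * q) 0 (h / 2) = 1.
  by have := kern_mass h20; rewrite (_ : (h / 2) ^+ 2 = h ^+ 2 / 4)//; field.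
pose k (q : R) := kern (h ^+ 2 / 4) (q ^+ 2) * q.
have ck : continuous k by have ck := @kern_cts R (h ^+ 2 / 4); rewrite /k; cts.
pose m (q : R) := J (fun t => f (x0 + q * cos t, h + q * sin t)) (- (pi / 4)) (7 * (pi / 4)).
have cm : continuous m.
  by apply: (@J_param_cts _ _ (fun z : R * R => f (x0 + z.1 * cos z.2, h + z.1 * sin z.2))); cts.
change (`|J (fun q => k q * m q) 0 (h / 2) - 2 * pi * f (x0, h)| <= eps).
rewrite -[X in _ - X](_ : J (fun q => 2 * pi * f (x0, h) * k q) 0 (h / 2) = _); last first.
  by rewrite JZ// mass mulr1.
rewrite -JB; [|by cts|by cts].
have -> : eps = J (fun q => eps * k q) 0 (h / 2) by rewrite JZ// mass mulr1.
apply: J_abs_le; [exact: ltW|by cts|by cts|move=> q qq].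
have k0 : 0 <= k q by rewrite mulr_ge0 ?kern_ge0//; lra.
have -> : k q * m q - 2 * pi * f (x0, h) * k q = (m q - 2 * pi * f (x0, h)) * k q by ring.
by rewrite normrM (ger0_norm k0); apply: ler_wpM2r => //; exact: H.
Qed.

End KernelMass.

Section ErrorTerm.
Context {R : realType}.

Lemma young (k x y : R) : 0 < k -> x * y <= k * x ^+ 2 + k^-1 * y ^+ 2 / 4.
Proof.
move=> k0; have kk : k * k^-1 = 1 by rewrite divff// gt_eqF.
have : 0 <= k * (x - k^-1 * y / 2) ^+ 2 by rewrite mulr_ge0 ?sqr_ge0// ltW.
have -> : k * (x - k^-1 * y / 2) ^+ 2 = k * x ^+ 2 - (k * k^-1) * (x * y) + (k * k^-1) * (k^-1 * y ^+ 2 / 4).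
  by field; rewrite gt_eqF.
by rewrite kk; lra.
Qed.

(** The quadratic part carries [V], which a Hardy inequality will control with weight $1/r$, and
    uses only [r * w <= 1 / 2]. The part with [b] has no such factor; it is split with a free [mu]
    against [r * w ^+ 2], whose integral will be bounded uniformly in the height. *)
Lemma err_pointwise (k b a3 V a1 a2 a4 r mu w Gx Gy : R) : 0 <= k -> 0 < r -> 0 < mu -> 0 < w -> r * w <= 1 / 2 ->
  `|Gx| <= k * w -> `|Gy| <= k * w ->
  `|r * (2 * V * (a1 * Gy - a2 * Gx) - b * (Gx * a2 + Gy * a4))| <=
    k * (V ^+ 2 * r^-1 + r * (a1 ^+ 2 + a2 ^+ 2 + a3 ^+ 2 + a4 ^+ 2)) +
    k * `|b| * (mu * (r * w ^+ 2) + (2 * mu)^-1 * (r * (a1 ^+ 2 + a2 ^+ 2 + a3 ^+ 2 + a4 ^+ 2))).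
Proof.
move=> k0 r0 mu0 w00 rw2 G1 G2.
have ri0 : 0 < r^-1 by rewrite invr_gt0.
have mi0 : 0 < mu^-1 by rewrite invr_gt0.
have a32 := sqr_ge0 a3; have a12 := sqr_ge0 a1; have a22 := sqr_ge0 a2; have a42 := sqr_ge0 a4.
rewrite normrM (gtr0_norm r0).
have T1 : `|2 * V * (a1 * Gy - a2 * Gx)| <= 2 * `|V| * ((`|a1| + `|a2|) * (k * w)).
  rewrite normrM [`|2 * V|]normrM ger0_norm//; apply: ler_wpM2l; first by rewrite mulr_ge0.
  apply: le_trans (ler_normB _ _) _; rewrite !normrM mulrDl.
  by apply: lerD; apply: ler_wpM2l.
have T2 : `|b * (Gx * a2 + Gy * a4)| <= `|b| * ((`|a2| + `|a4|) * (k * w)).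
  rewrite normrM; apply: ler_wpM2l => //.
  apply: le_trans (ler_normD _ _) _; rewrite !normrM mulrDl.
  by rewrite [`|Gx| * _]mulrC [`|Gy| * _]mulrC; apply: lerD; apply: ler_wpM2l.
apply: (@le_trans _ _ (r * (2 * `|V| * ((`|a1| + `|a2|) * (k * w)) + `|b| * ((`|a2| + `|a4|) * (k * w))))).
  apply: ler_wpM2l; first exact: ltW.
  by apply: le_trans (ler_normB _ _) _; apply: lerD.
have b0 := normr_ge0 b.
rewrite -(real_normK (num_real a1)) -(real_normK (num_real a2)) -(real_normK (num_real a4)) -(real_normK (num_real V)).
have := normr_ge0 V; have := normr_ge0 a1; have := normr_ge0 a2; have := normr_ge0 a4.
move: `|V| `|a1| `|a2| `|a4| `|b| b0 => {T1 T2 G1 G2 a12 a22 a42 a1 a2 a4 V b Gx Gy} V a1 a2 a4 b b0 n4 n2 n1 nV.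
have a12 := sqr_ge0 a1; have a22 := sqr_ge0 a2; have a42 := sqr_ge0 a4.
rewrite mulrDr; apply: lerD.
  apply: (@le_trans _ _ (k * (V * (a1 + a2)))).
    have -> : r * (2 * V * ((a1 + a2) * (k * w))) = k * (V * (a1 + a2)) * (2 * (r * w)) by ring.
    by rewrite ler_piMr ?mulr_ge0 ?addr_ge0//; lra.
  apply: ler_wpM2l => //.
  have := young V (a1 + a2) ri0; rewrite invrK.
  have : r * (a1 + a2) ^+ 2 <= r * (4 * (a1 ^+ 2 + a2 ^+ 2 + a3 ^+ 2 + a4 ^+ 2)).
    by apply: ler_wpM2l; [exact: ltW|have := sqr_ge0 (a1 - a2); lra].
  lra.
have -> : r * (b * ((a2 + a4) * (k * w))) = k * b * (r * (w * (a2 + a4))) by ring.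
have -> : (2 * mu)^-1 = mu^-1 / 2 by rewrite invfM mulrC.
have -> : mu * (r * w ^+ 2) + mu^-1 / 2 * (r * (a1 ^+ 2 + a2 ^+ 2 + a3 ^+ 2 + a4 ^+ 2)) =
   r * (mu * w ^+ 2 + mu^-1 * (a1 ^+ 2 + a2 ^+ 2 + a3 ^+ 2 + a4 ^+ 2) / 2) by ring.
apply: ler_wpM2l; first by rewrite mulr_ge0.
apply: ler_wpM2l; first exact: ltW.
have := young w (a2 + a4) mu0.
have : mu^-1 * (a2 + a4) ^+ 2 <= mu^-1 * (2 * (a1 ^+ 2 + a2 ^+ 2 + a3 ^+ 2 + a4 ^+ 2)).
  by apply: ler_wpM2l; [exact: ltW|have := sqr_ge0 (a2 - a4); lra].
lra.
Qed.

End ErrorTerm.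

(** * The Green representation near the axis *)

Section NearBoundary.
Context {R : realType} (b r1 : R) (u ux uy v vx vy o ox oy p px py : R * R -> R).
Context (F : plane_flow b r1 u ux uy v vx vy o ox oy p px py).
Let cux := C1_cx (pf_u F).
Let cuy := C1_cy (pf_u F).
Let cvx := C1_cx (pf_v F).
Let cvy := C1_cy (pf_v F).
Let cox := C1_cx (pf_o F).
Let coy := C1_cy (pf_o F).
Let cpx := C1_cx (pf_p F).
Let cpy := C1_cy (pf_p F).
Let cu := C1_cts (pf_u F).
Let cv := C1_cts (pf_v F).
Let co := C1_cts (pf_o F).
Let cp := C1_cts (pf_p F).
Local Notation e := (plane_energy ux uy vx vy).
Let ce : continuous e := plane_energy_cts F.
Let e0 : forall z, 0 <= e z := plane_energy_ge0 ux uy vx vy.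
Let pi0 : 0 < pi :> R := @pi_gt0 R.
Let pi4 := @pi_lt4 R.
Local Notation pt x r t := (x + r * cos t, r * sin t).
Local Notation ring_energy x r := (J (fun t => r * e (pt x r t)) 0 pi).

(** [v] vanishes where the arc starts, so it is the integral of its angular derivative, which is at
    most [r] times its gradient. *)
Lemma half_circle_hardy (x r : R) : 0 <= r -> v (x + r, 0) = 0 ->
  J (fun t => v (pt x r t) ^+ 2) 0 pi <= pi ^+ 2 * (r * ring_energy x r).
Proof.
move=> r0 v0; have pp := pi0.
have Cv := C1_polar (x, 0) (pf_v F).
pose vt (t : R) := r * (- vx (pt x r t) * sin t + vy (pt x r t) * cos t).
have cvt : continuous vt by rewrite /vt; cts.
have dvt t : der t (fun t => v (pt x r t)) (vt t).
  have := C1_dy Cv r t; rewrite /vt /= add0r.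
  by rewrite (_ : (fun t0 => _) = fun t0 => v (pt x r t0))//; apply/funext => t'; rewrite add0r.
have cvt2 : continuous (fun t => vt t ^+ 2) by cts.
have vb t : 0 <= t <= pi -> v (pt x r t) ^+ 2 <= pi * J (fun t => vt t ^+ 2) 0 pi.
  move=> /andP[t0 tp].
  have -> : v (pt x r t) = J vt 0 t.
    by rewrite (J_ftc _ _ cvt dvt) cos0 sin0 mulr1 mulr0 v0 subr0.
  apply: le_trans (sqr_J_le t0 cvt) _; rewrite subr0; apply: ler_pM => //.
    by apply: J_ge0 => // *; exact: sqr_ge0.
  by apply: J_sub_itv => // *; exact: sqr_ge0.
apply: (@le_trans _ _ (J (fun=> pi * J (fun t => vt t ^+ 2) 0 pi) 0 pi)).
  by apply: J_le; [exact: ltW|cts|cts|exact: vb].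
rewrite J_cst subr0 [leLHS]mulrC [leLHS]mulrA -expr2; apply: ler_wpM2l; first exact: sqr_ge0.
rewrite -JZ; last by cts.
apply: J_le => //; [exact: ltW|cts|move=> t _].
have cs := cos2Dsin2 t; rewrite /vt /plane_energy exprMn mulrA -expr2.
apply: ler_wpM2l; first exact: sqr_ge0.
set a := vx _; set a' := vy _.
have := sqr_ge0 (a * cos t + a' * sin t); have := sqr_ge0 (ux (pt x r t)); have := sqr_ge0 (uy (pt x r t)).
have : a ^+ 2 + a' ^+ 2 = (a ^+ 2 + a' ^+ 2) * (cos t ^+ 2 + sin t ^+ 2) by rewrite cs mulr1.
lra.
Qed.

Section Estimate.
Context (x0 h a R0 c0 mu sg eps k : R) (k0 : 0 <= k).
Hypothesis Hk : forall z, 0 <= z.2 ->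
  `|grx x0 h z| <= k * (h / (h ^+ 2 + ((z.1 - x0) ^+ 2 + z.2 ^+ 2))) /\
  `|gry x0 h z| <= k * (h / (h ^+ 2 + ((z.1 - x0) ^+ 2 + z.2 ^+ 2))).
Context (h0 : 0 < h) (ha : 3 / 2 * h <= a) (r1R0 : r1 <= R0) (xfar : R0 + a <= `|x0|).
Context (mu0 : 0 < mu) (eps0 : 0 <= eps).
Hypothesis Een : J (fun r => ring_energy x0 r) 0 a <= eps.
Hypothesis Hb : forall x, R0 <= `|x| -> `|p (x, 0) - c0| <= sg.
Hypothesis Hm : forall q, 0 <= q <= h / 2 ->
    `|J (fun t => p (x0 + q * cos t, h + q * sin t)) (- (pi / 4)) (7 * (pi / 4)) - 2 * pi * p (x0, h)| <= eps.

Let f z := p z - c0.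
(** The partner of [f] in the field below. With [o] alone the divergence would contain [u]
    undifferentiated; subtracting [u v] cancels it by incompressibility and leaves [v], which is
    zero on the axis. *)
Let g z := o z - u z * v z.
Let gxx := grx x0 h.
Let gyy := gry x0 h.

(** The divergence theorem for $f \nabla G + g \nabla^\perp G$ on the half disc of radius [a]. The
    kernel term is $2\pi f(x_0, h)$ up to [eps]. On the axis [v] and [o] vanish, so only $f G_y$
    remains, with $G_y$ bounded by the derivative of an arctangent; on the arc [a * w a <= 1 / 2].
    No constant depends on [h]. *)
Lemma near_boundary :
  `|2 * pi * f (x0, h)| <= eps + 4 * k * sg + k * (pi ^+ 2 + 1 + `|b| / (2 * mu)) * eps + k * `|b| * mu * pi
   + k * J (fun t => `|f (pt x0 a t)| + `|o (pt x0 a t)| + `|u (pt x0 a t) * v (pt x0 a t)|) 0 pi.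
Proof.
have pp := pi0; have hh := h0; have muu := mu0; have haa := ha.
have kk := k0; have a0 : 0 < a by slra gyy.
have r10 := r1_gt0 F.
have rr := r1R0; have R00 : 0 < R0 by slra gyy.
have Cf : C1 f px py.
  by rewrite /f; apply: C1_eq (C1_add (pf_p F) (_ : C1 (fun=> - c0) (fun=> 0) (fun=> 0))) _ _ => [|z|z];
    rewrite ?addr0//; split; [cts|cts| |] => x y; exact: der_cst.
have Cgx := C1_grx x0 h0; have Cgy := C1_gry x0 h0.
have Cg := C1_add (pf_o F) (C1_opp (C1_mul (pf_u F) (pf_v F))).
have C1Q := C1_add (C1_mul Cf Cgx) (C1_opp (C1_mul Cg Cgy)).
have C2Q := C1_add (C1_mul Cf Cgy) (C1_mul Cg Cgx).
pose Q1 (z : R * R) := f z * gxx z - g z * gyy z.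
pose Q2 (z : R * R) := f z * gyy z + g z * gxx z.
have cgx := C1_cts Cgx; have cgy := C1_cts Cgy; have cf := C1_cts Cf.
rewrite -/gxx in cgx; rewrite -/gyy in cgy.
have cQ1 : continuous Q1 := C1_cts C1Q.
have cQ2 : continuous Q2 := C1_cts C2Q.
(* The divergence of [(Q1, Q2)] without its kernel term: [px], [py] and [vy] are eliminated by the
   equations, and the derivatives of [o] cancel. *)
pose er z := 2 * v z * (ux z * gyy z - uy z * gxx z) - b * (gxx z * uy z + gyy z * vy z).
have cer : continuous er by rewrite /er; cts.
pose K (z : R * R) := f z * kern (h ^+ 2 / 4) ((z.1 - x0) ^+ 2 + (z.2 - h) ^+ 2).
have ckern := @kern_cts R (h ^+ 2 / 4).
have cK : continuous K by rewrite /K; cts.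
have far r t : 0 <= r <= a -> 0 <= t <= pi ->
   0 <= r * sin t /\ r1 ^+ 2 <= (x0 + r * cos t) ^+ 2 + (r * sin t) ^+ 2.
  move=> ra tt; have hx := xfar.
  have hf := @half_disc_far _ x0 r t r1 ltac:(slra gyy) (ltW r10) ltac:(slra gyy) tt.
  by move: hf; rewrite add0r.
pose w (r : R) := h / (h ^+ 2 + r ^+ 2).
have w0 (r : R) : 0 < w r by rewrite /w divr_gt0 ?hatan_den.
have rw (r : R) : 0 <= r -> r * (w r) <= 1 / 2.
  by move=> r0; rewrite /w mulrA ler_pdivrMr ?hatan_den//; have := sqr_ge0 (h - r); slra gyy.
have gb r t : 0 <= r <= a -> 0 <= t <= pi ->
   `|gxx (pt x0 r t)| <= k * (w r) /\ `|gyy (pt x0 r t)| <= k * (w r).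
  move=> ra tt; have [y0 _] := far r t ra tt.
  have := @Hk (pt x0 r t) y0.
  rewrite (_ : ((pt x0 r t).1 - x0) ^+ 2 + (pt x0 r t).2 ^+ 2 = r ^+ 2) //=.
  by have := sqr_norm_sum r x0 0 t; rewrite add0r subr0.
have z0pi : 0 <= (0 : R) <= pi by rewrite lexx ltW.
have zpipi : 0 <= (pi : R) <= pi by rewrite lexx andbT ltW.
have ov r : 0 <= r <= a -> [/\ v (x0 + r, 0) = 0, o (x0 + r, 0) = 0, v (x0 - r, 0) = 0 & o (x0 - r, 0) = 0].
  move=> ra; have [_] := far r 0 ra z0pi; have [_] := far r pi ra zpipi.
  rewrite cos0 sin0 cospi sinpi mulr1 mulrN1 !mulr0 !expr0n !addr0 => q1 q2.
  by rewrite !(pf_v0 F)// !(pf_o0 F).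
have DT : J (fun r => J (fun t => r * (K (pt x0 r t) + er (pt x0 r t))) 0 pi) 0 a =
    J (fun t => a * (Q1 (pt x0 a t) * cos t + Q2 (pt x0 a t) * sin t)) 0 pi
    - J (fun r => Q2 (x0 - r, 0) + Q2 (x0 + r, 0)) 0 a.
  apply: (half_disc_divergence_on C1Q C2Q (k := fun z => K z + er z)); [by cts|exact: ltW|move=> r t ra tt].
  have [y0 q] := far r t ra tt; symmetry.
  have lap := @gr_laplacian _ x0 h h0 (pt x0 r t) y0.
  have vyE : vy (pt x0 r t) = - ux (pt x0 r t) by have := pf_div F y0 q; slra gyy.
  rewrite /K -lap /er /g (pf_px F y0 q) (pf_py F y0 q) vyE /gxx /gyy; ring.
have err r t : 0 < r <= a -> 0 <= t <= pi -> `|r * er (pt x0 r t)| <=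
    k * (v (pt x0 r t) ^+ 2 * r^-1 + r * e (pt x0 r t)) +
    k * `|b| * (mu * (r * (w r) ^+ 2) + (2 * mu)^-1 * (r * e (pt x0 r t))).
  move=> /andP[r0 ra] tt; have [G1 G2] := gb r t ltac:(slra gyy) tt.
  exact: (err_pointwise b (vx (pt x0 r t)) _ _ _ _ k0 r0 mu0 (w0 r) (rw r (ltW r0)) G1 G2).
have cw : continuous w := hatan_dcts h0.
have cE : continuous (fun r : R => ring_energy x0 r).
  by apply: (@J_param_cts _ _ (fun z : R * R => z.1 * e (pt x0 z.1 z.2))); cts.
have cer2 : continuous (fun r : R => J (fun t => r * er (pt x0 r t)) 0 pi).
  by apply: (@J_param_cts _ _ (fun z : R * R => z.1 * er (pt x0 z.1 z.2))); cts.
have cK2 : continuous (fun r : R => J (fun t => r * K (pt x0 r t)) 0 pi).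
  by apply: (@J_param_cts _ _ (fun z : R * R => z.1 * K (pt x0 z.1 z.2))); cts.
have wint : J (fun r => r * (w r) ^+ 2) 0 a <= 1 / 2.
  rewrite (@J_ftc _ _ (fun r => - (h ^+ 2 / 2) * (h ^+ 2 + r ^+ 2)^-1)); [|by cts|].
    rewrite expr0n addr0 mulNr mulNr opprK (_ : h ^+ 2 / 2 / h ^+ 2 = 1 / 2).
      by have : 0 <= h ^+ 2 / 2 * (h ^+ 2 + a ^+ 2)^-1; [rewrite mulr_ge0 ?divr_ge0 ?sqr_ge0// invr_ge0 ltW ?hatan_den|slra gyy].
    by field; rewrite gt_eqF.
  move=> r; have dn : h ^+ 2 + r ^+ 2 != 0 by rewrite gt_eqF// hatan_den.
  have dh : der r (fun r => h ^+ 2 + r ^+ 2) (2 * r) by der_by fail; ring.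
  have dV := @is_deriveV R (fun y => h ^+ 2 + y ^+ 2) r (2 * r) 1 dn dh.
  refine (der_eq (derM (der_cst _ _) dV) _); rewrite /w /GRing.scale /=; field.
  by rewrite dn.
have b2 : 0 <= `|b| / (2 * mu) by apply: divr_ge0 => //; slra gyy.
have bmp : 0 <= k * `|b| * mu * pi.
  by apply: mulr_ge0; [apply: mulr_ge0; [apply: mulr_ge0 => //|]|]; exact: ltW.
have pi2 := sqr_ge0 (pi : R).
have Jerr : `|J (fun r => J (fun t => r * er (pt x0 r t)) 0 pi) 0 a| <=
   k * (pi ^+ 2 + 1 + `|b| / (2 * mu)) * eps + k * `|b| * mu * pi.
  apply: le_trans (J_abs (ltW a0) cer2) _.
  apply: (@le_trans _ _ (J (fun r => k * (pi ^+ 2 + 1 + `|b| / (2 * mu)) * ring_energy x0 r +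
     k * `|b| * mu * pi * (r * (w r) ^+ 2)) 0 a)); last first.
    rewrite JD; [|by cts|by cts]; rewrite !JZ//; last by cts.
    apply: lerD; first by apply: ler_wpM2l; [apply: mulr_ge0 => //; slra gyy|exact: Een].
    have : k * `|b| * mu * pi * J (fun r => r * w r ^+ 2) 0 a <= k * `|b| * mu * pi * 1.
      by apply: ler_wpM2l; slra gyy.
    by rewrite mulr1.
  apply: J_le_open; [exact: ltW|exact: cts_norm|by cts|move=> r r0 ra].
  have ra' : 0 < r <= a by rewrite r0.
  pose c1 := k * `|b| * (mu * (r * (w r) ^+ 2)).
  pose c2 := k + k * `|b| * (2 * mu)^-1.
  apply: (@le_trans _ _ (J (fun t => k * r^-1 * v (pt x0 r t) ^+ 2 + (c2 * (r * e (pt x0 r t)) + c1)) 0 pi)).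
    apply: J_abs_le; [exact: ltW|by cts|by cts|move=> t tt].
    by apply: le_trans (err r t ra' tt) _; rewrite le_eqVlt; apply/orP; left; apply/eqP; rewrite /c1 /c2; ring.
  rewrite JD; [|by cts|by cts]; rewrite JD; [|by cts|by cts].
  rewrite (@JZ _ (fun t => v (pt x0 r t) ^+ 2)); [|by cts].
  rewrite (@JZ _ (fun t => r * e (pt x0 r t)) c2); [|by cts].
  rewrite J_cst subr0.
  have [vz _ _ _] := ov r ltac:(slra gyy).
  have := half_circle_hardy (ltW r0) vz.
  set EE := ring_energy x0 r; set VV := J _ 0 pi => hv.
  have : k * r^-1 * VV <= k * r^-1 * (pi ^+ 2 * (r * EE)).
    have : 0 < r^-1 by rewrite invr_gt0.
    by move=> ri; apply: ler_wpM2l; [apply: mulr_ge0 => //; exact: ltW|exact: hv].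
  have -> : k * r^-1 * (pi ^+ 2 * (r * EE)) = k * pi ^+ 2 * EE by field; rewrite gt_eqF.
  by rewrite /c1 /c2; slra gyy.
have sg0 : 0 <= sg by apply: le_trans (Hb (x := x0) _) => //; have := xfar; slra gyy.
have Jbd : `|J (fun r => Q2 (x0 - r, 0) + Q2 (x0 + r, 0)) 0 a| <= 4 * k * sg.
  apply: (@le_trans _ _ (J (fun r => 2 * k * sg * (w r)) 0 a)).
    apply: J_abs_le; [exact: ltW|by cts|by cts|move=> r ra].
    have [v1 o1 v2 o2] := ov r ra; have [_] := gb r 0 ra z0pi; have [_] := gb r pi ra zpipi.
    rewrite cos0 sin0 cospi sinpi mulr1 mulrN1 !mulr0.
    move=> g2 g1.
    have xf := xfar.
    have f1 : `|f (x0 + r, 0)| <= sg.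
      by apply: Hb; have := ler_normB (x0 + r) r; rewrite addrK (ger0_norm (x := r)); move: xf ra; slra gyy.
    have f2 : `|f (x0 - r, 0)| <= sg.
      by apply: Hb; have := ler_normD (x0 - r) r; rewrite subrK (ger0_norm (x := r)); move: xf ra; slra gyy.
    rewrite /Q2 /g v1 v2 o1 o2 !mulr0 !subrr !mul0r !addr0.
    apply: le_trans (ler_normD _ _) _; rewrite !normrM.
    have k1 : `|f (x0 - r, 0)| * `|gyy (x0 - r, 0)| <= sg * (k * w r) by apply: ler_pM.
    have k2 : `|f (x0 + r, 0)| * `|gyy (x0 + r, 0)| <= sg * (k * w r) by apply: ler_pM.
    slra gyy.
  rewrite JZ// (J_ftc _ _ cw (fun x => hatan_der x h0)) hatan0 subr0.
  have := @hatan_bound R h a; rewrite ler_norml => /andP[_ hb].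
  by have := ler_wpM2l (mulr_ge0 k0 sg0) hb; slra gyy.
have Jout : `|J (fun t => a * (Q1 (pt x0 a t) * cos t + Q2 (pt x0 a t) * sin t)) 0 pi| <=
   k * J (fun t => `|f (pt x0 a t)| + `|o (pt x0 a t)| + `|u (pt x0 a t) * v (pt x0 a t)|) 0 pi.
  rewrite -JZ; last by cts.
  apply: J_abs_le; [exact: ltW|by cts|by cts|move=> t tt].
  have [g1 g2] := gb a t ltac:(slra gyy) tt; have rwa := rw a (ltW a0); have wa := w0 a.
  rewrite /Q1 /Q2 /g.
  set f1 := f _; set o1 := o _; set uv := u _ * v _; set Gx := gxx _ in g1 *; set Gy := gyy _ in g2 *; clearbody Gx Gy.
  rewrite normrM (gtr0_norm a0).
  set S := `|f1| + `|o1| + `|uv|.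
  have ouv : `|o1 - uv| <= `|o1| + `|uv| by exact: ler_normB.
  have S0 : 0 <= S by rewrite !addr_ge0.
  have wk : 0 <= k * w a by apply: mulr_ge0 => //; exact: ltW.
  have q1 : `|f1 * Gx - (o1 - uv) * Gy| <= S * (k * w a).
    apply: le_trans (ler_normB _ _) _; rewrite !normrM.
    have k1 : `|f1| * `|Gx| <= `|f1| * (k * w a) by apply: ler_wpM2l.
    have k2 : `|o1 - uv| * `|Gy| <= (`|o1| + `|uv|) * (k * w a) by apply: ler_pM.
    by rewrite /S; slra gyy.
  have q2 : `|f1 * Gy + (o1 - uv) * Gx| <= S * (k * w a).
    apply: le_trans (ler_normD _ _) _; rewrite !normrM.
    have k1 : `|f1| * `|Gy| <= `|f1| * (k * w a) by apply: ler_wpM2l.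
    have k2 : `|o1 - uv| * `|Gx| <= (`|o1| + `|uv|) * (k * w a) by apply: ler_pM.
    by rewrite /S; slra gyy.
  have cN : `|cos t| <= 1 by rewrite ler_norml cos_geN1 cos_le1.
  have sN : `|sin t| <= 1 by rewrite ler_norml sin_geN1 sin_le1.
  apply: (@le_trans _ _ (a * (S * (k * w a) * 1 + S * (k * w a) * 1))).
    apply: ler_wpM2l; first exact: ltW.
    apply: le_trans (ler_normD _ _) _; rewrite [`|_ * cos t|]normrM [`|_ * sin t|]normrM.
    by apply: lerD; apply: ler_pM.
  have -> : a * (S * (k * w a) * 1 + S * (k * w a) * 1) = k * S * (2 * (a * w a)) by ring.
  have : k * S * (2 * (a * w a)) <= k * S * 1 by apply: ler_wpM2l; [exact: mulr_ge0|move: rwa; slra gyy].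
  by slra gyy.
have mass := @kern_average _ f x0 h a eps cf h0 ha.
have {}mass : `|J (fun r => J (fun t => r * K (pt x0 r t)) 0 pi) 0 a - 2 * pi * f (x0, h)| <= eps.
  apply: mass => q qq; have := Hm qq.
  rewrite /f JB; [|by cts|by cts]; rewrite J_cst.
  by congr (`|_| <= _); field.
have {}DT : J (fun r => J (fun t => r * K (pt x0 r t)) 0 pi) 0 a + J (fun r => J (fun t => r * er (pt x0 r t)) 0 pi) 0 a =
    J (fun t => a * (Q1 (pt x0 a t) * cos t + Q2 (pt x0 a t) * sin t)) 0 pi
    - J (fun r => Q2 (x0 - r, 0) + Q2 (x0 + r, 0)) 0 a.
  rewrite -DT -JD//; congr J; apply/funext => r; rewrite -JD; [|by cts|by cts].
  by congr J; apply/funext => t; ring.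
move: mass DT Jout Jbd Jerr; set A1 := J _ 0 a; set A2 := J _ 0 a; set A3 := J _ 0 pi; set A4 := J _ 0 a.
set A5 := J _ 0 pi; move=> mass DT Jout Jbd Jerr.
move: mass Jout Jbd Jerr; rewrite !ler_norml.
move=> /andP[m1 m2] /andP[m3 m4] /andP[m5 m6] /andP[m7 m8].
by apply/andP; split; move: DT m1 m2 m3 m4 m5 m6 m7 m8; slra gyy.
Qed.
End Estimate.
End NearBoundary.

(** * Uniform convergence of the pressure *)

Section UniformLimit.
Context {R : realType} (b r1 : R) (u ux uy v vx vy o ox oy p px py : R * R -> R).
Context (F : plane_flow b r1 u ux uy v vx vy o ox oy p px py).
Let cu := C1_cts (pf_u F).
Let cv := C1_cts (pf_v F).
Let co := C1_cts (pf_o F).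
Let cp := C1_cts (pf_p F).
Local Notation e := (plane_energy ux uy vx vy).
Let ce : continuous e := plane_energy_cts F.
Let e0 : forall z, 0 <= e z := plane_energy_ge0 ux uy vx vy.
Let pi0 : 0 < pi :> R := @pi_gt0 R.
Local Notation pt x r t := (x + r * cos t, r * sin t).
Local Notation blk c s := (pressure_block (fun z => p (lp z)) c s).

(** The height is at least an eighth of the modulus, so a disc of radius [r / 16] about the point
    stays well inside. The average over its circles, with weight [q] in the radius, is a disc mean
    that [ball_block] bounds by a block. *)
Lemma interior_pressure (c eps : R) : 0 < eps -> exists R0, 0 < R0 /\ forall x y s,
  x ^+ 2 + y ^+ 2 = expR s ^+ 2 -> expR s <= 8 * y -> R0 <= expR s ->
  `|p (x, y) - c| <= 512 * expR 4 * blk c s + eps.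
Proof.
move=> eps0; have [R0 [r1R0 HR0]] := disc_pressure F eps0.
have r10 := r1_gt0 F; have pp := pi0.
exists (2 * R0); split; first by lra.
move=> x y s; set r := expR s => rE ry R0r.
have r0 : 0 < r by exact: expR_gt0.
pose a := r / 16; have a0 : 0 < a by rewrite /a; lra.
have ar : a <= r / 16 by [].
pose N q := J (fun t => q * `|p (x + q * cos t, y + q * sin t) - c|) (- (pi / 4)) (7 * (pi / 4)).
have cN : continuous N.
  by apply: (@J_param_cts _ _ (fun z : R * R => z.1 * `|p (x + z.1 * cos z.2, y + z.1 * sin z.2) - c|)); cts.
have ay : a <= y by rewrite /a; lra.
have key q : 0 <= q <= a -> q * (2 * pi * `|p (x, y) - c|) <= N q + q * eps.
  move=> qa; have q0 : 0 <= q by lra.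
  have := HR0 (x, y) a q qa ay; rewrite /= rE => h.
  have {}h : `|J (fun t => p (x + q * cos t, y + q * sin t)) (- (pi / 4)) (7 * (pi / 4)) - 2 * pi * p (x, y)| <= eps.
    by apply: h; rewrite ler_sqr ?nnegrE; slra pi0.
  have cc : continuous (fun t : R => p (x + q * cos t, y + q * sin t)) by cts.
  have -> : N q = q * J (fun t => `|p (x + q * cos t, y + q * sin t) - c|) (- (pi / 4)) (7 * (pi / 4)).
    by rewrite /N JZ//; cts.
  rewrite -mulrDr; apply: ler_wpM2l => //.
  rewrite -[X in X * _](gtr0_norm (x := 2 * pi)) -?normrM; last by lra.
  have ang : - (pi / 4) <= 7 * (pi / 4) :> R by lra.
  have h2 : `|J (fun t => p (x + q * cos t, y + q * sin t) - c) (- (pi / 4)) (7 * (pi / 4))| <=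
      J (fun t => `|p (x + q * cos t, y + q * sin t) - c|) (- (pi / 4)) (7 * (pi / 4)).
    by apply: J_abs => //; cts.
  move: h h2; rewrite JB//; last by cts.
  rewrite J_cst; set A := J _ _ _; set B := J _ _ _ => h h2.
  have -> : 2 * pi * (p (x, y) - c) = (A - c * (7 * (pi / 4) - - (pi / 4))) - (A - 2 * pi * p (x, y)) by field.
  by apply: le_trans (ler_normB _ _) _; apply: lerD.
have cP : continuous (fun z : R * R => `|p z - c|) by cts.
have bb : J N 0 a <= 2 * expR (s + 2) ^+ 2 * blk c s.
  apply: (@ball_block _ (fun z => `|p z - c|) s (x, y) 0 a _ _ cP) => //=; rewrite -/r; try slra pi0.
  move=> q t qa _; have h := sin_geN1 t.
  have : q * -1 <= q * sin t by apply: ler_wpM2l => //; lra.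
  lra.
have fin : J (fun q => q * (2 * pi * `|p (x, y) - c|)) 0 a <= J N 0 a + J (fun q => q * eps) 0 a.
  rewrite -JD//; last by cts.
  by apply: J_le; [lra|cts|cts|exact: key].
have Jq k : J (fun q => q * k) 0 a = a ^+ 2 / 2 * k.
  rewrite (@J_ftc _ _ (fun q => q ^+ 2 / 2 * k)); [by field|by cts|move=> q].
  by der_by fail; field.
move: fin; rewrite !Jq.
have -> : a ^+ 2 / 2 = r ^+ 2 / 512 by rewrite /a; field.
have A2 : expR (s + 2) ^+ 2 = r ^+ 2 * expR 4.
  by rewrite expr2 -expRD /r expr2 -!expRD; congr expR; ring.
rewrite A2 in bb; move: bb; set Q := `|_ - c|; set B := blk c s => bb fin.
have r2 : 0 < r ^+ 2 by rewrite exprn_gt0.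
have Q0 : 0 <= Q by exact: normr_ge0.
have : r ^+ 2 * (2 * pi * Q / 512) <= r ^+ 2 * (2 * expR 4 * B + eps / 512) by slra pi0.
rewrite (ler_pM2l r2) => h.
have p2 := @pi_ge2 R.
have : 2 * (2 * Q) <= 2 * (pi * Q) by apply: ler_wpM2l => //; apply: ler_wpM2r.
have : 0 <= expR 4 * B; last by slra pi0.
rewrite mulr_ge0 ?expR_ge0// /B /pressure_block; apply: J_ge0; first by slra pi0.
  by apply: (@J_param_cts _ _ (fun z : R * R => `|p (lp z) - c|)); rewrite /lp; cts.
by move=> z _; apply: J_ge0 => //; [exact: ltW|rewrite /lp /=; cts].
Qed.

(** Young's inequality puts [mu] on what is bounded but not small, the length of the arc and
    [u ^+ 2], and [mu^-1] on what the energy makes small: the vorticity and, by the Hardy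
    inequality, [v]. *)
Lemma outer_circle_bound (c mu x X a : R) : 0 < mu -> 0 < X -> `|x| = X -> 2 * r1 <= X -> X / 4 <= a <= X / 2 ->
  a * J (fun t => `|p (pt x a t) - c| + `|o (pt x a t)| + `|u (pt x a t) * v (pt x a t)|) 0 pi <=
  J (fun t => a * `|p (pt x a t) - c|) 0 pi + mu * pi * X + mu^-1 / 2 * J (fun t => a * e (pt x a t)) 0 pi
  + mu * J (fun t => a * u (pt x a t) ^+ 2) 0 pi
  + mu^-1 / 4 * (pi ^+ 2 * X ^+ 2) * J (fun t => a * e (pt x a t)) 0 pi.
Proof.
move=> mu0 X0 xX r1X aX; have pp := pi0; have r10 := r1_gt0 F.
have a0 : 0 <= a by lra.
have v0 : v (x + a, 0) = 0.
  apply: (pf_v0 F).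
  have z0 : 0 <= (0 : R) <= pi by rewrite lexx ltW.
  have ax : r1 + a <= `|x| by rewrite xX; lra.
  have [_] := @half_disc_far _ x a 0 r1 ltac:(lra) (ltW r10) ax z0.
  by rewrite cos0 sin0 mulr1 mulr0 add0r expr0n addr0.
have mi0 : 0 < mu^-1 by rewrite invr_gt0.
rewrite -JZ; last by cts.
apply: (@le_trans _ _ (J (fun t => a * `|p (pt x a t) - c| + (a * mu + (mu^-1 / 2 * (a * e (pt x a t)) +
     (mu * (a * u (pt x a t) ^+ 2) + mu^-1 / 4 * a * v (pt x a t) ^+ 2)))) 0 pi)).
  apply: J_le; [lra|by cts|by cts|move=> t tt].
  have [] := @half_disc_far _ x a t r1 a0 (ltW r10) _ tt; first by rewrite xX; lra.
  rewrite add0r => yy far.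
  have oE := pf_oE F yy far; set z := pt x a t in oE *.
  have o2 : o z ^+ 2 <= 2 * e z.
    rewrite oE /plane_energy; have := sqr_ge0 (vx z + uy z); have := sqr_ge0 (ux z).
    by have := sqr_ge0 (vy z); lra.
  have y1 := young 1 (`|o z|) mu0; have y2 := young (`|u z|) (`|v z|) mu0.
  rewrite !real_normK ?num_real// expr1n mulr1 mul1r in y1 y2.
  have o3 : mu^-1 * o z ^+ 2 <= mu^-1 * (2 * e z) by apply: ler_wpM2l => //; exact: ltW.
  rewrite normrM.
  have -> : a * `|p z - c| + (a * mu + (mu^-1 / 2 * (a * e z) + (mu * (a * u z ^+ 2) + mu^-1 / 4 * a * v z ^+ 2))) =
     a * (`|p z - c| + (mu + mu^-1 / 2 * e z) + (mu * u z ^+ 2 + mu^-1 / 4 * v z ^+ 2)) by ring.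
  apply: ler_wpM2l => //; lra.
rewrite JD; [|by cts|by cts]; rewrite JD; [|by cts|by cts].
rewrite JD; [|by cts|by cts]; rewrite JD; [|by cts|by cts].
rewrite (@JZ _ (fun t => a * e (pt x a t))); [|by cts].
rewrite (@JZ _ (fun t => a * u (pt x a t) ^+ 2)); [|by cts].
rewrite (@JZ _ (fun t => v (pt x a t) ^+ 2)); [|by cts].
rewrite J_cst subr0; set EEa := J (fun t => a * e (pt x a t)) 0 pi.
set Na := J (fun t => a * `|_|) 0 pi; set Ua := J (fun t => a * u _ ^+ 2) 0 pi.
have := half_circle_hardy F a0 v0; rewrite -/EEa; set VV := J _ 0 pi => hv.
have EE0 : 0 <= EEa.
  by apply: J_ge0; [exact: ltW|by cts|move=> t _; rewrite mulr_ge0].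
clearbody EEa Na Ua VV.
have h1 : mu^-1 / 4 * a * VV <= mu^-1 / 4 * (pi ^+ 2 * X ^+ 2) * EEa.
  have -> : mu^-1 / 4 * a * VV = mu^-1 / 4 * (a * VV) by ring.
  have -> : mu^-1 / 4 * (pi ^+ 2 * X ^+ 2) * EEa = mu^-1 / 4 * (pi ^+ 2 * (X ^+ 2 * EEa)) by ring.
  apply: ler_wpM2l; first by lra.
  apply: (@le_trans _ _ (a * (pi ^+ 2 * (a * EEa)))).
    exact: ler_wpM2l.
  have -> : a * (pi ^+ 2 * (a * EEa)) = pi ^+ 2 * (a ^+ 2 * EEa) by ring.
  apply: ler_wpM2l; first exact: sqr_ge0.
  by apply: ler_wpM2r => //; rewrite ler_sqr ?nnegrE; slra pi0.
have h2 : a * mu * pi <= mu * pi * X.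
  rewrite (_ : a * mu * pi = mu * pi * a); last by ring.
  by apply: ler_wpM2l; [rewrite mulr_ge0 ?ltW|lra].
lra.
Qed.

(** The arc term of [near_boundary] is averaged over radii in $[X/4, X/2]$, $X = |x|$. The condition
    [7 * y <= expR s] ensures $3y/2 \le X/4$, so all these half discs contain the regularised
    pole. *)
Lemma boundary_layer_pressure (c K S0 mu sg eps k : R) : 0 <= k ->
  (forall (x0 h : R) (z : R * R), 0 < h -> 0 <= z.2 ->
    `|grx x0 h z| <= k * (h / (h ^+ 2 + ((z.1 - x0) ^+ 2 + z.2 ^+ 2))) /\
    `|gry x0 h z| <= k * (h / (h ^+ 2 + ((z.1 - x0) ^+ 2 + z.2 ^+ 2)))) -> 0 < mu -> 0 < eps -> 0 <= K ->
  (forall s, S0 <= s -> J (fun t => u (lp (s, t)) ^+ 2) 0 pi <= K) ->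
  exists R0, 0 < R0 /\ forall R1 x y s, R0 <= R1 ->
  (forall x, R1 <= `|x| -> `|p (x, 0) - c| <= sg) ->
  `|x| = expR s -> 2 * R1 <= expR s -> 0 < y -> 7 * y <= expR s ->
  12 * `|p (x, y) - c| <= 3 * (eps + 4 * k * sg + k * (pi ^+ 2 + 1 + `|b| / (2 * mu)) * eps + k * `|b| * mu * pi) +
  32 * k * (2 * expR 4 * blk c s + mu * pi + eps / (2 * mu) + 8 * expR 4 * K * mu + pi ^+ 2 * eps / (4 * mu)).
Proof.
move=> k0 Hk mu0 eps0 K0 HK.
have [Rd [r1Rd HRd]] := disc_pressure F eps0.
have [Re [r1Re HRe]] := plane_energy_tail F eps0.
have r10 := r1_gt0 F; have pp := pi0.
pose R0 := Num.max (Num.max Rd Re) (Num.max 1 (expR (S0 + 2))).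
have [R0d R0e R01 R0S] : [/\ Rd <= R0, Re <= R0, 1 <= R0 & expR (S0 + 2) <= R0].
  by rewrite /R0 !le_max !lexx !orbT.
clearbody R0; exists R0; split; first by lra.
move=> R1 x y s R0R1 Hb; have X0 := expR_gt0 s; have [X eX] : exists X, X = expR s by exists (expR s).
rewrite -eX in X0 *; move=> xX R1X y0 yX.
have sS0 : S0 <= s - 2 by have : expR (S0 + 2) <= expR s; [rewrite -eX; slra pi0|rewrite ler_expR; slra pi0].
have [al0 alpi] : (- (pi / 4) <= 0 :> R) /\ (pi <= 7 * (pi / 4) :> R) by split; slra pi0.
clear R0S.
have x2 : x ^+ 2 = X ^+ 2 by rewrite -xX real_normK ?num_real.
have bb (g : R * R -> R) : continuous g -> (forall z, 0 <= g z) ->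
    J (fun a => J (fun t => a * g (pt x a t)) 0 pi) (X / 4) (X / 2) <=
    2 * (X ^+ 2 * expR 4) * J (fun x => J (fun t => g (lp (x, t))) 0 pi) (s - 2) (s + 2).
  move=> cg g0; have -> : X ^+ 2 * expR 4 = expR (s + 2) ^+ 2.
    by rewrite [RHS]expr2 -expRD eX expr2 -!expRD; congr expR; ring.
  have := @ball_block _ g s (x, 0) (X / 4) (X / 2) 0 pi cg g0; rewrite /=.
  have -> : (fun r : R => J (fun t : R => r * g (x + r * cos t, 0 + r * sin t)) 0 pi) = fun a => J (fun t => a * g (pt x a t)) 0 pi.
    by apply/funext => r; congr J; apply/funext => t; rewrite add0r.
  rewrite -eX x2 expr0n addr0; apply; [by []|slra pi0|slra pi0|slra pi0|exact: al0|exact: ltW|exact: alpi|].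
  by move=> r t rr tt; rewrite add0r mulr_ge0 ?sin_ge0_pi//; slra pi0.
clear eX; have X1 : 1 <= X by slra pi0.
have Xx2 : X <= X ^+ 2 by rewrite expr2 ler_peMl// ltW.
set Q := `|p (x, y) - c|; have Q0 : 0 <= Q by exact: normr_ge0.
pose G a := J (fun t => `|p (pt x a t) - c| + `|o (pt x a t)| + `|u (pt x a t) * v (pt x a t)|) 0 pi.
pose EE a := J (fun t => a * e (pt x a t)) 0 pi.
have cEE : continuous EE.
  by apply: (@J_param_cts _ _ (fun z : R * R => z.1 * e (pt x z.1 z.2))); cts.
have EEint (a a' : R) : 0 <= a -> a <= a' -> a' <= X / 2 -> J EE a a' <= eps.
  move=> a0 aa aX; have := HRe (x, 0) a a' 0 pi a0 aa; rewrite /=.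
  have -> : (fun r : R => J (fun t : R => r * e (x + r * cos t, 0 + r * sin t)) 0 pi) = EE.
    by apply/funext => r; congr J; apply/funext => t; rewrite add0r.
  apply; [exact: al0|exact: ltW|exact: alpi|move=> r t rr tt].
  by apply: half_disc_far; [slra pi0|slra pi0|rewrite xX; slra pi0|exact: tt].
set E := eps + 4 * k * sg + k * (pi ^+ 2 + 1 + `|b| / (2 * mu)) * eps + k * `|b| * mu * pi.
have near a : X / 4 <= a <= X / 2 -> 2 * pi * Q <= E + k * G a.
  move=> aX; have := @near_boundary _ _ _ _ _ _ _ _ _ _ _ _ _ _ _ F x y a R1 c mu sg eps k k0 (fun z => Hk x y z y0) y0.
  have -> : `|2 * pi * (p (x, y) - c)| = 2 * pi * Q by rewrite normrM gtr0_norm//; slra pi0.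
  apply.
  - by slra pi0.
  - by slra pi0.
  - by rewrite xX; slra pi0.
  - exact: mu0.
  - by apply: EEint; slra pi0.
  - exact: Hb.
  - move=> q qy; apply: (HRd (x, y) (y / 2) q) => /=; [slra pi0|slra pi0|].
    by rewrite x2; have := sqr_ge0 y; have : (Rd + y / 2) ^+ 2 <= X ^+ 2; [rewrite ler_sqr ?nnegrE; slra pi0|slra pi0].
clearbody E Q.
have cG : continuous G.
  by apply: (@J_param_cts _ _ (fun z : R * R => `|p (pt x z.1 z.2) - c| + `|o (pt x z.1 z.2)| + `|u (pt x z.1 z.2) * v (pt x z.1 z.2)|)); cts.
pose N a := J (fun t => a * `|p (pt x a t) - c|) 0 pi.
pose U a := J (fun t => a * u (pt x a t) ^+ 2) 0 pi.
have cN : continuous N.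
  by apply: (@J_param_cts _ _ (fun z : R * R => z.1 * `|p (pt x z.1 z.2) - c|)); cts.
have cU : continuous U.
  by apply: (@J_param_cts _ _ (fun z : R * R => z.1 * u (pt x z.1 z.2) ^+ 2)); cts.
have NB : J N (X / 4) (X / 2) <= 2 * (X ^+ 2 * expR 4) * blk c s.
  by apply: (bb (fun z => `|p z - c|)); [cts|move=> z; exact: normr_ge0].
have UB : J U (X / 4) (X / 2) <= 2 * (X ^+ 2 * expR 4) * (4 * K).
  apply: le_trans (bb (fun z => u z ^+ 2) ltac:(by cts) (fun z => sqr_ge0 _)) _.
  apply: ler_wpM2l; first by have : 0 <= X ^+ 2 * expR 4; [rewrite mulr_ge0 ?sqr_ge0 ?expR_ge0|slra pi0].
  have -> : 4 * K = J (fun=> K) (s - 2) (s + 2) by rewrite J_cst; ring.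
  apply: J_le; [slra pi0| |by cts|move=> q qs].
    by apply: (@J_param_cts _ _ (fun z : R * R => u (lp z) ^+ 2)); rewrite /lp; cts.
  by apply: HK; slra pi0.
have mi0 : 0 < mu^-1 by rewrite invr_gt0.
have Gb a : X / 4 <= a <= X / 2 -> a * G a <= N a + mu * pi * X + mu^-1 / 2 * EE a + mu * U a + mu^-1 / 4 * (pi ^+ 2 * X ^+ 2) * EE a.
  by apply: outer_circle_bound => //; slra pi0.
clearbody N U EE; have cGa : continuous (fun a : R => a * G a) by cts.
clearbody G; clear r1Rd r1Re R0d R0e R01 R0R1 R1X y0 yX xX x2 sS0 al0 alpi K0 Hk; have X4 : X / 4 <= X / 2 by slra pi0.
have cc : continuous (fun a : R => N a + mu * pi * X + mu^-1 / 2 * EE a + mu * U a + mu^-1 / 4 * (pi ^+ 2 * X ^+ 2) * EE a) by cts.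
have JG : J (fun a => a * G a) (X / 4) (X / 2) <= X ^+ 2 * (2 * expR 4 * blk c s + mu * pi + eps / (2 * mu) + 8 * expR 4 * K * mu + pi ^+ 2 * eps / (4 * mu)).
  apply: le_trans (J_le X4 cGa cc Gb) _.
  rewrite JD; [|by cts|by cts]; rewrite JD; [|by cts|by cts].
  rewrite JD; [|by cts|by cts]; rewrite JD; [|by cts|by cts].
  rewrite !(JZ _ _ _ cEE) (JZ _ _ _ cU) J_cst.
  have EI := EEint (X / 4) (X / 2) ltac:(slra pi0) X4 ltac:(slra pi0).
  have -> : (2 * mu)^-1 = mu^-1 / 2 by rewrite invfM mulrC.
  have -> : (4 * mu)^-1 = mu^-1 / 4 by rewrite invfM mulrC.
  have k1 : mu^-1 / 2 * J EE (X / 4) (X / 2) <= X ^+ 2 * (eps * (mu^-1 / 2)).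
    apply: (@le_trans _ _ (1 * (eps * (mu^-1 / 2)))).
      by rewrite mul1r mulrC; apply: ler_wpM2r => //; slra pi0.
    by apply: ler_wpM2r; [rewrite mulr_ge0 ?ltW//; slra pi0|slra pi0].
  have k2 : mu * J U (X / 4) (X / 2) <= mu * (2 * (X ^+ 2 * expR 4) * (4 * K)) by apply: ler_wpM2l => //; exact: ltW.
  have mp0 : 0 <= mu^-1 / 4 * (pi ^+ 2 * X ^+ 2).
    by apply: mulr_ge0; [slra pi0|apply: mulr_ge0; exact: sqr_ge0].
  have k3 := ler_wpM2l mp0 EI.
  have k4 : mu * pi * X * (X / 2 - X / 4) <= X ^+ 2 * (mu * pi).
    have : 0 <= mu * pi * X ^+ 2 by rewrite !mulr_ge0 ?sqr_ge0// ltW.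
    by slra pi0.
  by slra pi0.
have fin : J (fun a => a * (2 * pi * Q)) (X / 4) (X / 2) <= J (fun a => a * E + k * (a * G a)) (X / 4) (X / 2).
  apply: J_le; [slra pi0|by cts|by cts|move=> a aX].
  have -> : a * E + k * (a * G a) = a * (E + k * G a) by ring.
  by apply: ler_wpM2l; [slra pi0|exact: near].
move: fin; rewrite JD; [|by cts|by cts]; rewrite (@JZ _ (fun a => a * G a)); [|by cts].
have Jq m : J (fun q => q * m) (X / 4) (X / 2) = 3 / 32 * X ^+ 2 * m.
  rewrite (@J_ftc _ _ (fun q => q ^+ 2 / 2 * m)); [by field|by cts|move=> q].
  by der_by fail; field.
rewrite !Jq.
move: JG; set JJ := J _ _ _; set B := (_ + _ + _ + _ + _) => JG fin.
have XX : 0 < X ^+ 2 by rewrite exprn_gt0.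
have p2 := @pi_ge2 R.
have pQ : 2 * Q <= pi * Q by apply: ler_wpM2r.
have kJG := ler_wpM2l k0 JG.
have : X ^+ 2 * (3 / 32 * (2 * (2 * Q))) <= X ^+ 2 * (3 / 32 * E + k * B).
  have : X ^+ 2 * (2 * Q) <= X ^+ 2 * (pi * Q) by apply: ler_wpM2l => //; exact: ltW.
  slra pi0.
rewrite (ler_pM2l XX) => h.
slra pi0.
Qed.

End UniformLimit.

Section UniformLimit.
Context {R : realType} (b r1 : R) (u ux uy v vx vy o ox oy p px py : R * R -> R).
Context (F : plane_flow b r1 u ux uy v vx vy o ox oy p px py).
Let pi0 : 0 < pi :> R := @pi_gt0 R.
Local Notation blk c s := (pressure_block (fun z => p (lp z)) c s).

(** The order of choice matters: [mu] multiplies bounded quantities and comes first, [eps] is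
    divided by [mu] and comes next, while [sg] and [d] only compete with [k] and [expR 4]. *)
Lemma layer_constants (k K eta : R) : 0 <= k -> 0 <= K -> 0 < eta ->
  exists mu eps sg d, [/\ 0 < mu, 0 < eps, 0 < sg & 0 < d] /\ sg <= eta /\ forall B, B <= d ->
  3 * (eps + 4 * k * sg + k * (pi ^+ 2 + 1 + `|b| / (2 * mu)) * eps + k * `|b| * mu * pi) +
  32 * k * (2 * expR 4 * B + mu * pi + eps / (2 * mu) + 8 * expR 4 * K * mu + pi ^+ 2 * eps / (4 * mu)) <= 12 * eta.
Proof.
move=> k0 K0 eta0.
have p0 := pi0; have p2 := sqr_ge0 (pi : R); have e4 := expR_gt0 (4 : R); have b0 := normr_ge0 b.
have [M M0 HM] : exists2 M, 0 <= M & forall mu, 3 * (k * `|b| * mu * pi) + 32 * k * (mu * pi + 8 * expR 4 * K * mu) = mu * M.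
  have h1 : 0 <= `|b| * pi by apply: mulr_ge0 => //; exact: ltW.
  have h2 : 0 <= expR 4 * K by apply: mulr_ge0 => //; exact: ltW.
  have h3 : 0 <= k * (`|b| * pi) by apply: mulr_ge0.
  have h4 : 0 <= k * (pi + 8 * (expR 4 * K)) by apply: mulr_ge0 => //; lra.
  exists (3 * (k * (`|b| * pi)) + 32 * (k * (pi + 8 * (expR 4 * K)))) => [|mu]; first by lra.
  by ring.
have [mu mu0 muM] : exists2 mu, 0 < mu & mu * M <= eta.
  exists (eta / (M + 1)); first by rewrite divr_gt0//; lra.
  by rewrite mulrAC ler_pdivrMr; [rewrite ler_pM2l//|]; lra.
have [L L0 HL] : exists2 L, 0 < L & forall eps, 3 * (eps + k * (pi ^+ 2 + 1 + `|b| / (2 * mu)) * eps) + 32 * k * (eps / (2 * mu) + pi ^+ 2 * eps / (4 * mu)) = eps * L.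
  have h1 : 0 <= `|b| / (2 * mu) by apply: divr_ge0 => //; lra.
  have h2 : 0 <= (2 * mu)^-1 by rewrite invr_ge0; lra.
  have h3 : 0 <= pi ^+ 2 * (4 * mu)^-1 by apply: mulr_ge0 => //; rewrite invr_ge0; lra.
  have h4 : 0 <= k * (pi ^+ 2 + 1 + `|b| / (2 * mu)) by apply: mulr_ge0 => //; lra.
  have h5 : 0 <= k * ((2 * mu)^-1 + pi ^+ 2 * (4 * mu)^-1) by apply: mulr_ge0 => //; lra.
  exists (3 + 3 * (k * (pi ^+ 2 + 1 + `|b| / (2 * mu))) + 32 * (k * ((2 * mu)^-1 + pi ^+ 2 * (4 * mu)^-1))) => [|eps]; first by lra.
  by ring.
have [eps eps0 epsL] : exists2 eps, 0 < eps & eps * L = eta.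
  by exists (eta / L); [rewrite divr_gt0|rewrite divfK// gt_eqF].
have [sg sg0 [sE sg_eta]] : exists2 sg, 0 < sg & k * sg <= eta / 12 /\ sg <= eta.
  exists (eta / (12 * (k + 1))); first by rewrite divr_gt0//; lra.
  have := mulr_ge0 k0 (ltW eta0) => ke.
  by split; [rewrite mulrA|]; rewrite ler_pdivrMr; slra pi0.
have [d d0 dk] : exists2 d, 0 < d & k * (expR 4 * d) <= eta / 64.
  have De : 0 < 64 * (k + 1) * expR 4 by apply: mulr_gt0 => //; slra pi0.
  exists (eta / (64 * (k + 1) * expR 4)); first by rewrite divr_gt0.
  have k1 : 0 < k + 1 by slra pi0.
  rewrite (_ : k * _ = k * eta / (k + 1) / 64); last by field; rewrite !gt_eqF.
  by rewrite ler_pM2r ?invr_gt0// ler_pdivrMr//; have := mulr_ge0 k0 (ltW eta0); slra pi0.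
exists mu, eps, sg, d; split; first by split.
split=> // B Bd.
have BE : k * (expR 4 * B) <= k * (expR 4 * d) by apply: ler_wpM2l => //; apply: ler_wpM2l => //; exact: ltW.
have := HL eps; have := HM mu; slra pi0.
Qed.

Lemma boundary_layer_limit (c K S0 : R) : 0 <= K ->
  (forall s, S0 <= s -> J (fun t => u (lp (s, t)) ^+ 2) 0 pi <= K) ->
  tends (fun s => blk c s) 0 -> tends (fun s => p (expR s, 0)) c -> tends (fun s => p (- expR s, 0)) c ->
  forall eta, 0 < eta -> exists R1, 0 < R1 /\ forall x y, R1 <= `|x| -> 0 <= y -> 7 * y <= `|x| ->
    `|p (x, y) - c| <= eta.
Proof.
move=> K0 HK Tb T1 T2 eta eta0.
have [k k0 Hk] := @gr_bound_ex R.
have [mu [eps [sg [d [[mu0 eps0 sg0 d0] [sg_eta HB]]]]]] := layer_constants k0 K0 eta0.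
have [Ra [Ra0 HRa]] := boundary_layer_pressure F c sg k0 Hk mu0 eps0 K0 HK.
have [Sb HSb] := Tb d d0.
have [Sp1 HS1] := T1 _ sg0; have [Sp2 HS2] := T2 _ sg0.
have bnd : exists R2, 0 < R2 /\ forall x, R2 <= `|x| -> `|p (x, 0) - c| <= sg.
  exists (expR (Num.max Sp1 Sp2)); split; first exact: expR_gt0.
  move=> x hx; have x0 : 0 < `|x| := lt_le_trans (expR_gt0 _) hx.
  have xl : expR (ln `|x|) = `|x| by rewrite lnK ?posrE.
  have : Num.max Sp1 Sp2 <= ln `|x| by rewrite -ler_expR xl.
  rewrite ge_max => /andP[/HS1 h1 /HS2 h2]; move: h1 h2; rewrite xl.
  by have [x1|x1] := leP 0 x; [rewrite (ger0_norm x1)|rewrite (ltr0_norm x1) opprK].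
have [R2 [R20 HR2]] := bnd; have Sb0 := expR_gt0 Sb.
exists (2 * (Ra + R2) + expR Sb); split; first by slra pi0.
move=> x y hx y0 yx.
have [y00|yn] := eqVneq y 0.
  by rewrite y00; apply: le_trans (HR2 x _) _ => //; slra pi0.
have y1 : 0 < y by rewrite lt_neqAle eq_sym yn.
have x0 : 0 < `|x| by slra pi0.
have es : expR (ln `|x|) = `|x| by rewrite lnK ?posrE.
have hb : blk c (ln `|x|) <= d.
  apply: le_trans (ler_norm _) _; rewrite -[X in `|X|]subr0; apply: HSb.
  by rewrite -ler_expR es; slra pi0.
have R2x : forall x', Ra + R2 <= `|x'| -> `|p (x', 0) - c| <= sg.
  by move=> x' hx'; apply: HR2; slra pi0.
have h := HRa (Ra + R2) x y (ln `|x|) ltac:(slra pi0) R2x.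
rewrite es in h; have {}h := h erefl ltac:(slra pi0) y1 yx.
rewrite -(@ler_pM2l _ 12)//; exact: le_trans h (HB _ hb).
Qed.

Lemma interior_limit (c : R) : tends (fun s => blk c s) 0 ->
  forall eta, 0 < eta -> exists R1, 0 < R1 /\ forall x y, 0 <= y -> `|x| <= 7 * y ->
    R1 ^+ 2 <= x ^+ 2 + y ^+ 2 -> `|p (x, y) - c| <= eta.
Proof.
move=> Tb eta eta0; have e4 := expR_gt0 (4 : R).
have [Ri [Ri0 HRi]] := interior_pressure F c (eps := eta / 2) ltac:(lra).
have [d d0 dE] : exists2 d, 0 < d & 512 * (expR 4 * d) = eta / 2.
  exists (eta / 2 / (512 * expR 4)); last by field; rewrite gt_eqF.
  by apply: divr_gt0; [lra|apply: mulr_gt0; lra].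
have [Sb HSb] := Tb d d0; have Sb0 := expR_gt0 Sb.
exists (Ri + expR Sb); split; first by slra pi0.
move=> x y y0 yx far.
have [r r2 rR] : exists2 r, r ^+ 2 = x ^+ 2 + y ^+ 2 & Ri + expR Sb <= r.
  have q0 : 0 <= x ^+ 2 + y ^+ 2 by rewrite addr_ge0 ?sqr_ge0.
  exists (Num.sqrt (x ^+ 2 + y ^+ 2)); first by rewrite sqr_sqrtr.
  rewrite -(@ler_sqr _ (Ri + expR Sb)) ?nnegrE ?sqrtr_ge0 ?sqr_sqrtr//; slra pi0.
have r0 : 0 < r by slra pi0.
have es : expR (ln r) = r by rewrite lnK ?posrE.
have r8 : r <= 8 * y.
  have x2 : x ^+ 2 <= (7 * y) ^+ 2.
    by rewrite -(real_normK (num_real x)) ler_sqr ?nnegrE//; slra pi0.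
  rewrite -(@ler_sqr _ r) ?nnegrE ?(ltW r0)//; last by slra pi0.
  by rewrite r2; have := sqr_ge0 y; slra pi0.
have h := HRi x y (ln r); rewrite es r2 in h.
have {}h := h erefl r8 ltac:(slra pi0).
have hb : blk c (ln r) <= d.
  apply: le_trans (ler_norm _) _; rewrite -[X in `|X|]subr0; apply: HSb.
  by rewrite -ler_expR es; slra pi0.
have : expR 4 * blk c (ln r) <= expR 4 * d by apply: ler_wpM2l => //; exact: ltW.
slra pi0.
Qed.

(** The ray $|x| = 7y$ suits both regimes: below it $3|x|/14 < |x|/4$ leaves room for the half
    discs, and above it $50 < 64$ gives $r \le 8y$. *)
Lemma uniform_limit : exists c, forall eta, 0 < eta -> exists R1, 0 < R1 /\ forall x y,
  0 <= y -> R1 ^+ 2 <= x ^+ 2 + y ^+ 2 -> `|p (x, y) - c| <= eta.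
Proof.
have [c [[K [S0 HK]] Tb T1 T2]] := plane_limits F; exists c => eta eta0.
have K0 : 0 <= Num.max 0 K by rewrite le_max lexx.
have {}HK s : S0 <= s -> J (fun t => u (lp (s, t)) ^+ 2) 0 pi <= Num.max 0 K.
  by move=> /HK h; rewrite le_max h orbT.
have [R1 [R10 H1]] := boundary_layer_limit K0 HK Tb T1 T2 eta0.
have [R2 [R20 H2]] := interior_limit Tb eta0.
exists (2 * R1 + R2); split; first by lra.
move=> x y y0 far; have [yx|xy] := leP (7 * y) `|x|; last first.
  apply: H2 => //; first exact: ltW.
  by apply: le_trans far; rewrite ler_sqr ?nnegrE; lra.
apply: H1 => //.
have x0 := normr_ge0 x; have x2 : `|x| ^+ 2 = x ^+ 2 by rewrite real_normK ?num_real.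
have y2 : (7 * y) ^+ 2 <= `|x| ^+ 2 by rewrite ler_sqr ?nnegrE//; lra.
suff : 2 * R1 <= 2 * `|x| by lra.
apply: (@le_trans _ _ (2 * R1 + R2)); first by lra.
rewrite -(@ler_sqr _ (2 * R1 + R2)) ?nnegrE; [|lra|lra].
by apply: le_trans far _; have := sqr_ge0 x; have := sqr_ge0 y; lra.
Qed.

End UniformLimit.

(** * Extension to the whole plane *)

Section Cutoff.
Context {R : realType}.
Implicit Types t y : R.

(** The polynomial $3t^2 - 2t^3$ on [0, 1], continued by constants; as an integral it is $C^1$
    across the joints without case analysis. *)
Definition step t : R := J (fun s => 6 * clamp s * (1 - clamp s)) 0 t.
Definition step' t : R := 6 * clamp t * (1 - clamp t).
(** The $C^1$ function $\max(y, 0)^2$, written as an integral for the same reason. *)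
Definition possq y : R := J (fun s => 2 * Num.max s 0) 0 y.

Lemma step'_cts : continuous step'.
Proof. by have cc := @clamp_cts R; rewrite /step'; cts. Qed.

Lemma step_der t : der t step (step' t).
Proof. by apply: J_der; exact: step'_cts. Qed.

Lemma step'_le0 t : t <= 0 -> step' t = 0.
Proof. by move=> t0; rewrite /step' clamp0// mulr0 mul0r. Qed.

Lemma step_le0 t : t <= 0 -> step t = 0.
Proof.
move=> t0; rewrite /step J_sym (@J_ext _ _ (fun=> 0) t 0 t0 step'_cts).
- by rewrite J_cst mul0r oppr0.
- by cts.
- by move=> x /andP[_ x0]; exact: step'_le0.
Qed.

Lemma step_ge1 t : 1 <= t -> step t = 1.
Proof.
move=> t1; rewrite /step (J_cat _ 0 1 t) -[RHS]addr0; congr (_ + _).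
  have c1 : continuous (fun s : R => 6 * s * (1 - s)) by cts.
  rewrite (@J_ext _ _ (fun s => 6 * s * (1 - s)) 0 1 ler01 step'_cts c1).
    rewrite (@J_ftc _ _ (fun s => 3 * s ^+ 2 - 2 * (s ^+ 2 * s)) 0 1 c1); first by ring.
    by move=> s; der_by fail; ring.
  move=> x /andP[x0 x1]; rewrite /step' /clamp.
  by rewrite (min_idPr x1) (max_idPr x0).
rewrite (@J_ext _ _ (fun=> 0) 1 t t1 step'_cts).
- by rewrite J_cst mul0r.
- by cts.
- by move=> x /andP[x1 _]; rewrite /step' clamp1// subrr mulr0.
Qed.

Lemma possq_dcts : continuous (fun s : R => 2 * Num.max s 0).
Proof. by cts. Qed.

Lemma possq_der y : der y possq (2 * Num.max y 0).
Proof. by apply: J_der; exact: possq_dcts. Qed.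

Lemma possq_ge0 y : 0 <= y -> possq y = y ^+ 2.
Proof.
move=> y0; have c2 : continuous (fun s : R => 2 * s) by cts.
rewrite /possq (J_ext y0 possq_dcts c2).
  rewrite (@J_ftc _ _ (fun s => s ^+ 2) 0 y c2); first by ring.
  by move=> s; der_by fail; ring.
by move=> x /andP[x0 _]; rewrite (max_idPl x0).
Qed.

Lemma possq_le0 y : y <= 0 -> possq y = 0.
Proof.
move=> y0; have c0 : continuous (fun _ : R => 0 : R) by cts.
rewrite /possq J_sym (J_ext y0 possq_dcts c0); first by rewrite J_cst mul0r oppr0.
by move=> x /andP[_ x0]; rewrite (max_idPr x0) mulr0.
Qed.

Lemma J_der_in (f f' : R -> R) (a b : R) : continuous f' ->
  (forall x, a <= x <= b \/ b <= x <= a -> der x f (f' x)) -> J f' a b = f b - f a.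
Proof.
move=> cf' df; have c1 : continuous (fun _ : R => 1 : R) by cts.
have [ab|/ltW ba] := leP a b.
  rewrite (@J_subst_in _ (fun=> 1) f f' f' a b ab c1 cf'); first by rewrite J_cst mul1r.
    by move=> x xab; apply: df; left.
  by move=> x _; rewrite mul1r.
rewrite J_sym (@J_subst_in _ (fun=> 1) f f' f' b a ba c1 cf'); first by rewrite J_cst mul1r; ring.
  by move=> x xab; apply: df; right.
by move=> x _; rewrite mul1r.
Qed.

Lemma cts_eq0_right (h : R -> R) (x : R) : continuous h -> (forall y, x < y -> h y = 0) -> h x = 0.
Proof.
move=> ch h0; apply/eqP/negPn/negP => hx.
have e0 : 0 < `|h x| by rewrite normr_gt0.
have /cvgrPdist_lt /(_ _ e0) [d /= d0 Hd] := ch x.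
have := Hd (x + d / 2); rewrite /ball_ /= => /(_ _).
rewrite (h0 (x + d / 2)); last by lra.
rewrite subr0 ltxx => H; apply: notF; apply: H.
by rewrite opprD addrA subrr add0r normrN gtr0_norm; lra.
Qed.

End Cutoff.

Section PartialDer.
Context {R : realType}.
Implicit Types f : R * R -> R.

Lemma der_dx f (x y : R) : derivable f (x, y) ex -> der x (fun t => f (t, y)) (dx f (x, y)).
Proof.
move=> df; have E : (fun h : R => h^-1 *: ((fun t => f (t, y)) (h *: 1 + x) - f (x, y))) =
   (fun h : R => h^-1 *: (f (h *: ex + (x, y)) - f (x, y))).
  by apply/funext => h; congr (_ *: (f _ - _)); rewrite /ex; congr (_, _) => /=; rewrite /GRing.scale /= mulr0 add0r.
apply: DeriveDef.
  by rewrite /derivable /= E.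
by rewrite /dx /derive /= E.
Qed.

Lemma der_dy f (x y : R) : derivable f (x, y) ey -> der y (fun t => f (x, t)) (dy f (x, y)).
Proof.
move=> df; have E : (fun h : R => h^-1 *: ((fun t => f (x, t)) (h *: 1 + y) - f (x, y))) =
   (fun h : R => h^-1 *: (f (h *: ey + (x, y)) - f (x, y))).
  by apply/funext => h; congr (_ *: (f _ - _)); rewrite /ey; congr (_, _) => /=; rewrite /GRing.scale /= mulr0 add0r.
apply: DeriveDef.
  by rewrite /derivable /= E.
by rewrite /dy /derive /= E.
Qed.

End PartialDer.

Section Domain.
Context {R : realType} (r0 : R) (r00 : 0 < r0).
Implicit Types (z : R * R).
Local Notation D := (Omega0 r0).
Local Notation q z := (z.1 ^+ 2 + z.2 ^+ 2).

Lemma Omega0P z : D z <-> 0 < z.2 /\ r0 ^+ 2 < q z.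
Proof.
have q0 : 0 <= q z by rewrite addr_ge0 ?sqr_ge0.
have s2 := sqr_sqrtr q0.
rewrite /Omega0 /=; split => -[y0 h]; split => //.
  by rewrite -s2 ltr_sqr ?nnegrE ?sqrtr_ge0// ltW.
by rewrite -(@ltr_sqr _ r0) ?nnegrE ?sqrtr_ge0 ?s2// ltW.
Qed.

Lemma closure_Omega0 z : 0 <= z.2 -> r0 ^+ 2 < q z -> closure D z.
Proof.
case: z => x y /= y0 h B nB.
have cl : continuous (fun t : R => (x, y + t)).
  by apply: (@cts_pair _ _ _ (fun _ : R => x) (fun t : R => y + t)); cts.
have := cl 0; rewrite /continuous_at addr0 => /(_ B nB) [d /= d0 Hd].
have d2 : 0 < d / 2 by lra.
exists (x, y + d / 2); split; last first.
  by apply: Hd; rewrite /ball_ /= sub0r normrN gtr0_norm; lra.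
apply/Omega0P; split => /=; first by lra.
by apply: lt_le_trans h _; rewrite lerD2l ler_sqr ?nnegrE; lra.
Qed.

Lemma cut_cts (g k : R * R -> R) (a : R) : r0 ^+ 2 < a ->
  {within closure D, continuous g} -> continuous k -> (forall z, q z <= a -> k z = 0) ->
  continuous (fun z => k z * g (z.1, `|z.2|)).
Proof.
move=> ra cg ck k0 z.
have cq : continuous (fun z : R * R => q z) by cts.
have [za|za] := ltP (q z) a.
  have nz : \forall w \near z, k w * g (w.1, `|w.2|) = 0.
    have := cq z; move=> /cvgr_lt => /(_ _ za); apply: filterS => w wa.
    by rewrite k0 ?mul0r// ltW.
  rewrite /continuous_at k0 ?mul0r ?(ltW za)//.
  apply: cvg_near_cst; exact: nz.
apply: cvgM; first exact: ck.
pose N (w : R * R) : R * R := (w.1, `|w.2|).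
have cN : continuous N.
  by apply: (@cts_pair _ _ _ (fun w : R * R => w.1) (fun w : R * R => `|w.2|)); cts.
have qN w : q (N w) = q w by rewrite /N /= real_normK ?num_real.
have clN w : r0 ^+ 2 < q w -> closure D (N w).
  by move=> h; apply: closure_Omega0; rewrite ?qN// /N /=.
have zr : r0 ^+ 2 < q z by exact: lt_le_trans za.
have /subspace_continuousP cg' := cg.
have H := cg' _ (clN z zr).
move=> P hP; have h : nbhs (N z) [set w | closure D w -> P (g w)] := H P hP.
have h1 : \forall w \near z, closure D (N w) -> P (g (N w)) := cN z _ h.
have h2 : \forall w \near z, r0 ^+ 2 < q w by have := cq z; move=> /cvgr_gt; apply.
by apply: filterS2 h1 h2 => w hw /clN.
Qed.

End Domain.

Section Extension.
Context {R : realType} (r0 : R) (r00 : 0 < r0).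
Local Notation D := (Omega0 r0).
Local Notation q z := (z.1 ^+ 2 + z.2 ^+ 2).
Context (a b c : R) (ra : r0 ^+ 2 < a) (ab : a < b) (bc : b < c).
Context (f gx gy : R * R -> R).
Hypothesis cgx : {within closure D, continuous gx}.
Hypothesis cgy : {within closure D, continuous gy}.
Hypothesis df : forall z, D z -> [/\ derivable f z ex, derivable f z ey, dx f z = gx z & dy f z = gy z].

Let b0 : 0 < b.
Proof. by have := sqr_ge0 r0; have := ra; have := ab; lra. Qed.

Let k (z : R * R) : R := clamp ((q z - a) / (b - a)).

Let ck : continuous k.
Proof. by apply: cts_clamp; cts. Qed.

Let k0 z : q z <= a -> k z = 0.
Proof.
move=> h; apply: clamp0; rewrite pmulr_lle0 ?invr_gt0; last by have := ab; lra.
by lra.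
Qed.

Let k1 z : b <= q z -> k z = 1.
Proof. by move=> h; apply: clamp1; rewrite ler_pdivlMr; have := ab; lra. Qed.

Let Gx (z : R * R) : R := k z * gx (z.1, `|z.2|).
Let Gy (z : R * R) : R := k z * gy (z.1, `|z.2|).
Let cGx : continuous Gx := cut_cts r00 ra cgx ck k0.
Let cGy : continuous Gy := cut_cts r00 ra cgy ck k0.

Let inD (x y : R) : 0 < y -> b <= x ^+ 2 + y ^+ 2 -> D (x, y).
Proof. by move=> y0 h; apply/(Omega0P r00) => /=; have := ra; have := ab; split => //; lra. Qed.

Let derx (x y : R) : 0 < y -> b <= x ^+ 2 + y ^+ 2 -> der x (fun t => f (t, y)) (Gx (x, y)).
Proof.
move=> y0 h; have [dfx _ E _] := df (inD y0 h).
by rewrite /Gx (@k1 (x, y) h) mul1r /= (ger0_norm (ltW y0)) -E; exact: der_dx.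
Qed.

Let dery (x y : R) : 0 < y -> b <= x ^+ 2 + y ^+ 2 -> der y (fun t => f (x, t)) (Gy (x, y)).
Proof.
move=> y0 h; have [_ dfy _ E] := df (inD y0 h).
by rewrite /Gy (@k1 (x, y) h) mul1r /= (ger0_norm (ltW y0)) -E; exact: der_dy.
Qed.

(** Since $b \le (b + 1)^2$, the whole line $y = Y_0$ lies where [f] is known and serves as the
    starting line of an integration. *)
Let Y0 : R := b + 1.
Let Y00 : 0 < Y0. Proof. by rewrite /Y0; have := b0; lra. Qed.
Let Y0b : b <= Y0 ^+ 2. Proof. by rewrite /Y0; have := b0; nra. Qed.
Let Y0x (x y : R) : Y0 <= y -> b <= x ^+ 2 + y ^+ 2.
Proof.
move=> h; have h1 : Y0 ^+ 2 <= y ^+ 2 by rewrite ler_sqr ?nnegrE; have := Y00; lra.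
by have := sqr_ge0 x; have := Y0b; lra.
Qed.

(** Integrating the even reflection of $f_y$ continues [f] below the axis by $2 f(x, 0) - f(x, -y)$,
    which is $C^1$ across the axis, whereas the even reflection of [f] itself would have a kink. *)
Let F0 (z : R * R) : R := f (z.1, Y0) + J (fun t => Gy (z.1, t)) Y0 z.2.

Let cGy1 (x : R) : continuous (fun t : R => Gy (x, t)).
Proof. by have := cGy => cG; cts. Qed.

Let F0_cts : continuous F0.
Proof.
have cG := cGy; have cG' := cGy1.
have cf : continuous (fun x : R => f (x, Y0)).
  by apply: (@der_cts _ _ (fun x => Gx (x, Y0))) => x; apply: derx => //; exact: Y0x.
apply: ctsD; first by apply: (@cts_comp _ _ (fun x : R => f (x, Y0)) (fun z : R * R => z.1)) => //; cts.
rewrite (_ : (fun z => _) = fun z : R * R => (z.2 - Y0) * J (fun s => Gy (z.1, Y0 + s * (z.2 - Y0))) 0 1).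
  apply: ctsM; first by cts.
  by apply: (@J_param_cts _ _ (fun z : (R * R) * R => Gy (z.1.1, Y0 + z.2 * (z.1.2 - Y0)))); cts.
by apply/funext => z; rewrite J_line.
Qed.

Let F0_f (x y : R) : 0 < y -> b <= x ^+ 2 + y ^+ 2 -> F0 (x, y) = f (x, y).
Proof.
move=> y0 h; rewrite /F0 /= (@J_der_in _ (fun t => f (x, t)) (fun t => Gy (x, t)) Y0 y); first by ring.
  exact: cGy1.
move=> t [] /andP[t1 t2]; apply: dery.
- by have := Y00; lra.
- exact: Y0x.
- by lra.
- by apply: le_trans h _; rewrite lerD2l ler_sqr ?nnegrE; lra.
Qed.

Let F0_dy (x y : R) : der y (fun t => F0 (x, t)) (Gy (x, y)).
Proof.
have dJ : der y (J (fun s => Gy (x, s)) Y0) (Gy (x, y)) by apply: J_der; exact: cGy1.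
by rewrite /F0 /=; der_by ltac:(exact: dJ); rewrite add0r.
Qed.

Let F0_neg (x y : R) : F0 (x, - y) = 2 * F0 (x, 0) - F0 (x, y).
Proof.
have E : J (fun t => Gy (x, t)) 0 (- y) = - J (fun t => Gy (x, t)) 0 y.
  have H := @J_opp _ _ 0 y (@cGy1 x); rewrite oppr0 in H.
  rewrite (J_sym _ (- y) 0) -H; congr (- J _ _ _).
  by apply/funext => t; rewrite /Gy /k /= sqrrN normrN.
rewrite /F0 /= (J_cat _ Y0 0 (- y)) (J_cat _ Y0 0 y) E; ring.
Qed.

Let Fx0 (z : R * R) : R := Gx (z.1, Num.max z.2 0) + Gx (z.1, 0) - Gx (z.1, Num.max (- z.2) 0).

(** Below the axis [F0] involves the axis value at the same abscissa, so being far from the disc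
    must mean $x^2 > b$ there whatever $y$ is; this is what [possq] encodes. *)
Let F0_dx (x y : R) : b < x ^+ 2 + possq y -> der x (fun t => F0 (t, y)) (Fx0 (x, y)).
Proof.
have cF := F0_cts; have cG := cGx.
have near (y' : R) : b < x ^+ 2 + y' -> \forall t \near x, b < t ^+ 2 + y'.
  move=> h; have ch : continuous (fun t : R => t ^+ 2 + y') by cts.
  by have := ch x; move=> /cvgr_gt; apply.
have pos y' : 0 < y' -> b < x ^+ 2 + y' ^+ 2 -> der x (fun t => F0 (t, y')) (Gx (x, y')).
  move=> y0 h; apply: der_near (derx y0 (ltW h)) _.
  by apply: filterS (near _ h) => t tb; rewrite F0_f// ltW.
have zero : b < x ^+ 2 -> der x (fun t => F0 (t, 0)) (Gx (x, 0)).
  move=> h; have cGx0 : continuous (fun s : R => Gx (s, 0)) by cts.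
  have h' : b < x ^+ 2 + 0 by rewrite addr0.
  have dJ : der x (fun t => F0 (x, 0) + J (fun s => Gx (s, 0)) x t) (Gx (x, 0)).
    have dJ : der x (J (fun s => Gx (s, 0)) x) (Gx (x, 0)) by apply: J_der.
    by der_by ltac:(exact: dJ); rewrite add0r.
  apply: der_near dJ _.
  have [d /= d0 Hd] : \forall t \near x, b < t ^+ 2 + 0 := near _ h'.
  exists d => //= t xt.
  have xs s : x <= s <= t \/ t <= s <= x -> b < s ^+ 2.
    move=> hs; rewrite -[X in _ < X]addr0; apply: Hd; rewrite /ball_ /=; move: xt; rewrite /ball_ /= !ltr_norml => /andP[h1 h2].
    by apply/andP; case: hs => /andP[h3 h4]; split; lra.
  (* Derivatives of [f] are known above the axis only. The integrated increment formula passes to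
     [y = 0] by continuity, and differentiating it gives the derivative on the axis. *)
  pose g (y : R) := F0 (t, y) - F0 (x, y) - J (fun s => Gx (s, y)) x t.
  have cg : continuous g.
    apply: ctsD; first by cts.
    by apply: ctsN; apply: (@J_param_cts _ _ (fun z : R * R => Gx (z.2, z.1))); cts.
  have := @cts_eq0_right _ g 0 cg; rewrite /g => H.
  have {}H : F0 (t, 0) - F0 (x, 0) - J (fun s => Gx (s, 0)) x t = 0; last by lra.
  apply: H => y' y0.
  rewrite (@J_der_in _ (fun s => f (s, y')) (fun s => Gx (s, y')) x t); [|by cts|].
    rewrite !F0_f//; [by rewrite subrr| |].
    - by have := sqr_ge0 y'; have := h; lra.
    - have tb : b < t ^+ 2.
        by apply: xs; have [xt'|tx'] := leP x t; [left|right]; apply/andP; split => //; exact: ltW.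
      by have := sqr_ge0 y'; lra.
  move=> s hs; apply: derx => //.
  by have := xs s hs; have := sqr_ge0 y'; lra.
rewrite /Fx0 /=; have [y0|y0|->] := ltgtP y 0.
- rewrite possq_le0 ?(ltW y0)// addr0 => h.
  rewrite ?(max_idPr (ltW y0)) (max_idPl _); last by lra.
  have ny : 0 < - y by lra.
  have hn : b < x ^+ 2 + (- y) ^+ 2 by have := sqr_ge0 (- y); lra.
  rewrite (_ : (fun t => F0 (t, y)) = fun t => 2 * F0 (t, 0) - F0 (t, - y)).
    der_by ltac:(first [exact: zero|exact: pos]).
    by ring.
  by apply/funext => t; have := F0_neg t y; lra.
- rewrite possq_ge0 ?(ltW y0)// => h.
  rewrite ?(max_idPl (ltW y0)) (max_idPr _); last by lra.
  by rewrite addrK; exact: pos.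
- rewrite possq_ge0// expr0n addr0 => h.
  by rewrite oppr0 ?maxxx addrK; exact: zero.
Qed.

Let d : R := (b + c) / 2.
Let arg (z : R * R) : R := (z.1 ^+ 2 + possq z.2 - d) / (c - d).
Let cd : 0 < c - d. Proof. by rewrite /d; have := bc; lra. Qed.
Let bd : b < d. Proof. by rewrite /d; have := bc; lra. Qed.

Let C1arg : C1 arg (fun z => 2 * z.1 / (c - d)) (fun z => 2 * Num.max z.2 0 / (c - d)).
Proof.
split; [by cts|by cts| |] => x y.
  by rewrite /arg /=; der_by fail; ring.
by rewrite /arg /=; der_by ltac:(exact: possq_der); rewrite /=; ring.
Qed.

Let C1chi := C1_comp (@step'_cts R) (@step_der R) C1arg.

Lemma C1_extension : exists F Fx Fy, C1 F Fx Fy /\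
  forall x y, 0 < y -> c <= x ^+ 2 + y ^+ 2 -> F (x, y) = f (x, y).
Proof.
have cF := F0_cts; have cG := cGx; have cG' := cGy; have cchi := C1_cts C1chi.
have [ccx ccy dcx dcy] := C1chi.
have cFx : continuous Fx0 by rewrite /Fx0; cts.
set chi := (fun z => step (arg z)) in cchi dcx dcy.
set chix := (fun z => _) in ccx dcx; set chiy := (fun z => _ * (2 * Num.max _ _ / _)) in ccy dcy.
exists (fun z => chi z * F0 z), (fun z => chi z * Fx0 z + F0 z * chix z), (fun z => chi z * Gy z + F0 z * chiy z).
split.
  split; [by cts|by cts| |] => x y; last first.
    exact: derM (dcy x y) (F0_dy x y).
  have [h|h] := ltP b (x ^+ 2 + possq y).
    exact: derM (dcx x y) (F0_dx h).
  have E t : t ^+ 2 + possq y < d -> chi (t, y) = 0 /\ chix (t, y) = 0.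
    move=> hd; have a0 : arg (t, y) <= 0.
      by rewrite /arg /= pmulr_lle0 ?invr_gt0 ?cd//; lra.
    by rewrite /chi /chix step_le0// step'_le0// mul0r.
  have hx : x ^+ 2 + possq y < d by have := bd; lra.
  have [-> ->] := E x hx; rewrite mul0r mulr0 addr0.
  have d0 : der x (fun _ : R => 0 : R) 0 by exact: der_cst.
  apply: der_near d0 _.
  have ch : continuous (fun t : R => t ^+ 2 + possq y) by cts.
  have := ch x; move=> /cvgr_lt /(_ _ hx); apply: filterS => t /E[-> _].
  by rewrite mul0r.
move=> x y y0 h; rewrite F0_f//; last by have := bc; lra.
rewrite /chi step_ge1 ?mul1r// /arg /= possq_ge0 ?(ltW y0)// ler_pdivlMr ?cd// mul1r.
by lra.
Qed.

End Extension.

(** * Identities in the open region and their passage to the axis *)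

Section Region.
Context {R : realType} (c : R).
Implicit Types (f F : R * R -> R).
Local Notation far := (fun x y : R => 0 < y /\ c < x ^+ 2 + y ^+ 2).

Lemma far_near_x (x y : R) : far x y -> \forall t \near x, far t y.
Proof.
move=> [y0 h]; have ch : continuous (fun t : R => t ^+ 2 + y ^+ 2) by cts.
by have := ch x; move=> /cvgr_gt /(_ _ h); apply: filterS.
Qed.

Lemma far_near_y (x y : R) : far x y -> \forall t \near y, far x t.
Proof.
move=> [y0 h]; have ch : continuous (fun t : R => x ^+ 2 + t ^+ 2) by cts.
have h1 : \forall t \near y, c < x ^+ 2 + t ^+ 2 by have := ch y; move=> /cvgr_gt; apply.
have cid : continuous (fun t : R => t) by exact: cts_id.
have h2 : \forall t \near y, 0 < t by have := cid y; move=> /cvgr_gt; apply.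
by apply: filterS2 h1 h2.
Qed.

Lemma C1_dx_near F Fx Fy f (x y a : R) : C1 F Fx Fy -> (forall x y, far x y -> F (x, y) = f (x, y)) ->
  far x y -> der x (fun t => f (t, y)) a -> Fx (x, y) = a.
Proof.
move=> CF E fxy da; apply: (der_unique (C1_dx CF x y)).
by apply: der_near da _; apply: filterS (far_near_x fxy) => t /E.
Qed.

Lemma C1_dy_near F Fx Fy f (x y a : R) : C1 F Fx Fy -> (forall x y, far x y -> F (x, y) = f (x, y)) ->
  far x y -> der y (fun t => f (x, t)) a -> Fy (x, y) = a.
Proof.
move=> CF E fxy da; apply: (der_unique (C1_dy CF x y)).
by apply: der_near da _; apply: filterS (far_near_y fxy) => t /E.
Qed.

Lemma far_closure (h : R * R -> R) (x y : R) : continuous h -> (forall x y, far x y -> h (x, y) = 0) ->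
  0 <= y -> c < x ^+ 2 + y ^+ 2 -> h (x, y) = 0.
Proof.
move=> ch h0 y0 hc; apply: (@cts_eq0_right _ (fun t => h (x, t)) y); first by cts.
move=> t yt; apply: h0; split; first by lra.
by apply: lt_le_trans hc _; rewrite lerD2l ler_sqr ?nnegrE; lra.
Qed.

(** [F0] is recovered from [F2] by integration in $y$ from a height [Y]; differentiating in $x$
    under the integral writes [F1] as a primitive of [F2x] in $y$. *)
Lemma schwarz F0 F0x F0y F1 F1x F1y F2 F2x F2y : C1 F0 F0x F0y -> C1 F1 F1x F1y -> C1 F2 F2x F2y ->
  (forall x y, far x y -> F0x (x, y) = F1 (x, y)) -> (forall x y, far x y -> F0y (x, y) = F2 (x, y)) ->
  forall x y, far x y -> F1y (x, y) = F2x (x, y).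
Proof.
move=> C0 C1' C2 E1 E2 x y fxy.
have c2 := C1_cts C2; have c0y := C1_cy C0; have c2x := C1_cx C2.
have up x' y' t : far x' y' -> y' <= t -> far x' t.
  move=> [y0 h] yt; split; first by lra.
  by apply: lt_le_trans h _; rewrite lerD2l ler_sqr ?nnegrE; lra.
pose Y := y + 1.
have key y' : far x y' -> y' <= Y -> F1 (x, y') = F1 (x, Y) - J (fun t => F2x (x, t)) y' Y.
  move=> fy yY.
  have E x' : far x' y' -> F0 (x', y') = F0 (x', Y) - J (fun t => F2 (x', t)) y' Y.
    move=> fx'; have cc : continuous (fun t : R => F0y (x', t)) by cts.
    have cc2 : continuous (fun t : R => F2 (x', t)) by cts.
    rewrite (J_ext yY cc2 cc).
      by rewrite (J_ftc _ _ cc (fun t => C1_dy C0 x' t)); ring.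
    by move=> t /andP[ty _]; rewrite E2//; exact: up ty.
  rewrite -(E1 _ _ fy) -(E1 x Y); last exact: up yY.
  have dJ := @J_der_param _ F2 F2x y' Y _ c2 c2x (fun t s => C1_dx C2 t s).
  apply: (der_unique (C1_dx C0 x y')).
  have h : der x (fun x' => F0 (x', Y) - J (fun t => F2 (x', t)) y' Y) (F0x (x, Y) - J (fun t => F2x (x, t)) y' Y).
    by der_by ltac:(first [exact: (C1_dx C0)|exact: dJ]).
  by apply: der_near h _; apply: filterS (far_near_x fy) => t /E.
have cc : continuous (fun t : R => F2x (x, t)) by cts.
apply: (der_unique (C1_dy C1' x y)).
have h : der y (fun t => F1 (x, Y) + J (fun t => F2x (x, t)) Y t) (F2x (x, y)).
  have dJ : der y (J (fun s => F2x (x, s)) Y) (F2x (x, y)) by apply: J_der.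
  by der_by ltac:(exact: dJ); rewrite add0r.
apply: der_near h _; have yY : y < Y by rewrite /Y; lra.
have cid : continuous (fun t : R => t) by exact: cts_id.
have h2 : \forall t \near y, t < Y by have := cid y; move=> /cvgr_lt; apply.
apply: filterS2 (far_near_y fxy) h2 => t ft tY.
by rewrite key ?(ltW tY)// (J_sym _ t Y).
Qed.

End Region.

Section Extensions.
Context {R : realType} (r0 : R) (r00 : 0 < r0).
Local Notation D := (Omega0 r0).
Implicit Types (f F : R * R -> R).

Definition fits c f F := forall x y : R, 0 < y -> c <= x ^+ 2 + y ^+ 2 -> F (x, y) = f (x, y).

Lemma extension1 f : (forall z, D z -> derivable f z ex /\ derivable f z ey) ->
  extends_to_closure D (dx f) -> extends_to_closure D (dy f) ->
  exists F Fx Fy, C1 F Fx Fy /\ fits (r0 ^+ 2 + 3) f F.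
Proof.
move=> df [gx cgx Egx] [gy cgy Egy].
apply: (@C1_extension _ r0 r00 (r0 ^+ 2 + 1) (r0 ^+ 2 + 2) (r0 ^+ 2 + 3) _ _ _ f gx gy cgx cgy); try lra.
by move=> z Dz; have [d1 d2] := df z Dz; rewrite Egx// Egy.
Qed.

Lemma ext_fits c f F (x y : R) : continuous F -> fits c f F -> r0 ^+ 2 < c ->
  0 <= y -> c < x ^+ 2 + y ^+ 2 -> ext D f (x, y) = F (x, y).
Proof.
move=> cF E rc y0 h; apply: cvg_lim => //.
- apply: within_nbhs_proper; apply: closure_Omega0 => //=; lra.
- have cq : continuous (fun z : R * R => z.1 ^+ 2 + z.2 ^+ 2) by cts.
  have n1 : \forall z \near (x, y), c < z.1 ^+ 2 + z.2 ^+ 2.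
    by have := cq (x, y); move=> /cvgr_gt; apply.
  move=> P hP; have n2 : \forall z \near (x, y), P (F z) := cF (x, y) P hP.
  have : \forall z \near (x, y), D z -> P (f z); last by [].
  apply: filterS2 n1 n2 => -[x' y'] /= n1 n2 /(Omega0P r00)[/= y'0 _].
  by rewrite -E ?ltW.
Qed.

End Extensions.

(** * Finite energy and conclusion *)

Section Lebesgue.
Context {R : realType}.
Local Notation mu := (@lebesgue_measure R).

Lemma integral_J (f : R -> R) (a b : R) : a <= b -> continuous f ->
  (\int[mu]_(x in `[a, b]) (f x)%:E = (J f a b)%:E)%E.
Proof.
move=> ab cf; have [->|anb] := eqVneq a b.
  by rewrite Jaa set_itv1 integral_set1.
have {ab anb} ab : a < b by rewrite lt_neqAle anb.
have dF := primP cf; have cF : continuous (prim f) := der_cts dF.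
rewrite (@continuous_FTC2 _ f (prim f) a b ab) //.
- exact: continuous_subspaceT.
- split.
  + by move=> x _; have [] := dF x.
  + by apply: cvg_at_right_filter; exact: cF.
  + by apply: cvg_at_left_filter; exact: cF.
- by move=> x _; rewrite derive1E; have [_] := dF x.
Qed.

(** The product sigma-algebra is generated by rectangles, and an open set is the countable union of
    the rational boxes that it contains. *)
Lemma open_measurable2 (U : set (R * R)) : open U -> measurable U.
Proof.
move=> oU.
pose I (q1 q2 : rat) (n : nat) : set (R * R) := ball (ratr q1 : R) n.+1%:R^-1 `*` ball (ratr q2 : R) n.+1%:R^-1.
pose C q1 q2 n := if `[< I q1 q2 n `<=` U >] then I q1 q2 n else set0.
have -> : U = \bigcup_q1 \bigcup_q2 \bigcup_n C q1 q2 n.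
  apply/seteqP; split => [[x y] Uxy|z [q1 _ [q2 _ [n _]]]]; last first.
    by rewrite /C; case: ifPn => // /asboolP; apply.
  have := oU; rewrite openE => /(_ _ Uxy); rewrite /interior -nbhs_ballE => -[e /= e0 He].
  have [n hn] : exists n : nat, n.+1%:R^-1 < e / 2.
    have e2 : 0 < e / 2 by rewrite divr_gt0.
    have [n _ /(_ n (leqnn n))] := near_infty_natSinv_lt (PosNum e2).
    by exists n.
  have n0 : 0 < n.+1%:R^-1 :> R by rewrite invr_gt0.
  have dd : n.+1%:R^-1 + n.+1%:R^-1 <= e by move: hn; move: (n.+1%:R^-1) => d; lra.
  have appr (w : R) : exists q : rat, `|ratr q - w| < n.+1%:R^-1.
    move: n0; move: (n.+1%:R^-1) => d d0.
    have wd : w - d < w + d by lra.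
    have [q] := @rat_in_itvoo R (w - d) (w + d) wd.
    rewrite in_itv /= => /andP[h1 h2]; exists q; rewrite ltr_norml; apply/andP; split; lra.
  have [q1 h1] := appr x; have [q2 h2] := appr y.
  exists q1 => //; exists q2 => //; exists n => //.
  rewrite /C; case: ifPn => [_|/asboolP []]; first by split.
  move=> [x' y'] [/= b1 b2]; apply: He; split => /=.
    apply: (@le_ball _ _ _ (n.+1%:R^-1 + n.+1%:R^-1)) => //.
    by apply: ball_triangle b1; move: h1; rewrite /ball /= distrC.
  apply: (@le_ball _ _ _ (n.+1%:R^-1 + n.+1%:R^-1)) => //.
  by apply: ball_triangle b2; move: h2; rewrite /ball /= distrC.
apply: bigcupT_measurable_rat => q1; apply: bigcupT_measurable_rat => q2.
apply: bigcupT_measurable => n; rewrite /C; case: ifPn => _; last exact: measurable0.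
by apply: measurableX; apply: open_measurable; exact: ball_open.
Qed.

Lemma continuous_measurable2 (f : R * R -> R) : continuous f -> measurable_fun setT f.
Proof.
move=> /continuousP cf; apply: (measurability _ (RGenOpens.measurableE R)).
move=> _ [_ [a [b ->] <-]]; rewrite setTI; apply: open_measurable2.
exact/cf/interval_open.
Qed.

(** The comparison is made on the simple minorants that define the integral, because no
    measurability of [sqr_grad] is at hand. *)
Lemma integral_le_restrict d (T : measurableType d) (m : {measure set T -> \bar R}) (D : set T) (g S : T -> \bar R) :
  (forall x, 0 <= g x)%E -> (forall x, D x -> 0 <= S x)%E -> (forall x, g x <= (S \_ D) x)%E ->
  (\int[m]_x g x <= \int[m]_(x in D) S x)%E.
Proof.
move=> g0 S0 gS; rewrite ge0_integralTE// ge0_integralE//.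
apply: le_ereal_sup => _ [h hg <-]; exists h => // x.
exact: le_trans (gS x).
Qed.

Lemma box_integral (f : R * R -> R) (a b c d : R) : a <= b -> c <= d -> continuous f -> (forall z, 0 <= f z) ->
  (\int[mu \x mu]_z ((EFin \o f) \_ (`[a, b] `*` `[c, d])) z =
   (J (fun x => J (fun y => f (x, y)) c d) a b)%:E)%E.
Proof.
move=> ab cd cf f0.
have mB : measurable (`[a, b] `*` `[c, d] : set (R * R)) by exact: measurableX.
pose g : R * R -> \bar R := (EFin \o f) \_ (`[a, b] `*` `[c, d]).
have mf : measurable_fun setT g.
  apply: (measurable_restrictT _ mB).1; apply: measurable_funTS; apply/measurable_EFinP.
  exact: continuous_measurable2.
have g0 z : (0 <= g z)%E.
  by apply: erestrict_ge0 => w _; rewrite lee_fin.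
rewrite (@fubini_tonelli1 _ _ _ _ _ mu mu g mf g0).
rewrite -integral_J//; last exact: J_param_cts.
rewrite [RHS]integral_mkcond; apply: eq_integral => x _; rewrite /fubini_F /g.
have cfx : continuous (fun y => f (x, y)) by cts.
rewrite /patch; have [xab|xab] := boolP (x \in `[a, b]%classic).
  rewrite -integral_J// [RHS]integral_mkcond; apply: eq_integral => y _.
  rewrite /patch; have -> : ((x, y) \in `[a, b]%classic `*` `[c, d]%classic) = (y \in `[c, d]%classic).
    by rewrite in_setX /= xab.
  by [].
rewrite integral0_eq// => y _.
by rewrite in_setX /= (negbTE xab).
Qed.

(** The lower edge of the box is raised to [e > 0], where [f] is dominated by [S] on [D]; continuity
    of the iterated integral then lets [e] tend to 0. *)
Lemma finite_integral_box (D : set (R * R)) (S : R * R -> R) : (forall z, 0 <= S z) ->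
  (\int[mu \x mu]_(z in D) (S z)%:E < +oo)%E ->
  exists En : R, forall (B : R) (f : R * R -> R), 0 <= B -> continuous f -> (forall z, 0 <= f z) ->
    (forall z, 0 < z.2 -> f z <> 0 -> D z /\ f z <= S z) ->
    J (fun x => J (fun y => f (x, y)) 0 B) (- B) B <= En.
Proof.
move=> S0 fin; pose I := (\int[mu \x mu]_(z in D) (S z)%:E)%E.
have I0 : (0 <= I)%E by apply: integral_ge0 => z _; rewrite lee_fin.
have If : I \is a fin_num by rewrite ge0_fin_numE.
exists (fine I) => B f B0 cf f0 fS.
have key (e : R) : 0 < e -> J (fun x => J (fun y => f (x, y)) e B) (- B) B <= fine I \/ B < e.
  move=> e0; have [eB|] := leP e B; [left|by right].
  rewrite -lee_fin fineK// -(box_integral _ eB cf f0); last by lra.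
  apply: integral_le_restrict.
  - by move=> z; apply: erestrict_ge0 => w _; rewrite lee_fin.
  - by move=> z _; rewrite lee_fin.
  move=> z; rewrite /patch; case: ifPn => [|_]; last first.
    by case: ifPn => // _; rewrite lee_fin.
  rewrite in_setX => /andP[_]; rewrite inE /= in_itv /= => /andP[ez _].
  have [fz|/eqP fz] := eqVneq (f z) 0.
    by rewrite fz; case: ifPn => // _; rewrite lee_fin.
  have [Dz le] := fS z (lt_le_trans e0 ez) fz.
  by rewrite mem_set// lee_fin.
have cJ : continuous (fun e : R => J (fun x => J (fun y => f (x, y)) e B) (- B) B).
  have E (e : R) : J (fun x => J (fun y => f (x, y)) e B) (- B) B = J (fun y => J (fun x => f (x, y)) (- B) B) e B.
    exact: J_fubini.
  rewrite (_ : (fun e => _) = fun e => - J (fun y => J (fun x => f (x, y)) (- B) B) B e).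
    by apply: ctsN; apply: J_cts; apply: (@J_param_cts _ _ (fun z : R * R => f (z.2, z.1))); cts.
  by apply/funext => e; rewrite E J_sym.
have [B00|B1] := eqVneq B 0.
  by rewrite B00 oppr0 Jaa fine_ge0.
have B2 : 0 < B by rewrite lt_neqAle eq_sym B1.
rewrite -subr_ge0; apply: (@cts_ge0_closure _ (fun e => fine I - J (fun x => J (fun y => f (x, y)) e B) (- B) B)).
  by cts.
move=> e e0 _; rewrite subr_ge0.
have [//|Be] := key e e0.
have mono : J (fun x => J (fun y => f (x, y)) e B) (- B) B <= 0; last by rewrite (le_trans mono)// fine_ge0.
have cx (x : R) : continuous (fun y : R => f (x, y)) by cts.
rewrite -oppr_ge0 -JN; last by apply: (@J_param_cts _ _ f).
apply: J_ge0; [lra|by apply: ctsN; apply: (@J_param_cts _ _ f)|move=> x _].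
by rewrite -J_sym; apply: J_ge0 => //; exact: ltW.
Qed.

End Lebesgue.

(** [f] and its two first derivatives are extended separately, since each extension is only $C^1$.
    Far from the disc the equalities reconnect them, so second derivatives of [f] are first
    derivatives of [F1] and [F2]. *)
Record ext2 {R : realType} (c : R) (f F Fx Fy F1 F1x F1y F2 F2x F2y : R * R -> R) : Prop := Ext2 {
  e_F : C1 F Fx Fy; e_F1 : C1 F1 F1x F1y; e_F2 : C1 F2 F2x F2y;
  e_f : fits c f F; e_f1 : fits c (dx f) F1; e_f2 : fits c (dy f) F2;
  e_x : forall x y : R, 0 < y /\ c < x ^+ 2 + y ^+ 2 -> Fx (x, y) = F1 (x, y);
  e_y : forall x y : R, 0 < y /\ c < x ^+ 2 + y ^+ 2 -> Fy (x, y) = F2 (x, y);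
  e_xx : forall x y : R, 0 < y /\ c < x ^+ 2 + y ^+ 2 -> dx (dx f) (x, y) = F1x (x, y);
  e_yy : forall x y : R, 0 < y /\ c < x ^+ 2 + y ^+ 2 -> dy (dy f) (x, y) = F2y (x, y);
  e_xy : forall x y : R, 0 < y /\ c < x ^+ 2 + y ^+ 2 -> F1y (x, y) = F2x (x, y) }.

Section Assembly.
Context {R : realType} (r0 : R) (r00 : 0 < r0).
Local Notation D := (Omega0 r0).
Local Notation c := (r0 ^+ 2 + 3).

Lemma far_Omega0 (c' x y : R) : r0 ^+ 2 <= c' -> 0 < y /\ c' < x ^+ 2 + y ^+ 2 -> D (x, y).
Proof. by move=> rc [y0 h]; apply/(Omega0P r00); split => //=; lra. Qed.

Lemma C2_extension f : Ck_closure 2 D f ->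
  exists F Fx Fy F1 F1x F1y F2 F2x F2y, ext2 c f F Fx Fy F1 F1x F1y F2 F2x F2y.
Proof.
move=> [_ [df [ex1 [df1 [e11 _] [e12 _]]] [ex2 [df2 [e21 _] [e22 _]]]]].
have [F [Fx [Fy [CF fF]]]] := extension1 r00 df ex1 ex2.
have [F1 [F1x [F1y [CF1 fF1]]]] := extension1 r00 df1 e11 e12.
have [F2 [F2x [F2y [CF2 fF2]]]] := extension1 r00 df2 e21 e22.
exists F, Fx, Fy, F1, F1x, F1y, F2, F2x, F2y.
have inD x y : 0 < y /\ c < x ^+ 2 + y ^+ 2 -> D (x, y) by apply: far_Omega0; lra.
have E g G : fits c g G -> forall x y, 0 < y /\ c < x ^+ 2 + y ^+ 2 -> G (x, y) = g (x, y).
  by move=> H x y [y0 /ltW h]; exact: H.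
have Ex x y : 0 < y /\ c < x ^+ 2 + y ^+ 2 -> Fx (x, y) = F1 (x, y).
  move=> h; rewrite (E _ _ fF1)//; apply: (C1_dx_near CF (E _ _ fF) h).
  exact: der_dx (proj1 (df _ (inD _ _ h))).
have Ey x y : 0 < y /\ c < x ^+ 2 + y ^+ 2 -> Fy (x, y) = F2 (x, y).
  move=> h; rewrite (E _ _ fF2)//; apply: (C1_dy_near CF (E _ _ fF) h).
  exact: der_dy (proj2 (df _ (inD _ _ h))).
split.
- exact: CF.
- exact: CF1.
- exact: CF2.
- exact: fF.
- exact: fF1.
- exact: fF2.
- exact: Ex.
- exact: Ey.
- move=> x y h; symmetry; apply: (C1_dx_near CF1 (E _ _ fF1) h).
  exact: der_dx (proj1 (df1 _ (inD _ _ h))).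
- move=> x y h; symmetry; apply: (C1_dy_near CF2 (E _ _ fF2) h).
  exact: der_dy (proj2 (df2 _ (inD _ _ h))).
- exact: schwarz CF CF1 CF2 Ex Ey.
Qed.

Context (b : R) (u v p : R * R -> R).
Hypothesis uC2 : Ck_closure 2 D u.
Hypothesis vC2 : Ck_closure 2 D v.
Hypothesis sol : system_solution b D u v p.
Hypothesis v_bdry : forall x : R, r0 < `|x| -> ext D v (x, 0) = 0.
Hypothesis dyu_bdry : forall x : R, r0 < `|x| -> ext D (dy u) (x, 0) = 0.
Hypothesis fin : (dirichlet_integral D u v < +oo)%E.
Hypothesis bu_bdry : forall r : R, r0 < r -> b * polar (ext D u) r 0 = b * polar (ext D u) r pi.

Lemma flow_extension : exists r1 U Ux Uy V Vx Vy O Ox Oy P Px Py,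
  plane_flow b r1 U Ux Uy V Vx Vy O Ox Oy P Px Py /\
  forall x y : R, 0 <= y -> r1 ^+ 2 <= x ^+ 2 + y ^+ 2 -> ext D p (x, y) = P (x, y).
Proof.
have [U [Ux [Uy [U1 [U1x [U1y [U2 [U2x [U2y EU]]]]]]]]] := C2_extension uC2.
have [V [Vx [Vy [V1 [V1x [V1y [V2 [V2x [V2y EV]]]]]]]]] := C2_extension vC2.
have [CU CU1 CU2 fU fU1 fU2 Ux1 Uy2 Uxx Uyy Uxy] := EU.
have [CV CV1 CV2 fV fV1 fV2 Vx1 Vy2 Vxx Vyy Vxy] := EV.
have [cU cU1 cU2] := And3 (C1_cts CU) (C1_cts CU1) (C1_cts CU2).
have [cV cV1 cV2] := And3 (C1_cts CV) (C1_cts CV1) (C1_cts CV2).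
have [[cUx cUy _ _] [cU1x cU1y _ _] [cU2x cU2y _ _]] := And3 CU CU1 CU2.
have [[cVx cVy _ _] [cV1x cV1y _ _] [cV2x cV2y _ _]] := And3 CV CV1 CV2.
have rr := r00.
(* [p] is only known to have partial derivatives in the open set. By the equations these equal the
   continuous [Gx] and [Gy] far out, so [p] is extended from the smaller domain with radius [ra],
   where this holds up to the boundary. *)
pose ra := r0 + 2; pose c' := ra ^+ 2 + 3.
have ra0 : 0 < ra by rewrite /ra; slra bu_bdry.
have cra : c < ra ^+ 2 by rewrite /ra; nra.
have cc' : c < c' by rewrite /c'; slra bu_bdry.
have fc' x y : 0 < y /\ c' < x ^+ 2 + y ^+ 2 -> 0 < y /\ c < x ^+ 2 + y ^+ 2 by move=> [? ?]; split => //; slra bu_bdry.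
pose Gx z := U1x z + U2y z - (U z * U1 z + V z * U2 z) - b * U2 z.
pose Gy z := V1x z + V2y z - (U z * V1 z + V z * V2 z) - b * V2 z.
have cGx : continuous Gx by rewrite /Gx; cts.
have cGy : continuous Gy by rewrite /Gy; cts.
have gradp z : 0 < z.2 /\ c < z.1 ^+ 2 + z.2 ^+ 2 ->
    [/\ derivable p z ex, derivable p z ey, dx p z = Gx z & dy p z = Gy z].
  case: z => x y /= h; have [y0 /ltW h'] := h.
  have Dz : D (x, y) by apply: far_Omega0 h; slra bu_bdry.
  have [[d1 d2] m1 m2 _] := sol Dz; split; [exact: d1|exact: d2| |].
    by rewrite -m1 /laplacian /Gx -Uxx// -Uyy// fU1// fU2// fU// fV.
  by rewrite -m2 /laplacian /Gy -Vxx// -Vyy// fV1// fV2// fU// fV.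
have [P [Px [Py [CP fP]]]] : exists F Fx Fy, C1 F Fx Fy /\ fits c' p F.
  apply: (@C1_extension _ ra ra0 (ra ^+ 2 + 1) (ra ^+ 2 + 2) c' _ _ _ p Gx Gy); rewrite ?/c'; try slra bu_bdry.
  - exact: continuous_subspaceT.
  - exact: continuous_subspaceT.
  - by move=> z /(Omega0P ra0) [z0 h]; apply: gradp; split => //; slra bu_bdry.
have Pfar x y : 0 < y /\ c' < x ^+ 2 + y ^+ 2 -> P (x, y) = p (x, y) by move=> [y0 /ltW]; exact: fP.
have PxE x y : 0 < y /\ c' < x ^+ 2 + y ^+ 2 -> Px (x, y) = Gx (x, y).
  move=> h; have [d1 _ <- _] := gradp (x, y) (fc' _ _ h).
  exact: (C1_dx_near CP Pfar h (der_dx d1)).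
have PyE x y : 0 < y /\ c' < x ^+ 2 + y ^+ 2 -> Py (x, y) = Gy (x, y).
  move=> h; have [_ d2 _ <-] := gradp (x, y) (fc' _ _ h).
  exact: (C1_dy_near CP Pfar h (der_dy d2)).
have divE x y : 0 < y /\ c < x ^+ 2 + y ^+ 2 -> U1 (x, y) + V2 (x, y) = 0.
  move=> h; have [y0 /ltW h'] := h; rewrite fU1// fV2//.
  have Dz : D (x, y) by apply: far_Omega0 h; slra bu_bdry.
  by have [] := sol Dz.
have Cdiv := C1_add CU1 CV2.
have divx x y : 0 < y /\ c < x ^+ 2 + y ^+ 2 -> U1x (x, y) + V2x (x, y) = 0.
  move=> h; apply: (@C1_dx_near _ _ _ _ _ (fun=> 0) x y 0 Cdiv divE h); exact: der_cst.
have divy x y : 0 < y /\ c < x ^+ 2 + y ^+ 2 -> U1y (x, y) + V2y (x, y) = 0.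
  move=> h; apply: (@C1_dy_near _ _ _ _ _ (fun=> 0) x y 0 Cdiv divE h); exact: der_cst.
have CO := C1_add CV1 (C1_opp CU2).
pose r1 := r0 + 4 + expR 1; have e0 := expR_gt0 (1 : R).
have r1c : c' < r1 ^+ 2 by rewrite /r1 /c' /ra; nra.
have r10 : 0 < r1 by rewrite /r1; slra bu_bdry.
have cls (h : R * R -> R) : continuous h -> (forall x y, 0 < y /\ c' < x ^+ 2 + y ^+ 2 -> h (x, y) = 0) ->
    forall x y, 0 <= y -> r1 ^+ 2 <= x ^+ 2 + y ^+ 2 -> h (x, y) = 0.
  move=> ch h0 x y y0 q; apply: (far_closure ch h0 y0); slra bu_bdry.
have far0 (x : R) : r1 ^+ 2 <= x ^+ 2 -> r1 <= `|x|.
  by rewrite -(real_normK (num_real x)) ler_sqr ?nnegrE// ltW.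
have extU f G x y : continuous G -> fits c f G -> 0 <= y -> c < x ^+ 2 + y ^+ 2 -> ext D f (x, y) = G (x, y).
  by move=> cG fG y0 q; apply: (ext_fits r00 cG fG) => //; slra bu_bdry.
have far2 x : c < x ^+ 2 -> r0 < `|x|.
  move=> h; rewrite -(@ltr_sqr _ r0) ?nnegrE ?(ltW rr)// real_normK ?num_real//; slra bu_bdry.
have V0 x : c < x ^+ 2 -> V (x, 0) = 0.
  move=> h; rewrite -(extU v V x 0 cV fV) ?v_bdry//; first exact: far2.
  by rewrite expr0n addr0.
exists r1, U, Ux, Uy, V, Vx, Vy, (fun z => V1 z + - U2 z), (fun z => V1x z + - U2x z), (fun z => V1y z + - U2y z), P, Px, Py.
split; last first.
  move=> x y y0 q; apply: (ext_fits r00 (C1_cts CP) fP) => //; rewrite /c' in r1c *; slra bu_bdry.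
have [cPx cPy _ _] := CP.
split => //.
- by rewrite /r1; slra bu_bdry.
- apply: (cls (fun z => Ux z + Vy z)); first by cts.
  by move=> x y /fc' h; rewrite Ux1// Vy2// divE.
- move=> x y y0 q; apply/eqP; rewrite -subr_eq0; apply/eqP.
  apply: (cls (fun z => V1 z + - U2 z - (Vx z - Uy z))) => //; first by cts.
  by move=> x' y' /fc' h; rewrite Vx1// Uy2//; ring.
- move=> x y y0 q; apply/eqP; rewrite -subr_eq0; apply/eqP.
  apply: (cls (fun z => Px z - (- (V1y z + - U2y z) - U z * Ux z - (V z + b) * Uy z))) => //; first by cts.
  move=> x' y' h; have h' := fc' _ _ h; rewrite PxE// /Gx Ux1// Uy2// Vxy//.
  by have := divx _ _ h'; slra bu_bdry.
- move=> x y y0 q; apply/eqP; rewrite -subr_eq0; apply/eqP.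
  apply: (cls (fun z => Py z - ((V1x z + - U2x z) - U z * Vx z - (V z + b) * Vy z))) => //; first by cts.
  move=> x' y' h; have h' := fc' _ _ h; rewrite PyE// /Gy Vx1// Vy2// -Uxy//.
  by have := divy _ _ h'; slra bu_bdry.
- by move=> x q; apply: V0; slra bu_bdry.
- move=> x q; have cx : c < x ^+ 2 + 0 ^+ 2 by rewrite expr0n addr0; slra bu_bdry.
  have cx2 : c < x ^+ 2 by slra bu_bdry.
  have -> : U2 (x, 0) = 0.
    by rewrite -(extU (dy u) U2 x 0 cU2 fU2)// dyu_bdry// far2.
  have -> : V1 (x, 0) = Vx (x, 0).
    apply/eqP; rewrite -subr_eq0; apply/eqP.
    apply: (cls (fun z => V1 z - Vx z)) => //; first by cts.
      by move=> x' y' /fc' h; rewrite Vx1// subrr.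
    by rewrite expr0n addr0.
  (* [v] vanishes along the axis, hence so does its tangential derivative; with $\partial_y u = 0$
     the vorticity is zero there. *)
  rewrite oppr0 addr0; apply: (der_unique (C1_dx CV x 0)).
  apply: der_near (der_cst 0 x) _.
  have ch : continuous (fun t : R => t ^+ 2) by cts.
  by have := ch x; move=> /cvgr_gt /(_ _ cx2); apply: filterS => t; exact: V0.
- have pos x : 0 < x -> r1 ^+ 2 <= x ^+ 2 -> b * U (x, 0) = b * U (- x, 0).
    move=> x0 q; have cx : c < x ^+ 2 + 0 ^+ 2 by rewrite expr0n addr0; slra bu_bdry.
    have cx' : c < (- x) ^+ 2 + 0 ^+ 2 by rewrite sqrrN.
    rewrite -(extU u U x 0 cU fU)// -(extU u U (- x) 0 cU fU)//.
    have := bu_bdry (r := x); rewrite /polar cos0 sin0 cospi sinpi mulr1 mulr0 mulrN1; apply.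
    by have := far0 _ q; rewrite gtr0_norm// /r1; slra bu_bdry.
  move=> x q; have := far0 _ q; have [x0|x0] := leP 0 x.
    by rewrite (ger0_norm x0) => h; apply: pos => //; slra bu_bdry.
  by rewrite (ltr0_norm x0) => h; have := pos (- x); rewrite opprK sqrrN => ->//; slra bu_bdry.
- have S0 z : 0 <= sqr_grad u v z by rewrite /sqr_grad !addr_ge0 ?sqr_ge0.
  have [En HEn] := finite_integral_box S0 fin.
  (* One [En] for each half of the square: the energy density is reflected evenly in $y$. *)
  exists (En + En) => B f B0 cf fe fz.
  have f0 z : 0 <= f z by case: z => x y; have /andP[] := fe x y.
  have cfx (x : R) : continuous (fun y : R => f (x, y)) by cts.
  have sg x y : 0 < y -> r1 ^+ 2 < x ^+ 2 + y ^+ 2 -> D (x, y) /\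
      Ux (x, y) ^+ 2 + Uy (x, y) ^+ 2 + Vx (x, y) ^+ 2 + Vy (x, y) ^+ 2 = sqr_grad u v (x, y).
    move=> y0 q; have h : 0 < y /\ c < x ^+ 2 + y ^+ 2 by split => //; slra bu_bdry.
    have [_ /ltW h'] := h; split; first by apply: far_Omega0 h; slra bu_bdry.
    by rewrite /sqr_grad Ux1// Uy2// Vx1// Vy2// fU1// fU2// fV1// fV2.
  pose f' (z : R * R) := f (z.1, - z.2).
  have cf' : continuous f' by rewrite /f'; cts.
  have fin1 := HEn B f B0 cf f0; have fin2 := HEn B f' B0 cf' (fun z => f0 _).
  have {}fin1 : J (fun x => J (fun y => f (x, y)) 0 B) (- B) B <= En.
    apply: fin1 => -[x y] /= y0 fn.
    have q : r1 ^+ 2 < x ^+ 2 + y ^+ 2 by rewrite ltNge; apply/negP => h; apply: fn; exact: fz.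
    have [Dz <-] := sg x y y0 q; split => //.
    by have /andP[_] := fe x y; rewrite (gtr0_norm y0).
  have {}fin2 : J (fun x => J (fun y => f' (x, y)) 0 B) (- B) B <= En.
    apply: fin2 => -[x y] /= y0; rewrite /f' /= => fn.
    have q : r1 ^+ 2 < x ^+ 2 + y ^+ 2.
      by rewrite ltNge; apply/negP => h; apply: fn; apply: fz; rewrite sqrrN.
    have [Dz <-] := sg x y y0 q; split => //.
    by have /andP[_] := fe x (- y); rewrite normrN (gtr0_norm y0).
  rewrite (_ : (fun x => J (fun y => f (x, y)) (- B) B) = fun x => J (fun y => f (x, y)) 0 B + J (fun y => f' (x, y)) 0 B).
    rewrite JD; first exact: lerD.
      exact: (@J_param_cts _ _ f).
    exact: (@J_param_cts _ _ f').
  apply/funext => x; rewrite (J_cat _ (- B) 0 B) addrC; congr (_ + _).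
  by have := @J_opp _ _ 0 B (cfx x); rewrite oppr0.
Qed.

End Assembly.

Theorem theorem3 (R : realType) (r0 b : R) (u v p : R * R -> R)
  (r0_gt0 : 0 < r0)
  (uC2 : Ck_closure 2 (Omega0 r0) u)
  (vC2 : Ck_closure 2 (Omega0 r0) v)
  (uvp_sol : system_solution b (Omega0 r0) u v p)
  (v_bdry : forall x : R, r0 < `|x| -> ext (Omega0 r0) v (x, 0) = 0)
  (dyu_bdry : forall x : R, r0 < `|x| -> ext (Omega0 r0) (dy u) (x, 0) = 0)
  (finite_dirichlet : (dirichlet_integral (Omega0 r0) u v < +oo)%E)
  (bu_bdry : forall r : R, r0 < r ->
     b * polar (ext (Omega0 r0) u) r 0 = b * polar (ext (Omega0 r0) u) r pi) :
  (forall e : R, 0 < e ->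
     \forall r \near +oo, forall t : R, 0 <= t <= pi ->
       `|polar (ext (Omega0 r0) p) r t| <= e * ln r) /\
  (exists c : R, forall t : R, 0 <= t <= pi ->
     polar (ext (Omega0 r0) p) r t - c @[r --> +oo] --> 0).
Proof.
have [r1 [U [Ux [Uy [V [Vx [Vy [w [wx [wy [P [Px [Py [F PE]]]]]]]]]]]]]] :=
  flow_extension r0_gt0 uC2 vC2 uvp_sol v_bdry dyu_bdry finite_dirichlet bu_bdry.
have r10 := r1_gt0 F; have [c Hc] := uniform_limit F.
have key eta : 0 < eta -> exists2 R1, 0 < R1 & forall r t, R1 <= r -> 0 <= t <= pi ->
    `|polar (ext (Omega0 r0) p) r t - c| <= eta.
  move=> /Hc[R1 [R10 HR1]]; exists (R1 + r1) => [|r t hr tt]; first by lra.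
  have nrm : (r * cos t) ^+ 2 + (r * sin t) ^+ 2 = r ^+ 2 by rewrite !exprMn -mulrDr cos2Dsin2 mulr1.
  have y0 : 0 <= r * sin t by rewrite mulr_ge0 ?sin_ge0_pi//; lra.
  rewrite /polar PE//; last by rewrite nrm ler_sqr ?nnegrE; lra.
  by apply: HR1 => //; rewrite nrm ler_sqr ?nnegrE; lra.
split.
  (* Far out the pressure is at most $|c| + 1$ in modulus, which $e \log r$ exceeds for large
     $r$. *)
  move=> e e0; have [R1 R10 HR1] := key 1 ltr01.
  near=> r => t tt.
  have rR1 : R1 <= r by near: r; apply: nbhs_pinfty_ge; exact: num_real.
  have rE : expR ((`|c| + 1) / e) <= r by near: r; apply: nbhs_pinfty_ge; exact: num_real.
  have r_gt0 : 0 < r by lra.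
  have : (`|c| + 1) / e <= ln r by rewrite -[leLHS]expRK ler_ln ?posrE ?expR_gt0.
  rewrite ler_pdivrMr// mulrC; apply: le_trans.
  rewrite -[X in `|X|](subrK c); apply: le_trans (ler_normD _ _) _.
  by rewrite addrC lerD2l; exact: HR1.
exists c => t tt; apply/cvgrPdist_le => e e0; have [R1 R10 HR1] := key e e0.
near=> r; rewrite sub0r normrN; apply: HR1 => //.
Unshelve. all: by end_near.
Qed.
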